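(* Let $T\in(0,\infty)$, $d\ge1$ and $\delta\in[0,1)$. The following hold. (i) Almost every $\varphi\in C^\delta([0,T];\mathbb{R}^d)$ has the property that $$\dim_F(\varphi([s,t]))=\dim_H(\varphi([s,t]))=\frac1\delta\wedge d\qquad\text{for all }[s,t]\subset[0,T],\ s<t.$$ (ii) If additionally $\delta<1/(2d)$, then almost every $\varphi\in C^\delta([0,T];\mathbb{R}^d)$ has the property that, for all $[s,t]\subset[0,T]$ with $s<t$, $\varphi([s,t])$ contains a (nonempty) open set. In particular, for all $\delta\in[0,1)$, the image of almost every function $\varphi\in C^\delta([0,T];\mathbb{R}^d)$ is a Salem set.
   Context: Convention: $1/\delta=+\infty$ for $\delta=0$. $C^\delta([0,T];\mathbb{R}^d)$ is the Banach space of $\delta$-Hölder continuous paths for $\delta\in(0,1)$, and of continuous paths with the supremum norm for $\delta=0$. Prevalence: let $E$ be a Banach space. A Borel set $A\subset E$ is shy if there is a Borel measure $\mu$ on $E$ such that $0<\mu(K)<\infty$ for some compact $K\subset E$ and $\mu(v+A)=0$ for all $v\in E$. A subset of $E$ is shy if contained in a shy Borel set; the complement of a shy set is prevalent. ''Almost every $\varphi\in E$ satisfies a property'' means that the set of $\varphi\in E$ satisfying it is prevalent. Dimensions: for Borel $E\subset\mathbb{R}^d$, let $\mathcal{M}_+(E)$ be the set of (nonzero, finite) positive Radon measures supported on $E$. Then $$\dim_F(E)=\sup\{\alpha\in[0,d]:\exists\,\mu\in\mathcal{M}_+(E)\text{ with }\sup_\xi(1+|\xi|^2)^{\alpha/4}|\hat\mu(\xi)|<\infty\},$$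 $$\dim_H(E)=\sup\Big\{\alpha\in[0,d]:\exists\,\mu\in\mathcal{M}_+(E)\text{ with }\int_{\mathbb{R}^{2d}}\frac{\mu(dx)\mu(dy)}{|x-y|^\alpha}<\infty\Big\}$$ (Fourier and Hausdorff dimension). A Borel set $E$ is a Salem set if $\dim_F(E)=\dim_H(E)$. *)

(* Defs.v *)
(* Based on MathComp-Analysis, over an arbitrary R : realType. *)
From HB Require Import structures.
From mathcomp Require Import all_boot all_order all_algebra.
From mathcomp Require Import complex.
From mathcomp Require Import all_classical all_reals all_analysis.
From mathcomp Require Import ring lra.

Set Implicit Arguments.
Unset Strict Implicit.
Unset Printing Implicit Defensive.

Import Order.TTheory GRing.Theory Num.Theory.
Import numFieldNormedType.Exports.

Local Open Scope classical_set_scope.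
Local Open Scope ring_scope.

Section euclid.
Context (R : realType) (d : nat).
Implicit Types x y : 'rV[R]_d.

Definition dotv x y : R := \sum_(i < d) x 0 i * y 0 i.

(* The library norm `|x| on 'rV[R]_d is the maximum norm. *)
Definition euclid x : R := Num.sqrt (dotv x x).

Lemma dotv_ge0 x : 0 <= dotv x x.
Proof. by apply: sumr_ge0 => i _; rewrite -expr2 sqr_ge0. Qed.

Lemma euclid_ge0 x : 0 <= euclid x.
Proof. exact: sqrtr_ge0. Qed.

Lemma sqr_euclid x : euclid x ^+ 2 = dotv x x.
Proof. by rewrite sqr_sqrtr// dotv_ge0. Qed.

Lemma ler_coord_euclid x i : `|x 0 i| <= euclid x.
Proof.
rewrite -sqrtr_sqr ler_wsqrtr// /dotv (bigD1 i)//= expr2 lerDl.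
by apply: sumr_ge0 => j _; rewrite -expr2 sqr_ge0.
Qed.

Lemma ler_norm_euclid x : `|x| <= euclid x.
Proof.
rewrite [leLHS]/Num.norm /= mx_normrE; apply: bigmax_le; first exact: euclid_ge0.
by move=> -[i j] _ /=; rewrite (ord1 i) ler_coord_euclid.
Qed.

Lemma ler_euclid_norm x : euclid x <= d%:R * `|x|.
Proof.
have cx i : `|x 0 i| <= `|x|.
  by rewrite [leRHS]/Num.norm /= mx_normrE; apply: (le_bigmax _ _ (0, i)).
rewrite -ler_sqr ?nnegrE ?euclid_ge0 ?mulr_ge0// sqr_euclid.
apply: (@le_trans _ _ (\sum_(i < d) `|x| ^+ 2)).
  apply: ler_sum => i _; rewrite -expr2 -real_normK ?num_real//.
  by rewrite ler_sqr ?nnegrE.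
rewrite sumr_const card_ord exprMn -[leLHS]mulr_natl ler_wpM2r ?sqr_ge0//.
by rewrite -natrX ler_nat; case: (d) => // n; rewrite leq_pmulr.
Qed.

Lemma euclid_eq0 x : euclid x = 0 -> x = 0.
Proof.
by move=> x0; apply/normr0_eq0/le_anti; rewrite normr_ge0 andbT -x0 ler_norm_euclid.
Qed.

Lemma euclid0 : euclid 0 = 0.
Proof.
by apply/le_anti; rewrite euclid_ge0 andbT (le_trans (ler_euclid_norm _))// normr0 mulr0.
Qed.

Lemma euclidZ (a : R) x : euclid (a *: x) = `|a| * euclid x.
Proof.
rewrite /euclid -sqrtr_sqr -sqrtrM ?sqr_ge0//; congr Num.sqrt.
by rewrite /dotv mulr_sumr; apply: eq_bigr => i _; rewrite !mxE; ring.
Qed.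

Lemma dotv_le x y : dotv x y <= euclid x * euclid y.
Proof.
have [y0|y0] := eqVneq (euclid y) 0.
  rewrite y0 (euclid_eq0 y0) mulr0 /dotv big1// => i _.
  by rewrite mxE mulr0.
have b0 : 0 < dotv y y by rewrite -sqr_euclid exprn_gt0// lt_def y0 euclid_ge0.
apply: (le_trans (ler_norm _)).
rewrite -ler_sqr ?nnegrE ?mulr_ge0 ?euclid_ge0//.
rewrite real_normK ?num_real// exprMn !sqr_euclid -(ler_pM2l b0).
have := dotv_ge0 (dotv y y *: x - dotv x y *: y).
suff -> : dotv (dotv y y *: x - dotv x y *: y) (dotv y y *: x - dotv x y *: y) =
  dotv y y * (dotv x x * dotv y y) - dotv y y * dotv x y ^+ 2.
  by rewrite subr_ge0.
suff key (b c : R) : dotv (b *: x - c *: y) (b *: x - c *: y) =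
    b ^+ 2 * dotv x x - 2 * b * c * dotv x y + c ^+ 2 * dotv y y.
  by rewrite key; ring.
rewrite /dotv !mulr_sumr -sumrB -big_split/=.
by apply: eq_bigr => i _; rewrite !mxE; ring.
Qed.

Lemma ler_euclidD x y : euclid (x + y) <= euclid x + euclid y.
Proof.
rewrite -ler_sqr ?nnegrE ?addr_ge0 ?euclid_ge0// sqrrD !sqr_euclid.
have -> : dotv (x + y) (x + y) = dotv x x + dotv x y *+ 2 + dotv y y.
  rewrite mulr2n /dotv -!big_split/=.
  by apply: eq_bigr => i _; rewrite !mxE; ring.
by rewrite lerD2r lerD2l lerMn2r dotv_le orbT.
Qed.

Lemma euclidN x : euclid (- x) = euclid x.
Proof. by rewrite -scaleN1r euclidZ normrN normr1 mul1r. Qed.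

End euclid.

Section sup_ge0.
Context (R : realType).
Implicit Type A : set R.

Lemma sup_le_ge0 A b : ubound A b -> 0 <= b -> sup A <= b.
Proof.
move=> Ab b0; have [->|/set0P A0] := eqVneq A set0; first by rewrite sup0.
exact: ge_sup.
Qed.

Lemma sup_ge0 A : (forall x, A x -> 0 <= x) -> 0 <= sup A.
Proof.
move=> A0; have [[[x Ax] ubA]|noA] := pselect (has_sup A).
  exact: le_trans (A0 _ Ax) (ub_le_sup ubA Ax).
by rewrite sup_out.
Qed.

End sup_ge0.

Section holder_space.
Context (R : realType) (T : R) (d : nat) (delta : R).

Definition time : set R := `[0, T].

Implicit Types f g : time -> 'rV[R]_d.

(* Continuity is redundant for 0 < delta, and is the only condition for      *)
(* delta = 0.                                                                *)
Definition holder_path : {pred time -> 'rV[R]_d} :=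
  mem [set f : time -> 'rV[R]_d | continuous f /\
    (0 < delta -> exists K : R, forall u v : time,
      euclid (f u - f v) <= K * `|val u - val v| `^ delta)].

Definition sup_norm f : R := sup (range (fun u => euclid (f u))).

Definition holder_seminorm f : R :=
  sup [set euclid (f w.1 - f w.2) / `|val w.1 - val w.2| `^ delta |
       w in [set w : time * time | w.1 != w.2]].

(* For delta = 0 this is the supremum norm.                                  *)
Definition holder_norm f : R :=
  sup_norm f + (if 0 < delta then holder_seminorm f else 0).

Lemma holder_path_bounded f : f \in holder_path ->
  exists M, forall u, euclid (f u) <= M.
Proof.
rewrite inE => -[cf _].
have := @continuous_compact _ _ (valL f) time
  ((@subspace_valL_continuousP _ _ _ f).2 cf) (@segment_compact _ _ _).
move=> /compact_bounded/pinfty_ex_gt0[M M0 bM]; exists (d%:R * M) => u.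
apply: le_trans (ler_euclid_norm _) _; apply: ler_wpM2l => //; apply: bM.
exists (val u); first exact: set_valP.
by have := congr1 (fun g => g u) (valLK (point : 'rV[R]_d) f).
Qed.

Lemma le_sup_norm f u : f \in holder_path -> euclid (f u) <= sup_norm f.
Proof.
move=> /holder_path_bounded[M fM]; apply: ub_le_sup; last by exists u.
by exists M => _ [v _ <-]; exact: fM.
Qed.

Lemma sup_norm_le f a : 0 <= a -> (forall u, euclid (f u) <= a) ->
  sup_norm f <= a.
Proof. by move=> a0 fa; apply: sup_le_ge0 => // _ [u _ <-]; exact: fa. Qed.

Lemma sup_norm_ge0 f : 0 <= sup_norm f.
Proof. by apply: sup_ge0 => _ [u _ <-]; exact: euclid_ge0. Qed.

Lemma dist_gt0 (u v : time) : u != v -> 0 < `|val u - val v| `^ delta.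
Proof. by move=> uv; rewrite powR_gt0// normr_gt0 subr_eq0. Qed.

Lemma le_holder_seminorm f u v : f \in holder_path -> 0 < delta ->
  euclid (f u - f v) <= holder_seminorm f * `|val u - val v| `^ delta.
Proof.
rewrite inE => -[_ fK] /[dup] d0 /fK[K {}fK].
have [->|uv] := eqVneq u v; first by rewrite !subrr euclid0 normr0 powR0 ?gt_eqF ?mulr0.
rewrite -ler_pdivrMr ?dist_gt0//; apply: ub_le_sup; last by exists (u, v).
by exists K => _ [[x y] /= xy <-]; rewrite ler_pdivrMr ?dist_gt0.
Qed.

Lemma holder_seminorm_le f a : 0 <= a ->
  (forall u v, euclid (f u - f v) <= a * `|val u - val v| `^ delta) ->
  holder_seminorm f <= a.
Proof.
move=> a0 fa; apply: sup_le_ge0 => // _ [[x y] /= xy <-].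
by rewrite ler_pdivrMr ?dist_gt0.
Qed.

Lemma holder_seminorm_ge0 f : 0 <= holder_seminorm f.
Proof.
by apply: sup_ge0 => _ [u _ <-]; rewrite divr_ge0 ?euclid_ge0 ?powR_ge0.
Qed.

Lemma holder_path_submod_closed : submod_closed holder_path.
Proof.
split.
  rewrite inE; split; first exact: cst_continuous.
  by exists 0 => u v; rewrite subrr euclid0 mul0r.
move=> a f g; rewrite !inE => -[cf fK] [cg gK]; split.
  move=> x; have cfx : a *: f u @[u --> x] --> a *: f x.
    apply: (@cvg_comp _ _ _ f (fun y => a *: y) _ _ _ (cf x)).
    exact: scaler_continuous.
  exact: (@cvgD _ _ _ (nbhs x) _ _ _ _ _ cfx (cg x)).
move=> /[dup] /fK[K {}fK] /gK[L {}gK]; exists (`|a| * K + L) => u v.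
have -> : (a *: f + g) u - (a *: f + g) v = a *: (f u - f v) + (g u - g v).
  by rewrite scalerBr opprD addrACA.
rewrite (le_trans (ler_euclidD _ _))// euclidZ mulrDl -mulrA lerD//.
by rewrite ler_wpM2l.
Qed.

HB.instance Definition _ := GRing.isSubmodClosed.Build _ _ holder_path
  holder_path_submod_closed.

Record holder := Holder {
  holder_fun :> time -> 'rV[R]_d ;
  holder_funP : holder_fun \in holder_path }.

HB.instance Definition _ := [isSub for holder_fun].
HB.instance Definition _ := [Choice of holder by <:].
HB.instance Definition _ := [SubChoice_isSubLmodule of holder by <:].

Implicit Types p q : holder.

Lemma ler_holder_normD p q :
  holder_norm (p + q)%R <= holder_norm p + holder_norm q.
Proof.
rewrite /holder_norm addrACA; apply: lerD.
  apply: sup_norm_le; first by rewrite addr_ge0 ?sup_norm_ge0.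
  move=> u; apply: le_trans (ler_euclidD _ _) _.
  by rewrite lerD// le_sup_norm// holder_funP.
case: ifPn => d0; last by rewrite addr0.
apply: holder_seminorm_le; first by rewrite addr_ge0 ?holder_seminorm_ge0.
move=> u v; rewrite mulrDl.
have -> : (p + q) u - (p + q) v = (p u - p v) + (q u - q v).
  by rewrite opprD addrACA.
apply: le_trans (ler_euclidD _ _) _.
by rewrite lerD// le_holder_seminorm// holder_funP.
Qed.

Lemma holder_normZ_le (a : R) p : holder_norm (a *: p) <= `|a| * holder_norm p.
Proof.
rewrite /holder_norm mulrDr; apply: lerD.
  apply: sup_norm_le; first by rewrite mulr_ge0 ?sup_norm_ge0.
  by move=> u; rewrite euclidZ ler_wpM2l// le_sup_norm// holder_funP.
case: ifPn => d0; last by rewrite mulr0.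
apply: holder_seminorm_le; first by rewrite mulr_ge0 ?holder_seminorm_ge0.
move=> u v; have -> : (a *: p) u - (a *: p) v = a *: (p u - p v).
  by rewrite scalerBr.
by rewrite euclidZ -mulrA ler_wpM2l// le_holder_seminorm// holder_funP.
Qed.

Lemma holder_norm_ge0 f : 0 <= holder_norm f.
Proof.
by rewrite addr_ge0 ?sup_norm_ge0//; case: ifP => // _; exact: holder_seminorm_ge0.
Qed.

Lemma holder_normZ (a : R) p : holder_norm (a *: p) = `|a| * holder_norm p.
Proof.
apply/le_anti; rewrite holder_normZ_le/=.
have [->|a0] := eqVneq a 0; first by rewrite normr0 mul0r holder_norm_ge0.
have := holder_normZ_le a^-1 (a *: p).
by rewrite scalerA mulVf// scale1r normfV ler_pdivlMl ?normr_gt0.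
Qed.

Lemma holder_norm_eq0 p : holder_norm p = 0 -> p = 0.
Proof.
move=> p0; apply/val_inj/funext => u; apply: euclid_eq0.
apply/le_anti; rewrite euclid_ge0 andbT -p0.
apply: le_trans (le_sup_norm u (holder_funP p)) _; rewrite lerDl.
by case: ifP => // _; exact: holder_seminorm_ge0.
Qed.

HB.instance Definition _ := @Lmodule_isNormed.Build R holder
  (fun p => holder_norm p) ler_holder_normD holder_normZ holder_norm_eq0.

Lemma le_holder_norm p u : euclid (p u) <= holder_norm p.
Proof.
apply: le_trans (le_sup_norm u (holder_funP p)) _; rewrite lerDl.
by case: ifP => // _; exact: holder_seminorm_ge0.
Qed.

Lemma holder_complete (F : set_system holder) :
  ProperFilter F -> cauchy F -> cvg F.
Proof.
move=> FF /cauchy_ballP Fc.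
have {}Fc e : 0 < e -> \forall p & q \near F, holder_norm (q - p : holder) <= e.
  move=> e0; have := Fc e e0; apply: filterS => -[p q] /=.
  by rewrite -ball_normE /= distrC => /ltW.
have Fnear e : 0 < e -> \forall p \near F, \forall q \near F, holder_norm (q - p : holder) <= e.
  by move=> /Fc/nearP_dep.
have Fcvg u : cvg ((fun p : holder => p u) @ F).
  apply/cauchy_cvgP/cauchy_ballP => e e0; rewrite !near_map2.
  have e20 : 0 < e / 2 by rewrite divr_gt0.
  have := Fc _ e20; apply: filterS => -[p q] /= pq.
  rewrite -ball_normE /= distrC.
  apply: le_lt_trans (ler_norm_euclid _) _.
  apply: le_lt_trans (le_holder_norm (q - p) u) _.
  by apply: le_lt_trans pq _; rewrite ltr_pdivrMr// ltr_pMr// ltr1n.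
pose l (u : time) : 'rV[R]_d := lim ((fun p : holder => p u) @ F).
have euc (v : holder -> 'rV[R]_d) w b : v p @[p --> F] --> w ->
    (\forall p \near F, euclid (v p) <= b) -> euclid w <= b.
  move=> vw vb; apply/ler_addgt0Pr => e e0.
  have ed0 : 0 < e / d.+1%:R by rewrite divr_gt0.
  move/cvgrPdist_le : vw => /(_ _ ed0) vw; near F => p.
  rewrite -(subrK (v p) w) addrC.
  apply: le_trans (ler_euclidD _ _) _; apply: lerD; first by near: p.
  apply: le_trans (ler_euclid_norm _) _.
  apply: (@le_trans _ _ (d.+1%:R * (e / d.+1%:R))); last by rewrite mulrC divfK.
  by apply: ler_pM => //; [rewrite ler_nat|near: p].
pose close e (p : holder) := (forall u, euclid (l u - p u) <= e) /\
  (0 < delta -> forall u v, euclid ((l u - p u) - (l v - p v)) <=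
     e * `|val u - val v| `^ delta).
have unif e : 0 < e -> \forall p \near F, close e p.
  move=> e0; have := Fnear e e0; apply: filterS => p pF; split => [u|d0 u v].
    apply: (euc (fun q => q u - p u)).
      exact: (@cvgB _ _ _ F _ _ _ _ _ (Fcvg u) (cvg_cst _)).
    apply: filterS pF => q; apply: le_trans; exact: (le_holder_norm (q - p)).
  apply: (euc (fun q => (q u - p u) - (q v - p v))).
    apply: (@cvgB _ _ _ F).
      exact: (@cvgB _ _ _ F _ _ _ _ _ (Fcvg u) (cvg_cst _)).
    exact: (@cvgB _ _ _ F _ _ _ _ _ (Fcvg v) (cvg_cst _)).
  apply: filterS pF => q qp.
  apply: le_trans (le_holder_seminorm u v (holder_funP (q - p)) d0) _.
  rewrite ler_wpM2r ?powR_ge0//; apply: le_trans qp.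
  by rewrite /holder_norm d0 lerDr sup_norm_ge0.
have lP : l \in holder_path.
  rewrite inE; split.
    move=> u; apply/(@cvgrPdist_le _ _ _ (nbhs u) (nbhs_filter u)) => e e0.
    have e30 : 0 < e / 3 by rewrite divr_gt0.
    near F => p.
    have [lp _] : close (e / 3) p by near: p; exact: unif.
    have /set_mem[cp _] := holder_funP p.
    have /(@cvgrPdist_le _ _ _ (nbhs u) (nbhs_filter u))/(_ _ e30) := cp u; apply: filterS => v puv.
    have -> : l u - l v = (l u - p u) + (p u - p v) - (l v - p v).
      by apply/matrixP => i j; rewrite !mxE; ring.
    have -> : e = e / 3 + e / 3 + e / 3 by field.
    apply: le_trans (ler_normB _ _) _; apply: lerD.
      apply: le_trans (ler_normD _ _) _; apply: lerD => //.
      exact: le_trans (ler_norm_euclid _) (lp _).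
    exact: le_trans (ler_norm_euclid _) (lp _).
  move=> d0; near F => p.
  have [_ /(_ d0) lp] : close 1 p by near: p; exact: unif.
  exists (1 + holder_seminorm p) => u v; rewrite mulrDl.
  have -> : l u - l v = ((l u - p u) - (l v - p v)) + (p u - p v).
    by apply/matrixP => i j; rewrite !mxE; ring.
  apply: le_trans (ler_euclidD _ _) _; apply: lerD => //.
  exact: le_holder_seminorm (holder_funP p) d0.
apply/cvg_ex; exists (Holder lP); apply/cvgrPdist_le => e e0.
have e20 : 0 < e / 2 by rewrite divr_gt0.
have := unif _ e20; apply: filterS => p [lp1 lp2].
rewrite [leLHS]/Num.norm/= /holder_norm [leRHS]splitr; apply: lerD.
  by apply: sup_norm_le; [exact: ltW|exact: lp1].
case: ifPn => [d0|_]; last exact: ltW.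
by apply: holder_seminorm_le; [exact: ltW|exact: lp2].
Unshelve. all: by end_near. Qed.

HB.instance Definition _ := Uniform_isComplete.Build holder holder_complete.

End holder_space.

Notation borelType X := (g_sigma_algebraType (@open X)).

Section prevalence.
Context (R : realType) (E : completeNormedModType R).

Definition borel_shy (A : set E) : Prop :=
  (@open E).-sigma.-measurable A /\
  exists mu : {measure set (borelType E) -> \bar R},
    (exists2 K : set E, compact K & (0 < mu K < +oo)%E) /\
    (forall v : E, mu [set v + a | a in A] = 0%E).

Definition shy (A : set E) : Prop := exists2 B, borel_shy B & A `<=` B.

Definition prevalent (A : set E) : Prop := shy (~` A).

Definition almost_every (P : E -> Prop) : Prop := prevalent [set x | P x].

End prevalence.

Section dimensions.
Context (R : realType) (d : nat).

Local Notation Rd := 'rV[R]_d.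

(* A finite Borel measure on R^d is automatically Radon. *)
Definition Mplus (A : set Rd) :
    set {finite_measure set (borelType Rd) -> \bar R} :=
  [set mu | (0 < mu setT)%E /\ mu (~` A) = 0%E].

(* \int exp (i xi.x) mu(dx), with real and imaginary parts given separately. *)
Definition fourier (mu : {finite_measure set (borelType Rd) -> \bar R})
    (xi : Rd) : R[i] :=
  Complex (\int[mu]_x cos (dotv xi x)) (\int[mu]_x sin (dotv xi x)).

Definition fourier_decay (alpha : R)
    (mu : {finite_measure set (borelType Rd) -> \bar R}) : \bar R :=
  ereal_sup [set ((1 + euclid xi ^+ 2) `^ (alpha / 4) *
                  ComplexField.Normc.normc (fourier mu xi))%:E | xi in [set: Rd]].

(* sup is the real-valued supremum, with sup set0 = 0.                       *)
Definition dim_F (A : set Rd) : R :=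
  sup [set alpha | 0 <= alpha <= d%:R /\
    exists2 mu, Mplus A mu & (fourier_decay alpha mu < +oo)%E].

(* On the diagonal the value is +oo for 0 < alpha and 1 for alpha = 0, since *)
(* 0^-1 = +oo in \bar R and 0 `^ 0 = 1.                                      *)
Definition riesz_kernel (alpha : R) (x y : Rd) : \bar R :=
  ((euclid (x - y) `^ alpha)%:E)^-1%E.

Definition energy (alpha : R)
    (mu : {finite_measure set (borelType Rd) -> \bar R}) : \bar R :=
  (\int[(mu \x mu)%E]_z riesz_kernel alpha z.1 z.2)%E.

Definition dim_H (A : set Rd) : R :=
  sup [set alpha | 0 <= alpha <= d%:R /\
    exists2 mu, Mplus A mu & (energy alpha mu < +oo)%E].

Definition salem (A : set Rd) : Prop :=
  (@open Rd).-sigma.-measurable A /\ dim_F A = dim_H A.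

End dimensions.

Definition path_image (R : realType) (T : R) (d : nat) (delta : R)
    (phi : holder T d delta) (s t : R) : set 'rV[R]_d :=
  [set phi u | u in [set u : time T | s <= val u <= t]].

(* Main.v *)
(* A random path W is built as a sum over levels m of trapezoids on the cells of length T / 4^m, with
   independent signs as coefficients. Let v be any path. Flipping the signs of level m on cells of one
   parity changes the phase xi.(W - v) on distinct cells independently when |xi| is comparable with
   1 / amp m, and averages the integral of exp (i xi.(W - v)) over each cell almost to 0. By
   Hoeffding's inequality and Borel-Cantelli, on every dyadic interval the occupation measure of
   almost every W - v has Fourier transform O(m 2^-m) at such frequencies, that is O(|xi|^-b) for all
   b < 1 / (2 delta). Hence the paths without this decay form a shy set, W providing the transverse
   measure.
   The decay gives dim_F >= min (1 / delta, d); conversely dim_F <= dim_H <= d, and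
   dim_H <= 1 / delta by a covering argument. If delta < 1 / (2 d), then b = a d is possible with a > 1:
   the Fourier transform is integrable, the occupation measure has a continuous density, and the image
   contains an open set. *)
Require Import Defs.
From HB Require Import structures.
From mathcomp Require Import all_boot all_order all_algebra.
From mathcomp Require Import finmap complex.
From mathcomp Require Import all_classical all_reals all_analysis.
From mathcomp Require Import measurable_realfun.
From mathcomp Require Import ring lra zify.

Set Implicit Arguments.
Unset Strict Implicit.
Unset Printing Implicit Defensive.

Import Order.TTheory GRing.Theory Num.Theory.
Import numFieldNormedType.Exports.

Local Open Scope classical_set_scope.
Local Open Scope ring_scope.

(** * Averages over signs *)

Section sign_averages.
Context {R : realType}.
Implicit Types (b : bool) (lam t : R).

(** The translate v is arbitrary, so W - v has no regularity to exploit inside a cell: cancellation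
    can only come from signs that shift the phase by a constant on a whole cell. This is why the
    bumps are flat there, and the overlap of their slopes forces the split by parity. A single sign
    damps the mean phase of a cell by a fixed factor only; a number of signs proportional to m + 1
    makes this bias smaller than the relative fluctuation 2^-m of a sum over 4^m cells.
    Borel-Cantelli needs countably many events: at level m the frequencies are rounded to a grid of
    mesh 2^-m with about 64^(d m) points, and the threshold is chosen so that the tail beats this
    number. The signs are the binary digits of a uniform point of [0, 1[, so every probability is
    bounded by a count of bit vectors. On the analytic side no Fourier inversion occurs: integrals
    of trigonometric polynomials are expanded exactly, for the energy as well as for the interior,
    and equicontinuous mollifications of the occupation measure stand in for its density. *)

Definition sgb b : R := if b then 1 else -1.

Lemma sgb_norm b : `|sgb b| = 1.
Proof. by case: b; rewrite /sgb ?normrN normr1. Qed.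

(** Independent signs make the characteristic function a product: each sign contributes a factor 2
    cos lam. The offset [x] only permutes the bits, so it disappears from the result. *)
Lemma sum_cos_bits J lam t (x : nat -> bool) :
  \sum_(u : {ffun 'I_J -> bool})
    cos (t + lam * \sum_(j < J) sgb (x j (+) u j)) =
  2 ^+ J * (cos t * cos lam ^+ J).
Proof.
suff H : \sum_(u : {ffun 'I_J -> bool})
     cos (t + lam * \sum_(j < J) sgb (x j (+) u j)) =
   2 ^+ J * (cos t * cos lam ^+ J) /\ \sum_(u : {ffun 'I_J -> bool})
     sin (t + lam * \sum_(j < J) sgb (x j (+) u j)) =
   2 ^+ J * (sin t * cos lam ^+ J) by case: H.
pose cis (a : R) : R[i] := Complex (cos a) (sin a).
have cisD (a c : R) : cis (a + c) = cis a * cis c.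
  rewrite /cis cosD sinD; apply/eqP; rewrite eq_complex /=.
  by apply/andP; split; apply/eqP; ring.
have cis_sum (u : 'I_J -> R) : cis (\sum_(j < J) u j) = \prod_(j < J) cis (u j).
  apply: (big_morph cis cisD).
  by rewrite /cis cos0 sin0.
have key : \sum_(u : {ffun 'I_J -> bool})
    cis (t + lam * \sum_(j < J) sgb (x j (+) u j)) =
    cis t * (Complex (2 * cos lam) 0) ^+ J.
  transitivity (cis t * \sum_(u : {ffun 'I_J -> bool}) \prod_(j < J)
     cis (lam * sgb (x j (+) u j))).
    by rewrite mulr_sumr; apply: eq_bigr => u _; rewrite cisD mulr_sumr cis_sum.
  rewrite -(bigA_distr_bigA (fun (j : 'I_J) b => cis (lam * sgb (x j (+) b)))) /=.
  congr (_ * _); rewrite -[in RHS](card_ord J) -prodr_const; apply: eq_bigr => j _.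
  rewrite big_bool /cis; apply/eqP; rewrite eq_complex /=.
  by case: (x j) => /=; rewrite /sgb !mulrN !mulr1 cosN sinN;
    apply/andP; split; apply/eqP; ring.
have powC : (Complex (2 * cos lam) 0) ^+ J = Complex (2 ^+ J * cos lam ^+ J) 0.
  by rewrite -exprMn -(rmorphXn (real_complex R)).
have sumC (I : finType) (f : I -> R[i]) :
    \sum_i f i = Complex (\sum_i complex.Re (f i)) (\sum_i complex.Im (f i)).
  elim/big_rec3: _ => // i y1 y2 z _ ->; by case: (f i).
move: key; rewrite powC sumC /cis /= => -[-> ->].
by split; rewrite !mulr0 ?subr0 ?addr0 ?add0r; ring.
Qed.

(** The window is dictated by the amplitudes: consecutive ones have a ratio of at most 32, and
    rounding a frequency to the grid loses another factor 2. Within it, lam stays away from the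
    zeros of sin, so one constant c serves all levels. *)
Lemma cos_lt1_bound : exists2 c : R, 0 <= c < 1 &
  forall lam, 64^-1 <= `|lam| <= 1 -> `|cos lam| <= c.
Proof.
have pi2 : (2 : R) <= pi := @pi_ge2 R.
have in0pi (x : R) : 0 <= x <= 1 -> x \in `[0, pi].
  by rewrite in_itv /= => /andP[-> x1]; apply: le_trans x1 _; lra.
exists (cos 64^-1).
  apply/andP; split.
    apply: cos_ge0_pihalf; apply/andP; split.
      by apply: (@le_trans _ _ 0); [rewrite oppr_le0 divr_ge0// (le_trans _ pi2)|].
    by rewrite ler_pdivlMr//; apply: le_trans pi2; lra.
  by rewrite -[ltRHS]cos0 ltr_cos; [lra|apply: in0pi; lra..].
move=> lam /andP[l1 l2]; rewrite -cos_norm ger0_norm; last first.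
  apply: cos_ge0_pihalf; apply/andP; split.
    by apply: (@le_trans _ _ 0) => //; rewrite oppr_le0 divr_ge0// (le_trans _ pi2).
  by rewrite ler_pdivlMr//; apply: le_trans pi2; lra.
by rewrite leNgt ltr_cos; [rewrite -leNgt|apply: in0pi; rewrite ?normr_ge0; lra..].
Qed.

(** Inverting exp (-x) >= 1 - x gives exp x <= 1 / (1 - x), which the quadratic dominates as long as
    x <= 1/2. *)
Lemma expR_le_quadratic (x : R) : `|x| <= 2^-1 -> expR x <= 1 + x + 2 * x ^+ 2.
Proof.
rewrite ler_norml => /andP[x1 x2].
have x3 : 0 < 1 - x by lra.
rewrite -[x in expR x]opprK expRN.
apply: (@le_trans _ _ (1 - x)^-1).
  by rewrite lef_pV2 ?posrE ?expR_gt0//; exact: expR_ge1Dx.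
rewrite -[leLHS]mul1r ler_pdivrMr//.
have -> : (1 + x + 2 * x ^+ 2) * (1 - x) = 1 + x ^+ 2 * (1 - 2 * x) by ring.
by rewrite lerDl mulr_ge0 ?sqr_ge0//; lra.
Qed.

Lemma mean_expR_le (U : finType) (N : R) (Z : U -> R) (h mu s : R) :
  0 < N -> N = #|U|%:R -> 0 <= s -> s * h <= 2^-1 -> (forall u, `|Z u| <= h) ->
  \sum_u Z u <= N * mu ->
  \sum_u expR (s * Z u) <= N * expR (s * mu + 2 * (s * h) ^+ 2).
Proof.
move=> N0 NU s0 sh1 Zh Zmu.
have sZ u : `|s * Z u| <= s * h by rewrite normrM ger0_norm// ler_wpM2l.
apply: (@le_trans _ _ (\sum_u (1 + s * Z u + 2 * (s * h) ^+ 2))).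
  apply: ler_sum => u _; apply: le_trans (expR_le_quadratic _) _.
    exact: le_trans (sZ u) _.
  rewrite lerD2l ler_pM2l// -[leLHS]real_normK ?num_real// lerXn2r ?nnegrE//.
  exact: le_trans (sZ u).
rewrite !big_split /= -mulr_sumr !sumr_const -[1 *+ #|U|]/(#|U|%:R) -[_ *+ #|_|]mulr_natl -NU.
apply: (@le_trans _ _ (N * (1 + (s * mu + 2 * (s * h) ^+ 2)))).
  rewrite !mulrDr mulr1 addrA lerD2r lerD2l mulrCA ler_wpM2l//.
by rewrite ler_wpM2l ?expR_ge1Dx// ltW.
Qed.

(** A finite function into U encodes K independent uniform choices, so the exponential moment is a
    product over k. Each factor costs its mean, at most s mu, and a variance term 2 (s h)^2. *)
Lemma hoeffding_mgf (U : finType) (K : nat) (Z : 'I_K -> U -> R) (h mu s : R) :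
  (0 < #|U|)%N -> 0 <= s -> s * h <= 2^-1 -> (forall k u, `|Z k u| <= h) ->
  (forall k, \sum_u Z k u <= #|U|%:R * mu) ->
  \sum_(y : {ffun 'I_K -> U}) expR (s * \sum_(k < K) Z k (y k)) <=
  #|{ffun 'I_K -> U}|%:R * expR (K%:R * (s * mu + 2 * (s * h) ^+ 2)).
Proof.
move=> U0 s0 sh1 Zh Zmu.
under eq_bigr do rewrite mulr_sumr expR_sum.
rewrite -(bigA_distr_bigA (fun k u => expR (s * Z k u))) /=.
apply: (@le_trans _ _ (\prod_(k < K) (#|U|%:R * expR (s * mu + 2 * (s * h) ^+ 2)))).
  apply: ler_prod => k _; rewrite sumr_ge0/=; last by move=> *; exact: expR_ge0.
  by apply: mean_expR_le => //; rewrite ltr0n.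
rewrite prodr_const card_ord exprMn card_ffun card_ord natrX ler_wpM2l ?exprn_ge0//.
by rewrite -expRM_natl.
Qed.

End sign_averages.

(** * Measurability and integrals of bounded functions *)

Section borel_measurability.

Lemma continuous_borel_measurable_real (R : realType) (X : ptopologicalType) (f : X -> R) :
  continuous f -> measurable_fun setT (f : borelType X -> R).
Proof.
move=> /continuousP cf; apply: (measurability _ (RGenOInfty.measurableE R)).
move=> _ [_ [x ->] <-]; rewrite setTI; apply: sub_sigma_algebra; apply: cf.
by rewrite set_itvE; exact: open_gt.
Qed.

Lemma continuous_real_borel_measurable (R : realType) (Y : ptopologicalType) (f : R -> Y) :
  continuous f -> measurable_fun setT (f : R -> borelType Y).
Proof.
move=> /continuousP cf; apply: (@measurability _ _ R (borelType Y) _ _ (@open Y)) => //.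
by move=> _ [U oU <-]; rewrite setTI; apply: open_measurable; exact: cf.
Qed.

End borel_measurability.

Section bounded_integrals.
Context d (T : measurableType d) (R : realType) (mu : {measure set T -> \bar R}).
Context (D : set T) (mD : measurable D) (muD : (mu D < +oo)%E).
Implicit Types f g : T -> R.

(** On a set of finite measure this class is integrable and stable under the operations used below,
    so that linearity of [Rintegral] applies without separate integrability proofs. *)
Definition bmeas f := measurable_fun D f /\ exists M, forall x, D x -> `|f x| <= M.

Lemma bmeas_integrable f : bmeas f -> mu.-integrable D (EFin \o f).
Proof.
move=> [mf [M fM]]; apply: measurable_bounded_integrable => //.
exists M; split; first exact: num_real.
by move=> y My x Dx /=; rewrite (le_trans (fM _ Dx))// ltW.
Qed.

Lemma bmeas_cst c : bmeas (fun=> c).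
Proof. by split; [exact: measurable_cst|exists `|c|]. Qed.

Lemma bmeasD f g : bmeas f -> bmeas g -> bmeas (fun x => f x + g x).
Proof.
move=> [mf [M fM]] [mg [N gN]]; split; first exact: measurable_funD.
by exists (M + N) => x Dx; rewrite (le_trans (ler_normD _ _))// lerD ?fM ?gN.
Qed.

Lemma bmeasM f g : bmeas f -> bmeas g -> bmeas (fun x => f x * g x).
Proof.
move=> [mf [M fM]] [mg [N gN]]; split; first exact: measurable_funM.
by exists (M * N) => x Dx; rewrite normrM ler_pM ?fM ?gN.
Qed.

Lemma bmeasZ c f : bmeas f -> bmeas (fun x => c * f x).
Proof. by apply: bmeasM; exact: bmeas_cst. Qed.

Lemma bmeas_sum (I : Type) (r : seq I) (P : pred I) (f : I -> T -> R) :
  (forall i, bmeas (f i)) -> bmeas (fun x => \sum_(i <- r | P i) f i x).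
Proof.
move=> mf; elim: r => [|i r IH].
  by under eq_fun do rewrite big_nil; exact: bmeas_cst.
under eq_fun do rewrite big_cons; case: (P i) => //; exact: bmeasD (mf i) IH.
Qed.

Lemma bmeas_cos f : measurable_fun D f -> bmeas (fun x => cos (f x)).
Proof.
move=> mf; split; last by exists 1 => x _; exact: cos_max.
apply: (measurableT_comp _ mf); apply: continuous_measurable_fun; exact: continuous_cos.
Qed.

Lemma bmeas_sin f : measurable_fun D f -> bmeas (fun x => sin (f x)).
Proof.
move=> mf; split; last by exists 1 => x _; exact: sin_max.
apply: (measurableT_comp _ mf); apply: continuous_measurable_fun; exact: continuous_sin.
Qed.

Lemma Rintegral_sum (I : Type) (r : seq I) (P : pred I) (f : I -> T -> R) :
  (forall i, bmeas (f i)) ->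
  \int[mu]_(x in D) (\sum_(i <- r | P i) f i x) =
  \sum_(i <- r | P i) \int[mu]_(x in D) f i x.
Proof.
move=> mf; elim: r => [|i r IH].
  under eq_Rintegral do rewrite big_nil.
  by rewrite big_nil Rintegral_cst// mul0r.
rewrite big_cons; under eq_Rintegral do rewrite big_cons.
case: ifP => // _; rewrite RintegralD ?IH//; apply: bmeas_integrable => //.
exact: bmeas_sum.
Qed.

Lemma bmeas_RintegralZ c f : bmeas f ->
  \int[mu]_(x in D) (c * f x) = c * \int[mu]_(x in D) f x.
Proof. by move=> mf; rewrite RintegralZl//; exact: bmeas_integrable. Qed.

Lemma bmeas_RintegralZr c f : bmeas f ->
  \int[mu]_(x in D) (f x * c) = \int[mu]_(x in D) f x * c.
Proof. by move=> mf; rewrite RintegralZr//; exact: bmeas_integrable. Qed.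

Lemma bmeas_RintegralD f g : bmeas f -> bmeas g ->
  \int[mu]_(x in D) (f x + g x) = \int[mu]_(x in D) f x + \int[mu]_(x in D) g x.
Proof. by move=> mf mg; rewrite RintegralD//; exact: bmeas_integrable. Qed.

Lemma bmeas_RintegralB f g : bmeas f -> bmeas g ->
  \int[mu]_(x in D) (f x - g x) = \int[mu]_(x in D) f x - \int[mu]_(x in D) g x.
Proof. by move=> mf mg; rewrite RintegralB//; exact: bmeas_integrable. Qed.

Lemma bmeas_le_Rintegral f g : bmeas f -> bmeas g -> (forall x, D x -> f x <= g x) ->
  \int[mu]_(x in D) f x <= \int[mu]_(x in D) g x.
Proof. by move=> mf mg fg; apply: le_Rintegral => //; exact: bmeas_integrable. Qed.

Lemma Rintegral_norm_le f c : bmeas f -> (forall x, D x -> `|f x| <= c) ->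
  `|\int[mu]_(x in D) f x| <= c * fine (mu D).
Proof.
move=> mf fc; rewrite ler_norml -mulNr -!Rintegral_cst//.
have b x : D x -> - c <= f x <= c by move=> /fc; rewrite ler_norml.
by apply/andP; split; apply: bmeas_le_Rintegral => //;
  (try exact: bmeas_cst) => x /b/andP[].
Qed.

End bounded_integrals.

(** * Fourier decay and energy *)

Section decay_sums.
Context {R : realType}.
Implicit Types (a c C : R) (n m : nat).

(* The farthest end of a run of n + 1 integers is at distance at least n / 2 from any c. *)
Lemma sum_dist_le (g : R -> R) n c :
  (forall x y, 0 <= x -> x <= y -> g y <= g x) ->
  \sum_(k < n) g `|k%:R - c| <= \sum_(k < n) g (k%:R / 2).
Proof.
move=> gm; elim: n c => [|n IH] c; first by rewrite !big_ord0.
have [cn|cn] := leP c (n%:R / 2).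
  rewrite !big_ord_recr /= lerD ?IH// gm//.
  have := ler_norm (n%:R - c); lra.
rewrite big_ord_recl big_ord_recr /= addrC; apply: lerD.
  by rewrite sub0r normrN gm//; have := ler_norm c; lra.
apply: le_trans (IH (c - 1)); rewrite le_eqVlt; apply/orP; left; apply/eqP.
by apply: eq_bigr => i _; rewrite /bump /= add1n -natr1; congr (g `|_|); ring.
Qed.

Definition decay1 a (x : R) := (1 + `|x|) `^ (- a).

Lemma decay1_ge0 a x : 0 <= decay1 a x. Proof. exact: powR_ge0. Qed.

Lemma ler_powRN a (x y : R) : 0 <= a -> 0 < x -> x <= y -> y `^ (- a) <= x `^ (- a).
Proof.
move=> a0 x0 xy; have y0 := lt_le_trans x0 xy.
by rewrite !powRN lef_pV2 ?posrE ?powR_gt0// ge0_ler_powR// nnegrE ltW.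
Qed.

Lemma sum_decay1_le a c n : 0 <= a ->
  \sum_(k < n) decay1 a (k%:R - c) <= \sum_(k < n) (1 + k%:R / 2) `^ (- a).
Proof.
move=> a0; apply: (@sum_dist_le (fun x => (1 + x) `^ (- a))).
by move=> x y x0 xy; apply: ler_powRN => //; lra.
Qed.

Lemma powR_exprn (x r : R) n : 0 <= x -> (x `^ r) ^+ n = (x ^+ n) `^ r.
Proof.
by move=> x0; rewrite -powR_mulrn ?powR_ge0// -(powR_mulrn _ x0) -!powRrM mulrC.
Qed.

Lemma powR2_gt1 (b : R) : 0 < b -> 1 < 2 `^ b.
Proof.
move=> b0; have := @gt0_ltr_powR R b b0 1 2; rewrite powR1; apply; rewrite ?nnegrE ?ltr1n//.
Qed.

Lemma powR2_lt1 (b : R) : b < 0 -> 2 `^ b < 1.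
Proof.
move=> b0; rewrite -[b]opprK powRN invf_lt1 ?powR_gt0// powR2_gt1//; lra.
Qed.

(** The 2^l indices k in [2^l, 2^(l+1)[ satisfy 1 + k/2 >= 2^l / 2, so this block contributes at
    most 2^a 2^((1 - a) l). The geometric series then grows for a < 1, the case of the energy, and
    is bounded for a > 1, the case of the interior. *)
Lemma sum_powRN_dyadic a m : 0 <= a ->
  \sum_(k < 2 ^ m) (1 + k%:R / 2 : R) `^ (- a) <=
  1 + 2 `^ a * \sum_(l < m) (2 `^ (1 - a)) ^+ l.
Proof.
move=> a0; elim: m => [|m IH].
  by rewrite expn0 big_ord1 big_ord0 mul0r addr0 mulr0 addr0 powR1.
rewrite -(big_mkord xpredT (fun k => (1 + k%:R / 2 : R) `^ (- a))).
rewrite (@big_cat_nat _ _ _ (2 ^ m)%N) ?leq_exp2l//= big_mkord.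
rewrite big_ord_recr /= mulrDr addrA; apply: lerD => //.
apply: (@le_trans _ _ (\sum_(2 ^ m <= i < 2 ^ m.+1) (2 `^ (- a)) ^+ m * 2 `^ a)).
  rewrite big_seq [leRHS]big_seq; apply: ler_sum => i.
  rewrite mem_index_iota => /andP[mi _].
  have -> : (2 `^ (- a)) ^+ m * 2 `^ a = (2 ^+ m / 2 : R) `^ (- a).
    rewrite powRM// -powR_inv1// -powRrM mulN1r opprK; congr (_ * _).
    exact: powR_exprn.
  apply: ler_powRN => //.
  by rewrite ler_wpDl// ler_wpM2r// -natrX ler_nat.
rewrite sumr_const_nat expnS mul2n -addnn addnK -[leLHS]mulr_natl natrX mulrA.
rewrite -exprMn mulrC ler_wpM2l ?powR_ge0// powRD; last by apply/implyP.
by rewrite powRr1.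
Qed.

Lemma dyadic_sum_growth a : 0 <= a < 1 -> exists2 C : R, 0 <= C &
  forall m, \sum_(k < 2 ^ m) (1 + k%:R / 2 : R) `^ (- a) <= C * (2 `^ (1 - a)) ^+ m.
Proof.
move=> /andP[a0 a1]; set q := 2 `^ (1 - a).
have q1 : 1 < q by apply: powR2_gt1; lra.
exists (1 + 2 `^ a / (q - 1)).
  by rewrite addr_ge0// divr_ge0 ?powR_ge0// subr_ge0 ltW.
move=> m; apply: le_trans (sum_powRN_dyadic m a0) _; rewrite -/q mulrDl; apply: lerD.
  by rewrite mul1r exprn_ege1// ltW.
have -> : \sum_(l < m) q ^+ l = (q ^+ m - 1) / (q - 1).
  by rewrite subrX1 mulrC mulKf// subr_eq0 gt_eqF.
rewrite -mulrA ler_wpM2l ?powR_ge0// mulrC ler_wpM2l ?invr_ge0 ?subr_ge0 ?(ltW q1)//.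
by rewrite gerBl.
Qed.

Lemma dyadic_sum_bounded a : 1 < a -> exists2 C : R, 0 <= C &
  forall m, \sum_(k < 2 ^ m) (1 + k%:R / 2 : R) `^ (- a) <= C.
Proof.
move=> a1; set q := 2 `^ (1 - a).
have q0 : 0 <= q := powR_ge0 _ _.
have q1 : q < 1 by apply: powR2_lt1; lra.
exists (1 + 2 `^ a / (1 - q)).
  by rewrite addr_ge0// divr_ge0 ?powR_ge0// subr_ge0 ltW.
move=> m; apply: le_trans (sum_powRN_dyadic m _) _; first lra.
rewrite -/q lerD2l ler_wpM2l ?powR_ge0//.
have -> : \sum_(l < m) q ^+ l = (1 - q ^+ m) / (1 - q).
  apply: (canRL (mulfK _)); first by rewrite subr_eq0 gt_eqF.
  by rewrite -[_ - _]opprB mulrN mulrC -subrX1 opprB.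
by rewrite -[leRHS]mul1r ler_wpM2r ?invr_ge0 ?subr_ge0 ?(ltW q1)// gerBl exprn_ge0.
Qed.

(** A product over the coordinates rather than a power of the norm: sums over a lattice box then
    factor into one-dimensional sums. *)
Definition decay d a (x : 'rV[R]_d) : R := \prod_(j < d) decay1 a (x 0 j).

Definition lattice d n (v : {ffun 'I_d -> 'I_n}) : 'rV[R]_d := \row_j (v j)%:R.

Lemma sum_decay_le d n a (c : 'rV[R]_d) : 0 <= a ->
  \sum_(v : {ffun 'I_d -> 'I_n}) decay a (lattice v - c) <=
  (\sum_(k < n) (1 + k%:R / 2) `^ (- a)) ^+ d.
Proof.
move=> a0; rewrite -[X in _ ^+ X](card_ord d) -prodr_const.
apply: (@le_trans _ _ (\prod_(j < d) \sum_(k < n) decay1 a (k%:R - c 0 j))).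
  rewrite bigA_distr_bigA /= le_eqVlt; apply/orP; left; apply/eqP.
  by apply: eq_bigr => v _; apply: eq_bigr => j _; rewrite !mxE.
apply: ler_prod => j _; rewrite sum_decay1_le// andbT.
by apply: sumr_ge0 => k _; exact: decay1_ge0.
Qed.

(** For each of the d coordinates (1 + |x_j|)^2 <= 2 (1 + |x|^2); the powers of exponent -a/2 of
    these inequalities are multiplied together. *)
Lemma sqr_norm_decay d a (x : 'rV[R]_d) : 0 <= a ->
  (1 + euclid x ^+ 2) `^ (- (a * d%:R / 2)) <= 2 `^ (a * d%:R / 2) * decay a x.
Proof.
move=> a0; case: d x => [|d] x.
  by rewrite /decay big_ord0 !mulr0 mul0r oppr0 !powRr0 mulr1.
have e0 : 0 < 1 + euclid x ^+ 2 by rewrite ltr_pwDl ?sqr_ge0.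
have -> : decay a x = \prod_(j < d.+1) ((1 + `|x 0 j|) ^+ 2) `^ (- (a / 2)).
  apply: eq_bigr => j _; rewrite /decay1 -powR_mulrn ?addr_ge0// -powRrM.
  by congr (_ `^ _); field.
have -> : 2 `^ (a * d.+1%:R / 2) = \prod_(j < d.+1) (2^-1 : R) `^ (- (a / 2)).
  rewrite prodr_const card_ord -powR_mulrn ?powR_ge0// -powRrM.
  by rewrite -powR_inv1// -powRrM; congr (_ `^ _); field.
have -> : (1 + euclid x ^+ 2) `^ (- (a * d.+1%:R / 2)) =
    \prod_(j < d.+1) (1 + euclid x ^+ 2) `^ (- (a / 2)).
  rewrite prodr_const card_ord -[RHS]powR_mulrn ?powR_ge0// -powRrM.
  by congr (_ `^ _); field.
rewrite -big_split /=; apply: ler_prod => j _; rewrite powR_ge0 /=.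
rewrite -powRM// ?sqr_ge0//; apply: ler_powRN; first by rewrite divr_ge0.
  by rewrite mulr_gt0// exprn_gt0// ltr_pwDl.
have xe := ler_coord_euclid x j; have xj := normr_ge0 (x 0 j).
have : `|x 0 j| ^+ 2 <= euclid x ^+ 2 by rewrite lerXn2r// nnegrE euclid_ge0.
have := sqr_ge0 (1 - `|x 0 j|).
set u := `|_|; set w := euclid _; rewrite ler_pdivrMl//; nra.
Qed.

End decay_sums.

Section dotv_theory.
Context {R : realType} {d : nat}.
Implicit Types x y z : 'rV[R]_d.

Lemma dotvDl x y z : dotv (x + y) z = dotv x z + dotv y z.
Proof. by rewrite /dotv -big_split; apply: eq_bigr => i _; rewrite !mxE mulrDl. Qed.

Lemma dotvBl x y z : dotv (x - y) z = dotv x z - dotv y z.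
Proof. by rewrite /dotv -sumrB; apply: eq_bigr => i _; rewrite !mxE mulrBl. Qed.

Lemma dotvBr x y z : dotv x (y - z) = dotv x y - dotv x z.
Proof. by rewrite /dotv -sumrB; apply: eq_bigr => i _; rewrite !mxE mulrBr. Qed.

Lemma dotv0 x : dotv 0 x = 0.
Proof. by rewrite /dotv big1// => i _; rewrite mxE mul0r. Qed.

Lemma dotv_norm_le x y (b : R) : (forall i, `|y 0 i| <= b) ->
  `|dotv x y| <= (\sum_(i < d) `|x 0 i|) * b.
Proof.
move=> yb; rewrite /dotv (le_trans (ler_norm_sum _ _ _))// mulr_suml.
by apply: ler_sum => i _; rewrite normrM ler_wpM2l.
Qed.

Lemma measurable_coord (i : 'I_d) : measurable_fun setT ((fun x => x 0 i) : borelType 'rV[R]_d -> R).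
Proof. by apply: continuous_borel_measurable_real; exact: coord_continuous. Qed.

Lemma measurable_dotv x : measurable_fun setT ((dotv x) : borelType 'rV[R]_d -> R).
Proof.
apply: measurable_sum => i; apply: measurable_funM; first exact: measurable_cst.
exact: measurable_coord.
Qed.

Lemma measurable_euclidB : measurable_fun setT
  ((fun p => euclid (p.1 - p.2)) : borelType 'rV[R]_d * borelType 'rV[R]_d -> R).
Proof.
have -> : (fun p => euclid (p.1 - p.2)) = (fun p : 'rV[R]_d * 'rV[R]_d =>
   (\sum_(i < d) (p.1 0 i - p.2 0 i) ^+ 2) `^ 2^-1).
  apply/funext => p; rewrite powR12_sqrt; last by apply: sumr_ge0 => i _; exact: sqr_ge0.
  by congr Num.sqrt; apply: eq_bigr => i _; rewrite !mxE expr2.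
apply: (measurableT_comp (measurable_powR _)); apply: measurable_sum => i.
apply: measurable_funX; apply: measurable_funB.
  by apply: (measurableT_comp (measurable_coord i)); exact: measurable_fst.
by apply: (measurableT_comp (measurable_coord i)); exact: measurable_snd.
Qed.

Lemma measurable_riesz (b : R) : 0 < b -> measurable_fun setT
  ((fun p => riesz_kernel b p.1 p.2) : borelType 'rV[R]_d * borelType 'rV[R]_d -> \bar R).
Proof.
move=> b0.
have -> : (fun p : 'rV[R]_d * 'rV[R]_d => riesz_kernel b p.1 p.2) =
  (fun p => if euclid (p.1 - p.2) == 0 then +oo%E else ((euclid (p.1 - p.2)) `^ (- b))%:E).
  apply/funext => p; rewrite /riesz_kernel inver powRN powR_eq0 (gt_eqF b0) andbT.
  by case: ifP.
apply: measurable_fun_ifT => //.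
  apply: measurable_fun_eqr => //; exact: measurable_euclidB.
apply/measurable_EFinP; apply: (measurableT_comp (measurable_powR _)); exact: measurable_euclidB.
Qed.

End dotv_theory.

(** * Trigonometric polynomials integrated against a finite measure *)

Section trigonometric_kernel.
Context {R : realType} {d : nat} (mu : {finite_measure set (borelType 'rV[R]_d) -> \bar R}).
Implicit Types x y z xi : 'rV[R]_d.

Definition fcos xi : R := \int[mu]_x cos (dotv xi x).
Definition fsin xi : R := \int[mu]_x sin (dotv xi x).

Lemma mu_fin : (mu setT < +oo)%E.
Proof. by rewrite -ge0_fin_numE//; exact: fin_num_measure. Qed.

Definition mass : R := fine (mu setT).

Lemma bmeas_cosdot xi : bmeas setT (fun x : borelType _ => cos (dotv xi x)).
Proof. by apply: bmeas_cos; exact: measurable_dotv. Qed.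

Lemma bmeas_sindot xi : bmeas setT (fun x : borelType _ => sin (dotv xi x)).
Proof. by apply: bmeas_sin; exact: measurable_dotv. Qed.

Lemma fcos0 : fcos 0 = mass.
Proof.
rewrite /fcos; under eq_Rintegral do rewrite dotv0 cos0.
by rewrite Rintegral_cst// mul1r.
Qed.

Lemma fsin0 : fsin 0 = 0.
Proof.
rewrite /fsin; under eq_Rintegral do rewrite dotv0 sin0.
by rewrite Rintegral_cst// mul0r.
Qed.

Lemma mass_ge0 : 0 <= mass.
Proof. exact: fine_ge0. Qed.

Context {V : finType} (freq : V -> 'rV[R]_d).

(* The square modulus of the trigonometric polynomial sum_v exp (i freq v . z). *)
Definition tker z : R :=
  (\sum_v cos (dotv (freq v) z)) ^+ 2 + (\sum_v sin (dotv (freq v) z)) ^+ 2.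

Lemma tker_ge0 z : 0 <= tker z.
Proof. by rewrite addr_ge0 ?sqr_ge0. Qed.

Lemma tkerE z : tker z = \sum_v \sum_w cos (dotv (freq v - freq w) z).
Proof.
rewrite /tker !expr2 !mulr_suml -big_split; apply: eq_bigr => v _ /=.
rewrite !mulr_sumr -big_split; apply: eq_bigr => w _ /=.
by rewrite dotvBl cosB.
Qed.

Definition tconv x : R := \int[mu]_y tker (x - y).

Lemma bmeas_tker x : bmeas setT (fun y : borelType _ => tker (x - y)).
Proof.
under eq_fun => y.
  rewrite tkerE; under eq_bigr do under eq_bigr do rewrite dotvBr cosB; over.
apply: bmeas_sum => v; apply: bmeas_sum => w; apply: bmeasD; apply: bmeasZ.
  exact: bmeas_cosdot.
exact: bmeas_sindot.
Qed.

Lemma tconvE x : tconv x = \sum_v \sum_w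
  (cos (dotv (freq v - freq w) x) * fcos (freq v - freq w) +
   sin (dotv (freq v - freq w) x) * fsin (freq v - freq w)).
Proof.
rewrite /tconv; under eq_Rintegral => y _.
  rewrite tkerE; under eq_bigr do under eq_bigr do rewrite dotvBr cosB; over.
rewrite Rintegral_sum//=; first last.
- by move=> v; apply: bmeas_sum => w; apply: bmeasD; apply: bmeasZ;
    [exact: bmeas_cosdot|exact: bmeas_sindot].
- exact: mu_fin.
apply: eq_bigr => v _; rewrite Rintegral_sum//=; first last.
- by move=> w; apply: bmeasD; apply: bmeasZ; [exact: bmeas_cosdot|exact: bmeas_sindot].
- exact: mu_fin.
apply: eq_bigr => w _; rewrite bmeas_RintegralD//=; first last.
- by apply: bmeasZ; exact: bmeas_sindot.
- by apply: bmeasZ; exact: bmeas_cosdot.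
- exact: mu_fin.
by rewrite !bmeas_RintegralZ//; [exact: mu_fin|exact: bmeas_sindot|exact: mu_fin|exact: bmeas_cosdot].
Qed.

Lemma bmeas_tconv : bmeas setT (tconv : borelType _ -> R).
Proof.
rewrite (funext tconvE); apply: bmeas_sum => v; apply: bmeas_sum => w; apply: bmeasD.
  by apply: bmeasM; [exact: bmeas_cosdot|exact: bmeas_cst].
by apply: bmeasM; [exact: bmeas_sindot|exact: bmeas_cst].
Qed.

(** A finite Parseval identity, obtained by expanding cosines of differences. It relates the decay
    of the Fourier transform to the mass of mu x mu near the diagonal, and later to the
    mollifications. *)
Lemma Rintegral_tconv : \int[mu]_x tconv x =
  \sum_v \sum_w (fcos (freq v - freq w) ^+ 2 + fsin (freq v - freq w) ^+ 2).
Proof.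
under eq_Rintegral => x _ do rewrite tconvE.
have bc xi : bmeas setT (fun x : borelType _ => cos (dotv xi x) * fcos xi).
  by apply: bmeasM; [exact: bmeas_cosdot|exact: bmeas_cst].
have bs xi : bmeas setT (fun x : borelType _ => sin (dotv xi x) * fsin xi).
  by apply: bmeasM; [exact: bmeas_sindot|exact: bmeas_cst].
rewrite Rintegral_sum//=; first last.
- by move=> v; apply: bmeas_sum => w; exact: bmeasD.
- exact: mu_fin.
apply: eq_bigr => v _; rewrite Rintegral_sum//=; first last.
- by move=> w; exact: bmeasD.
- exact: mu_fin.
apply: eq_bigr => w _; rewrite bmeas_RintegralD//=; last exact: mu_fin.
rewrite !bmeas_RintegralZr//; last 4 first.
- exact: mu_fin.
- exact: bmeas_sindot.
- exact: mu_fin.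
- exact: bmeas_cosdot.
Qed.

End trigonometric_kernel.

(** * Fourier decay and mass near the diagonal *)

Section fourier_energy.
Context {R : realType} {d : nat} (mu : {finite_measure set (borelType 'rV[R]_d) -> \bar R}).
Implicit Types x y z xi : 'rV[R]_d.

Lemma fourier_decay_sqr alpha : (fourier_decay alpha mu < +oo)%E ->
  exists2 C : R, 0 <= C & forall xi,
    fcos mu xi ^+ 2 + fsin mu xi ^+ 2 <= C * (1 + euclid xi ^+ 2) `^ (- (alpha / 2)).
Proof.
move=> fin.
have [C CP] : exists C : R, forall xi, (1 + euclid xi ^+ 2) `^ (alpha / 4) *
    ComplexField.Normc.normc (fourier mu xi) <= C.
  exists (fine (fourier_decay alpha mu)) => xi.
  have le : (((1 + euclid xi ^+ 2) `^ (alpha / 4) *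
     ComplexField.Normc.normc (fourier mu xi))%:E <= fourier_decay alpha mu)%E.
    by apply: ereal_sup_ubound; exists xi.
  rewrite -lee_fin fineK// fin_real// fin andbT; apply: lt_le_trans le.
  by rewrite ltNyr.
exists (C ^+ 2); first exact: sqr_ge0.
move=> xi; have e0 : 0 < 1 + euclid xi ^+ 2 by rewrite ltr_pwDl ?sqr_ge0.
rewrite powRN ler_pdivlMr ?powR_gt0//.
have -> : alpha / 2 = alpha / 4 + alpha / 4 by field.
rewrite powRD; last by apply/implyP => _; rewrite gt_eqF.
rewrite -expr2 mulrC -(@sqr_sqrtr _ (fcos mu xi ^+ 2 + _)) ?addr_ge0 ?sqr_ge0//.
rewrite -exprMn lerXn2r ?nnegrE ?mulr_ge0 ?powR_ge0 ?sqrtr_ge0//.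
  by apply: le_trans (CP xi); rewrite mulr_ge0 ?powR_ge0 ?sqrtr_ge0.
exact: CP.
Qed.

Lemma fourier_decay_prod alpha a : (0 < d)%N -> 0 <= a -> a * d%:R <= alpha ->
  (fourier_decay alpha mu < +oo)%E ->
  exists2 C : R, 0 <= C & forall xi,
    fcos mu xi ^+ 2 + fsin mu xi ^+ 2 <= C * decay a xi.
Proof.
move=> d0 a0 aalpha /fourier_decay_sqr[C C0 HC].
exists (C * 2 `^ (a * d%:R / 2)); first by rewrite mulr_ge0// powR_ge0.
move=> xi; apply: le_trans (HC xi) _; rewrite -mulrA ler_wpM2l//.
apply: le_trans (sqr_norm_decay xi a0).
by rewrite ler_powR ?lerDl ?sqr_ge0// lerN2 ler_pM2r// invr_gt0.
Qed.

Lemma dotv_lattice_le n (v : {ffun 'I_d -> 'I_n}) z : (0 < d)%N ->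
  euclid z <= d%:R^-1 / n%:R -> `|dotv (lattice v) z| <= 1.
Proof.
move=> d0 zn; apply: le_trans (dotv_norm_le (lattice v) (b := euclid z) _) _.
  exact: ler_coord_euclid.
case: n v zn => [|n] v zn; first by case: (v (Ordinal d0)).
apply: (@le_trans _ _ ((\sum_(i < d) n.+1%:R) * (d%:R^-1 / n.+1%:R))).
  apply: ler_pM => //; first by apply: sumr_ge0.
    exact: euclid_ge0.
  by apply: ler_sum => i _; rewrite !mxE ger0_norm// ler_nat ltnW.
rewrite sumr_const card_ord -[_ *+ d]mulr_natl le_eqVlt; apply/orP; left; apply/eqP.
by rewrite mulrACA !divff ?mulr1// pnatr_eq0 -lt0n.
Qed.

(** For such z all the phases lie in [-1, 1]: no cancellation takes place, and the kernel is as
    large as its peak up to a constant. *)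
Lemma tker_lattice_ge n z : (0 < d)%N -> euclid z <= d%:R^-1 / n%:R ->
  (n%:R ^+ d * cos 1) ^+ 2 <= tker (@lattice R d n) z.
Proof.
move=> d0 zn; rewrite /tker -[leLHS]addr0 lerD ?sqr_ge0//.
have c1 : 0 < cos 1 :> R := cos1_gt0 R.
have pi2 : (2 : R) <= pi := @pi_ge2 R.
have in0pi (x : R) : 0 <= x <= 1 -> x \in `[0, pi].
  by rewrite in_itv /= => /andP[-> x1]; apply: le_trans x1 _; lra.
have le : n%:R ^+ d * cos 1 <= \sum_v cos (dotv (@lattice R d n v) z).
  have -> : n%:R ^+ d * cos 1 = \sum_(v : {ffun 'I_d -> 'I_n}) cos 1 :> R.
    by rewrite sumr_const card_ffun !card_ord -[RHS]mulr_natl natrX.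
  apply: ler_sum => v _; rewrite -[leRHS]cos_norm leNgt ltr_cos; last 2 first.
  - by apply: in0pi; rewrite ler01 lexx.
  - by apply: in0pi; rewrite normr_ge0 dotv_lattice_le.
  by rewrite -leNgt dotv_lattice_le.
by rewrite lerXn2r ?nnegrE ?mulr_ge0 ?exprn_ge0 ?(ltW c1)// (le_trans _ le)// mulr_ge0 ?exprn_ge0 ?(ltW c1).
Qed.

Definition near_diag (r : R) : set (borelType 'rV[R]_d * borelType 'rV[R]_d) :=
  [set p | euclid (p.1 - p.2) <= r].

Lemma measurable_near_diag r : measurable (near_diag r).
Proof.
have := @measurable_euclidB R d measurableT _ (measurable_itv `]-oo, r]).
by rewrite setTI; congr measurable; apply/seteqP; split => p /=; rewrite in_itv.
Qed.

(** Chebyshev's inequality for the kernel, which is nonnegative everywhere and at least [K] near the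
    diagonal. *)
Lemma near_diag_le n : (0 < d)%N -> (0 < n)%N ->
  ((mu \x mu) (near_diag (d%:R^-1 / n%:R)) <=
   (((n%:R ^+ d * cos 1) ^+ 2)^-1 * \int[mu]_x tconv mu (@lattice R d n) x)%:E)%E.
Proof.
move=> d0 n0; set K := (_ ^+ 2).
have K0 : 0 < K by rewrite exprn_gt0// mulr_gt0 ?exprn_gt0 ?ltr0n ?cos1_gt0.
have bt := bmeas_tconv mu (@lattice R d n).
rewrite -bmeas_RintegralZ//; last exact: mu_fin.
have bt2 := bmeasZ K^-1 bt.
have it := bmeas_integrable measurableT (mu_fin mu) bt2.
rewrite /Rintegral fineK; last exact: integrable_fin_num.
apply: ge0_le_integral => //.
- by apply: measurable_fun_xsection; exact: measurable_near_diag.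
- by case: bt2 => mt _; apply/measurable_EFinP.
move=> x _ /=.
have btk := bmeas_tker (@lattice R d n) x.
have -> : K^-1 * tconv mu (@lattice R d n) x = \int[mu]_y (K^-1 * tker (@lattice R d n) (x - y)).
  by rewrite bmeas_RintegralZ//; exact: mu_fin.
have btk2 := bmeasZ K^-1 btk.
have itk := bmeas_integrable measurableT (mu_fin mu) btk2.
rewrite /Rintegral fineK; last exact: integrable_fin_num.
have mA : measurable (xsection (near_diag (d%:R^-1 / n%:R)) x).
  by apply: measurable_xsection; exact: measurable_near_diag.
have <- : (\int[mu]_y (\1_(xsection (near_diag (d%:R^-1 / n%:R)) x) y)%:E)%E =
    mu (xsection (near_diag (d%:R^-1 / n%:R)) x) by rewrite integral_indic// setIT.
apply: ge0_le_integral => //.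
- exact/measurable_EFinP/measurable_indic.
- by case: btk2 => mt _; apply/measurable_EFinP.
move=> y _; rewrite lee_fin indicE.
have [yA|_] := boolP (y \in _); last by rewrite mulr_ge0 ?tker_ge0// invr_ge0 ltW.
rewrite ler_pdivlMl// mulr1; apply: tker_lattice_ge => //.
by move: yA; rewrite mem_xsection inE.
Qed.

Lemma Rintegral_tconv_lattice_le n a C : 0 <= a ->
  (forall xi, fcos mu xi ^+ 2 + fsin mu xi ^+ 2 <= C * decay a xi) -> 0 <= C ->
  \int[mu]_x tconv mu (@lattice R d n) x <=
  C * n%:R ^+ d * (\sum_(k < n) (1 + k%:R / 2) `^ (- a)) ^+ d.
Proof.
move=> a0 HC C0; rewrite Rintegral_tconv exchange_big /=.
apply: (@le_trans _ _ (\sum_(w : {ffun 'I_d -> 'I_n})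
   C * (\sum_(k < n) (1 + k%:R / 2) `^ (- a)) ^+ d)).
  apply: ler_sum => w _; apply: (@le_trans _ _ (\sum_v C * decay a (@lattice R d n v - lattice w))).
    by apply: ler_sum => v _; exact: HC.
  by rewrite -mulr_sumr ler_wpM2l// sum_decay_le.
by rewrite sumr_const card_ffun !card_ord -[leLHS]mulr_natl natrX mulrCA mulrA.
Qed.

(** With n = 2^m the Parseval sum is at most of order n^d (n^(1 - a))^d, while the kernel is of
    order n^(2 d) near the diagonal; the quotient is n^(- a d). *)
Lemma near_diag_dyadic a : (0 < d)%N -> 0 <= a < 1 ->
  (exists2 C : R, 0 <= C & forall xi,
    fcos mu xi ^+ 2 + fsin mu xi ^+ 2 <= C * decay a xi) ->
  exists2 C : R, 0 <= C & forall m,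
  ((mu \x mu) (near_diag (d%:R^-1 / 2 ^+ m)) <= (C * (2 `^ (- (a * d%:R))) ^+ m)%:E)%E.
Proof.
move=> d0 /[dup] a01 /andP[a0 a1] [C C0 HC].
have [S S0 HS] := dyadic_sum_growth a01.
have c1 : 0 < cos 1 :> R := cos1_gt0 R.
exists ((cos 1) ^- 2 * C * S ^+ d).
  by rewrite mulr_ge0 ?exprn_ge0// mulr_ge0// invr_ge0 exprn_ge0// ltW.
move=> m.
have -> : 2 ^+ m = (2 ^ m)%N%:R :> R by rewrite natrX.
apply: le_trans (near_diag_le d0 _) _; first by rewrite expn_gt0.
rewrite lee_fin.
apply: (@le_trans _ _ ((((2 ^ m)%N%:R ^+ d * cos 1) ^+ 2)^-1 *
    (C * (2 ^ m)%N%:R ^+ d * (S * (2 `^ (1 - a)) ^+ m) ^+ d))).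
  rewrite ler_wpM2l ?invr_ge0 ?sqr_ge0//.
  apply: le_trans (Rintegral_tconv_lattice_le _ a0 HC C0) _.
  rewrite ler_wpM2l ?mulr_ge0 ?exprn_ge0//.
  rewrite lerXn2r ?nnegrE ?HS//; first by apply: sumr_ge0 => k _; exact: powR_ge0.
  by rewrite mulr_ge0// exprn_ge0// powR_ge0.
rewrite natrX powRD; last by apply/implyP.
rewrite powRr1//.
have -> : 2 `^ (- (a * d%:R)) = (2 `^ (- a)) ^+ d :> R.
  by rewrite -powR_mulrn ?powR_ge0// -powRrM mulNr.
rewrite !exprMn -!exprM (mulnC d m) le_eqVlt; apply/orP; left; apply/eqP.
have h2 : (2 : R) ^+ (m * d) != 0 by rewrite expf_neq0.
rewrite (exprM _ _ 2); move: h2; set P := 2 ^+ (m * d) => h2.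
by field; rewrite h2 gt_eqF.
Qed.

End fourier_energy.

(** * Comparison of the Fourier and Hausdorff dimensions *)

Section dim_comparison.
Context {R : realType} {d : nat}.
Implicit Types (mu : {finite_measure set (borelType 'rV[R]_d) -> \bar R}) (A : set 'rV[R]_d).

Lemma riesz_kernel_ge0 (b : R) (x y : 'rV[R]_d) : (0 <= riesz_kernel b x y)%E.
Proof.
rewrite /riesz_kernel inver; case: ifP => // _.
by rewrite lee_fin invr_ge0 powR_ge0.
Qed.

Lemma riesz_kernel_ler (b r : R) (x y : 'rV[R]_d) : 0 <= b -> 0 < r -> euclid (x - y) <= r ->
  ((r `^ (- b))%:E <= riesz_kernel b x y)%E.
Proof.
move=> b0 r0 xr; rewrite /riesz_kernel inver; case: ifPn => [_|h]; first exact: leey.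
have h0 : 0 < euclid (x - y) `^ b by rewrite lt_def h powR_ge0.
rewrite lee_fin powRN lef_pV2 ?posrE//; last by rewrite powR_gt0.
by rewrite ge0_ler_powR ?nnegrE ?euclid_ge0// ltW.
Qed.

(** Off the diagonal one term is enough: if r / 2^(m+1) < |x - y| <= r / 2^m, the kernel is at most
    (r / 2^(m+1))^-b, which is the coefficient of the m-th indicator. The leading constant handles
    distances above r. *)
Lemma riesz_kernel_dyadic (b r : R) (x y : 'rV[R]_d) : 0 < b -> 0 < r ->
  (riesz_kernel b x y <= (r `^ (- b))%:E + \sum_(0 <= m <oo)
     (r `^ (- b) * (2 `^ b) ^+ m.+1 * \1_(near_diag (r / 2 ^+ m)) (x, y))%:E)%E.
Proof.
move=> b0 r0; set z := euclid (x - y).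
have t0 m : (0 <= (r `^ (- b) * (2 `^ b) ^+ m.+1 * \1_(near_diag (r / 2 ^+ m)) (x, y))%:E)%E.
  by rewrite lee_fin mulr_ge0// mulr_ge0 ?exprn_ge0 ?powR_ge0.
have z0 : 0 <= z := euclid_ge0 _.
have [zr|zr] := ltP r z.
  apply: (@le_trans _ _ (r `^ (- b))%:E); last first.
    by rewrite leeDl//; apply: nneseries_ge0 => m _ _; exact: t0.
  rewrite /riesz_kernel inver ifF; last first.
    by rewrite powR_eq0 -/z gt_eqF// (lt_trans r0).
  by rewrite lee_fin -/z -powRN; apply: ler_powRN; rewrite ?(ltW b0)// ltW.
(* On the diagonal every indicator equals 1 and every term is at least r^-b, so the series is
   infinite and matches the infinite value of the kernel. *)
have [z00|zn0] := eqVneq z 0.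
  suff -> : (\sum_(0 <= m <oo)
     (r `^ (- b) * (2 `^ b) ^+ m.+1 * \1_(near_diag (r / 2 ^+ m)) (x, y))%:E = +oo)%E.
    by rewrite addey ?leey.
  apply: eq_infty => t.
  have c0 : 0 < r `^ (- b) by rewrite powR_gt0.
  pose N := (Num.truncn (t / r `^ (- b))).+1.
  apply: le_trans (nneseries_lim_ge (P := xpredT) (m := 0) N _); last by move=> m _ _; exact: t0.
  rewrite sumEFin lee_fin.
  apply: (@le_trans _ _ (\sum_(0 <= m < N) r `^ (- b))).
    rewrite sumr_const_nat subn0 -[leRHS]mulr_natl -ler_pdivrMr//.
    by rewrite ltW// truncnS_gt.
  apply: ler_sum => m _; rewrite indicE mem_set; last first.
    by rewrite /near_diag /= -/z z00 divr_ge0// ltW.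
  rewrite mulr1 ler_peMr ?powR_ge0// exprn_ege1//.
  by rewrite ltW// powR2_gt1.
have zp : 0 < z by rewrite lt_def zn0.
have exm : exists m, r / 2 ^+ m < z.
  exists (Num.truncn (r / z)).+1; rewrite ltr_pdivrMr ?exprn_gt0// mulrC -ltr_pdivrMr//.
  apply: lt_le_trans (truncnS_gt _) _.
  by rewrite -natrX ler_nat ltnW// ltn_expl.
case: (ex_minnP exm) => -[|m]; first by rewrite expr0 divr1 ltNge zr.
move=> mz mmin.
have zm : z <= r / 2 ^+ m by rewrite leNgt; apply/negP => /mmin; rewrite ltnn.
apply: (@le_trans _ _ (r `^ (- b) * (2 `^ b) ^+ m.+1 * \1_(near_diag (r / 2 ^+ m)) (x, y))%:E).
  rewrite indicE mem_set// mulr1 /riesz_kernel inver ifF; last first.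
    by rewrite powR_eq0 -/z gt_eqF.
  rewrite lee_fin -/z -powRN.
  apply: (@le_trans _ _ ((r / 2 ^+ m.+1) `^ (- b))).
    by apply: ler_powRN; rewrite ?(ltW b0) ?divr_gt0 ?exprn_gt0// ltW.
  rewrite powRM ?invr_ge0 ?exprn_ge0 ?(ltW r0)// ler_wpM2l ?powR_ge0//.
  by rewrite powR_exprn// -[X in X `^ (- b)]powR_inv1 ?exprn_ge0// -powRrM mulN1r opprK.
apply: (@le_trans _ _ (\sum_(0 <= m <oo)
     (r `^ (- b) * (2 `^ b) ^+ m.+1 * \1_(near_diag (r / 2 ^+ m)) (x, y))%:E)%E); last first.
  by rewrite leeDr// lee_fin powR_ge0.
rewrite (nneseriesD1 (n := m))// leeDl//; apply: nneseries_ge0 => k _ _; exact: t0.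
Qed.

(** Integrating the dyadic bound of the kernel term by term leaves a geometric series of ratio 2^(b
    - a d) < 1. *)
Lemma energy_finite mu (a b : R) : (0 < d)%N -> 0 <= a < 1 -> 0 < b < a * d%:R ->
  (exists2 C : R, 0 <= C & forall xi,
    fcos mu xi ^+ 2 + fsin mu xi ^+ 2 <= C * decay a xi) ->
  (energy b mu < +oo)%E.
Proof.
move=> d0 a01 /andP[b0 bad] /(near_diag_dyadic d0 a01)[C C0 HC].
pose r : R := d%:R^-1; have r0 : 0 < r by rewrite invr_gt0 ltr0n.
have c0 : 0 <= r `^ (- b) := powR_ge0 _ _.
pose f m (p : borelType 'rV[R]_d * borelType 'rV[R]_d) :=
  (r `^ (- b) * (2 `^ b) ^+ m.+1 * \1_(near_diag (r / 2 ^+ m)) p)%:E.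
have f0 m p : (0 <= f m p)%E.
  by rewrite lee_fin mulr_ge0// mulr_ge0 ?exprn_ge0 ?powR_ge0.
have mf m : measurable_fun setT (f m).
  apply/measurable_EFinP; apply: measurable_funM; first exact: measurable_cst.
  by apply: measurable_indic; exact: measurable_near_diag.
have msum : measurable_fun setT (fun p => \sum_(0 <= m <oo) f m p)%E.
  exact: ge0_emeasurable_sum.
have sum0 p : (0 <= \sum_(0 <= m <oo) f m p)%E by apply: nneseries_ge0.
apply: (@le_lt_trans _ _ (\int[(mu \x mu)%E]_p ((r `^ (- b))%:E + \sum_(0 <= m <oo) f m p))%E).
  apply: ge0_le_integral => //.
  - by move=> p _; exact: riesz_kernel_ge0.
  - exact: measurable_riesz.
  - by apply: emeasurable_funD => //; exact: measurable_cst.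
  - by move=> [x y] _; exact: riesz_kernel_dyadic.
rewrite ge0_integralD//=.
rewrite integral_cst//= integral_nneseries//.
have muT : ((mu \x mu) setT < +oo)%E.
  rewrite -setXTT product_measure1E//.
  by rewrite -ge0_fin_numE ?mule_ge0// fin_numM// fin_num_measure.
pose q : R := 2 `^ b * 2 `^ (- (a * d%:R)).
have q0 : 0 <= q by rewrite mulr_ge0 ?powR_ge0.
have q1 : q < 1.
  rewrite /q -powRD; last by apply/implyP.
  by apply: powR2_lt1; lra.
pose K : R := r `^ (- b) * 2 `^ b * C.
have K0 : 0 <= K by rewrite !mulr_ge0 ?powR_ge0.
apply: lte_add_pinfty.
  by rewrite lte_mul_pinfty// lee_fin.
apply: (@le_lt_trans _ _ (K / (1 - q))%:E); last exact: ltry.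
apply: lime_le; first by apply: is_cvg_nneseries => m _ _; exact: integral_ge0.
apply: nearW => n.
apply: (@le_trans _ _ (\sum_(0 <= m < n) (K * q ^+ m)%:E)%E).
  apply: lee_sum => m _.
  rewrite /f; under eq_integral do rewrite EFinM.
  rewrite ge0_integralZl_EFin//=; last 2 first.
  - by apply/measurable_EFinP; apply: measurable_indic; exact: measurable_near_diag.
  - by rewrite mulr_ge0 ?exprn_ge0 ?powR_ge0.
  rewrite integral_indic//; last exact: measurable_near_diag.
  rewrite setIT; apply: le_trans (lee_wpmul2l _ (HC m)) _.
    by rewrite lee_fin mulr_ge0 ?exprn_ge0 ?powR_ge0.
  rewrite -EFinM lee_fin /K /q exprMn exprS le_eqVlt; apply/orP; left; apply/eqP; ring.
rewrite sumEFin lee_fin -mulr_sumr ler_wpM2l//.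
rewrite big_mkord.
have -> : \sum_(l < n) q ^+ l = (1 - q ^+ n) / (1 - q).
  apply: (canRL (mulfK _)); first by rewrite subr_eq0 gt_eqF.
  by rewrite -[_ - _]opprB mulrN mulrC -subrX1 opprB.
by rewrite -[leRHS]mul1r ler_wpM2r ?invr_ge0 ?subr_ge0 ?(ltW q1)// gerBl exprn_ge0.
Qed.

Lemma dim_H_ge0 A : 0 <= dim_H A.
Proof. by apply: sup_ge0 => x [/andP[]]. Qed.

Lemma dim_H_le A : dim_H A <= d%:R.
Proof. by apply: sup_le_ge0 => // x [/andP[]]. Qed.

Lemma le_dim_H A (b : R) mu : 0 <= b <= d%:R -> Mplus A mu ->
  (energy b mu < +oo)%E -> b <= dim_H A.
Proof.
move=> bd Amu ene; apply: ub_le_sup; last by split => //; exists mu.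
by exists d%:R => x [/andP[]].
Qed.

Lemma le_dim_F A (b : R) mu : 0 <= b <= d%:R -> Mplus A mu ->
  (fourier_decay b mu < +oo)%E -> b <= dim_F A.
Proof.
move=> bd Amu ene; apply: ub_le_sup; last by split => //; exists mu.
by exists d%:R => x [/andP[]].
Qed.

Lemma dim_F_le_dim_H A : (0 < d)%N -> dim_F A <= dim_H A.
Proof.
move=> d0; apply: sup_le_ge0 (dim_H_ge0 A) => alpha [/andP[al0 ald] [mu Amu dec]].
rewrite leNgt; apply/negP => Hal; have H0 := dim_H_ge0 A.
have dR : (0 : R) < d%:R by rewrite ltr0n.
(* b lies strictly between dim_H A and alpha, and a d strictly between b and alpha. Since alpha <=
   d, this gives a < 1. *)
pose b := (dim_H A + alpha) / 2; pose a := (b + alpha) / 2 / d%:R.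
have had : a * d%:R = (b + alpha) / 2 by rewrite /a divfK// gt_eqF.
have a0 : 0 <= a by rewrite /a /b; apply: divr_ge0; lra.
have a1 : a < 1 by rewrite /a ltr_pdivrMr// /b; lra.
have : b <= dim_H A.
  apply: (@le_dim_H _ _ mu) => //; first by rewrite /b; apply/andP; split; lra.
  apply: (@energy_finite _ a) => //; first by rewrite a0.
    by rewrite had /b; apply/andP; split; lra.
  by apply: (@fourier_decay_prod _ _ _ alpha) => //; rewrite had /b; lra.
by rewrite /b; lra.
Qed.

End dim_comparison.

(** * Images of Hoelder paths *)

Section holder_image.
Context {R : realType} {d : nat}.
Implicit Types (mu : {finite_measure set (borelType 'rV[R]_d) -> \bar R}) (A : set 'rV[R]_d).

Lemma compact_borel A : compact A -> measurable (A : set (borelType 'rV[R]_d)).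
Proof.
move=> cA; rewrite -[A]setCK; apply: measurableC.
apply: sub_sigma_algebra; rewrite openC.
by apply: compact_closed => //; exact: norm_hausdorff.
Qed.

(** Cauchy-Schwarz, from the nonnegativity of a variance. *)
Lemma sum_sqr_ge (I : finType) (x : I -> R) :
  (\sum_i x i) ^+ 2 <= #|I|%:R * \sum_i x i ^+ 2.
Proof.
have [I0|I0] := posnP #|I|.
  by rewrite I0 mul0r big_pred0 ?expr0n// => i; have := fintype0 i I0.
set M := \sum_i x i.
have n0 : (0 : R) < #|I|%:R by rewrite ltr0n.
have : 0 <= \sum_i (x i - M / #|I|%:R) ^+ 2 by apply: sumr_ge0 => i _; exact: sqr_ge0.
have -> : \sum_i (x i - M / #|I|%:R) ^+ 2 = \sum_i x i ^+ 2 - M ^+ 2 / #|I|%:R.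
  pose c := M / #|I|%:R.
  have -> : \sum_i (x i - M / #|I|%:R) ^+ 2 = \sum_i (x i ^+ 2 - x i * (2 * c) + c ^+ 2).
    by apply: eq_bigr => i _; rewrite -/c; ring.
  rewrite big_split /= sumrB -mulr_suml -/M /c.
  by rewrite sumr_const -[_ *+ #|_|]mulr_natl; field; rewrite gt_eqF.
by rewrite subr_ge0 ler_pdivrMr// mulrC.
Qed.

(** [seqDU] makes the cover disjoint. The kernel is at least r^-b on each square D_i x D_i, and by
    Cauchy-Schwarz the squares of the masses mu (D_i) sum to at least (mass mu)^2 / N. *)
Lemma energy_partition_ge mu (b r : R) (N : nat) (B : nat -> set 'rV[R]_d) :
  0 < b -> 0 < r -> (forall i, compact (B i)) ->
  (forall i x y, B i x -> B i y -> euclid (x - y) <= r) ->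
  mu (~` (\big[setU/set0]_(i < N) B i)) = 0%E ->
  ((r `^ (- b) * mass mu ^+ 2 / N%:R)%:E <= energy b mu)%E.
Proof.
move=> b0 r0 cB dB mu0.
case: N mu0 => [|N] mu0; first by rewrite invr0 mulr0 integral_ge0// => p _; exact: riesz_kernel_ge0.
have mB i : measurable (B i : set (borelType 'rV[R]_d)) by exact: compact_borel.
pose D i : set (borelType 'rV[R]_d) := seqDU B i.
have mD i : measurable (D i).
  by apply: measurableD => //; apply: bigsetU_measurable => k _; exact: mB.
have tD : trivIset setT D by exact: trivIset_seqDU.
have DB i x : D i x -> B i x by case.
have massE : mass mu = \sum_(i < N.+1) fine (mu (D i)).
  rewrite /mass -[in LHS](setUv (\big[setU/set0]_(i < N.+1) B i)).
  rewrite measureU//; last 3 first.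
  - by apply: bigsetU_measurable => i _; exact: mB.
  - by apply: measurableC; apply: bigsetU_measurable => i _; exact: mB.
  - by rewrite setICr.
  rewrite [X in fine (_ + X)%R](_ : _ = 0%E); last exact: mu0.
  rewrite [X in fine (mu X + _)%R](_ : _ = \big[setU/set0]_(i < N.+1) D i); last first.
    by rewrite /D bigsetU_seqDU.
  rewrite [(_ + 0)%R]adde0 measure_semi_additive_ord//; last 2 first.
  - by apply/trivIsetP => i j _ _ ij; move/trivIsetP : tD; exact.
  - by apply: bigsetU_measurable => i _; exact: mD.
  transitivity (fine (\sum_(i < N.+1) (fine (mu (D i)))%:E)%E); last by rewrite sumEFin.
  by congr fine; apply: eq_bigr => i _; rewrite fineK//; exact: fin_num_measure.
pose F (p : borelType 'rV[R]_d * borelType 'rV[R]_d) : \bar R :=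
  (\sum_(i < N.+1) (r `^ (- b))%:E * (\1_(D i `*` D i) p)%:E)%E.
have mDD i : measurable (D i `*` D i) by exact: measurableX.
have mF : measurable_fun setT F.
  apply: emeasurable_sum => i; apply: emeasurable_funM; first exact: measurable_cst.
  by apply/measurable_EFinP; exact: measurable_indic.
apply: (@le_trans _ _ (\int[(mu \x mu)%E]_p F p)%E); last first.
  apply: ge0_le_integral => //.
  - move=> p _; apply: sume_ge0 => i _.
    by rewrite mule_ge0// lee_fin ?powR_ge0.
  - exact: measurable_riesz.
  move=> [x y] _ /=; rewrite /F.
  have [[i [Dx Dy]]|no] := pselect (exists i : 'I_N.+1, D i x /\ D i y).
    rewrite (bigD1 i)//= big1 ?adde0.
      rewrite indicE mem_set//= mule1; apply: riesz_kernel_ler => //; first exact: ltW.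
      by apply: (dB i); exact: DB.
    move=> j ji; rewrite indicE memNset ?mule0//= => -[Djx _].
    move/trivIsetP : tD => /(_ j i I I ji) /seteqP[/(_ x) + _].
    by apply.
  rewrite big1 ?riesz_kernel_ge0// => i _.
  by rewrite indicE memNset ?mule0// => -[/= Dx Dy]; apply: no; exists i.
rewrite /F ge0_integral_sum//; last 2 first.
- by move=> i; apply: emeasurable_funM; [exact: measurable_cst|apply/measurable_EFinP; exact: measurable_indic].
- by move=> i p _; rewrite mule_ge0// lee_fin ?powR_ge0.
have -> : (\sum_(i < N.+1) \int[(mu \x mu)%E]_p ((r `^ (- b))%:E * (\1_(D i `*` D i) p)%:E) =
   (\sum_(i < N.+1) r `^ (- b) * fine (mu (D i)) ^+ 2)%:E)%E.
  rewrite -sumEFin; apply: eq_bigr => i _.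
  rewrite ge0_integralZl_EFin//; last 2 first.
  - by apply/measurable_EFinP; exact: measurable_indic.
  - exact: powR_ge0.
  rewrite [X in (_ * X)%E](_ : _ = mu (D i) * mu (D i))%E; last first.
    by rewrite integral_indic// setIT; exact: product_measure1E.
  by rewrite EFinM expr2 EFinM fineK//; exact: fin_num_measure.
rewrite lee_fin -mulr_sumr -mulrA ler_wpM2l ?powR_ge0// ler_pdivrMr// mulrC.
by have := @sum_sqr_ge _ (fun i : 'I_N.+1 => fine (mu (D i))); rewrite card_ord massE.
Qed.

(** N + 1 equal time intervals have images of diameter at most a constant times (N + 1)^-delta. The
    energy is therefore at least a constant times (N + 1)^(b delta - 1), which is unbounded in N
    when b > 1 / delta. *)
Lemma dim_H_holder_image (f : R -> 'rV[R]_d) (s t K delta : R) :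
  s < t -> 0 < K -> 0 < delta -> continuous f ->
  (forall u v, s <= u <= t -> s <= v <= t -> euclid (f u - f v) <= K * `|u - v| `^ delta) ->
  dim_H (f @` `[s, t]) <= delta^-1.
Proof.
move=> st K0 d0 cf hf; apply: sup_le_ge0; last by rewrite invr_ge0 ltW.
move=> b [/andP[b0 bd] [mu [mu0 muA] fin]].
rewrite leNgt; apply/negP => db.
have b0' : 0 < b by apply: lt_trans db; rewrite invr_gt0.
have m0 : 0 < mass mu.
  by rewrite fine_gt0// mu0 mu_fin.
have ts : 0 < t - s by rewrite subr_gt0.
pose rr (N : nat) : R := K * ((t - s) / N.+1%:R) `^ delta.
have rr0 N : 0 < rr N by rewrite mulr_gt0// powR_gt0// divr_gt0.
have key N : ((rr N) `^ (- b) * mass mu ^+ 2 / N.+1%:R <= fine (energy b mu))%R.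
  have fe : energy b mu \is a fin_num.
    rewrite fin_real// fin andbT.
    by apply: lt_le_trans (integral_ge0 _ _) => // p _; exact: riesz_kernel_ge0.
  rewrite -lee_fin fineK//.
  pose B i := f @` `[s + (t - s) * i%:R / N.+1%:R, s + (t - s) * i.+1%:R / N.+1%:R].
  pose B' i := if (i < N.+1)%N then B i else set0.
  apply: (@energy_partition_ge _ _ _ _ B') => //.
  - move=> i; rewrite /B'; case: ifP => _; last exact: compact0.
    apply: continuous_compact; last exact: segment_compact.
    exact: continuous_subspaceT.
  - move=> i x y; rewrite /B'; case: ifP => // iN [u + <-] [v + <-].
    rewrite /= !in_itv /= => /andP[u1 u2] /andP[v1 v2].
    have h1 : (t - s) * i.+1%:R / N.+1%:R = (t - s) * i%:R / N.+1%:R + (t - s) / N.+1%:R.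
      by rewrite -natr1; field.
    have h2 : (t - s) * i.+1%:R / N.+1%:R <= t - s.
      by rewrite ler_pdivrMr// ler_pM2l// ler_nat.
    have h3 : 0 <= (t - s) * i%:R / N.+1%:R by rewrite divr_ge0// mulr_ge0// ltW.
    move: u1 u2 v1 v2; rewrite h1; move: h2 h3; rewrite h1.
    set p := (_ * i%:R / _); set q := (_ / _) => h2 h3 u1 u2 v1 v2.
    have hu : s <= u <= t by apply/andP; split; lra.
    have hv : s <= v <= t by apply/andP; split; lra.
    apply: le_trans (hf _ _ hu hv) _.
    rewrite ler_pM2l// ge0_ler_powR ?nnegrE ?(ltW d0) ?divr_ge0 ?(ltW ts)//.
    by rewrite -/q ler_norml; apply/andP; split; lra.
  - apply/eqP; rewrite eq_le measure_ge0 andbT -muA.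
    apply: le_measure; rewrite ?inE.
    + apply: measurableC; apply: bigsetU_measurable => i _.
      apply: compact_borel; rewrite /B'; case: ifP => _; last exact: compact0.
      apply: continuous_compact; last exact: segment_compact.
      exact: continuous_subspaceT.
    + apply: measurableC; apply: compact_borel.
      apply: continuous_compact; last exact: segment_compact.
      exact: continuous_subspaceT.
    apply: subsetC => x [u]; rewrite /= in_itv /= => /andP[su ut] <-.
    pose z := (u - s) / (t - s) * N.+1%:R.
    have z0 : 0 <= z by rewrite mulr_ge0// divr_ge0; lra.
    have zu : (t - s) * z / N.+1%:R = u - s by rewrite /z mulrA mulfK// mulrC divfK// gt_eqF.
    have [uN|uN] := ltP z N.+1%:R.
      have /andP[z1 z2] := truncn_itv z0.
      have iN : (Num.truncn z < N.+1)%N by rewrite -(ltr_nat R); apply: le_lt_trans uN.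
      rewrite -bigcup_mkord; exists (Num.truncn z) => //; rewrite /B' iN; exists u => //=.
      have h1 : (t - s) * (Num.truncn z)%:R / N.+1%:R <= (t - s) * z / N.+1%:R.
        by rewrite ler_pM2r ?invr_gt0// ler_pM2l.
      have h2 : (t - s) * z / N.+1%:R <= (t - s) * (Num.truncn z).+1%:R / N.+1%:R.
        by rewrite ler_pM2r ?invr_gt0// ler_pM2l// ltW.
      by rewrite in_itv /=; apply/andP; split; [rewrite -lerBrDl -zu|rewrite -lerBlDl -zu].
    (* Only u = t reaches this case: its index would be N + 1, and it belongs to the last piece
       because the pieces are closed. *)
    rewrite -bigcup_mkord; exists N => //=; rewrite /B' ltnSn; exists u => //=.
    have h1 : (t - s) * N%:R / N.+1%:R <= (t - s) * z / N.+1%:R.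
      by rewrite ler_pM2r ?invr_gt0// ler_pM2l// (le_trans _ uN)// ler_nat.
    have h2 : (t - s) * N.+1%:R / N.+1%:R = t - s by rewrite mulfK.
    by rewrite in_itv /=; apply/andP; split; [rewrite -lerBrDl -zu|rewrite -lerBlDl h2 lerB].
pose e := b * delta - 1.
have e0 : 0 < e by rewrite subr_gt0 -ltr_pdivrMr// div1r.
pose C := K `^ (- b) * ((t - s) `^ delta) `^ (- b) * mass mu ^+ 2.
have C0 : 0 < C by rewrite !mulr_gt0 ?powR_gt0 ?exprn_gt0.
have key2 N : C * N.+1%:R `^ e <= fine (energy b mu).
  apply: le_trans (key N); rewrite le_eqVlt; apply/orP; left; apply/eqP.
  have n0 : (0 : R) < N.+1%:R by [].
  have -> : rr N `^ (- b) =
      K `^ (- b) * (((t - s) `^ delta) `^ (- b) * ((N.+1%:R^-1 : R) `^ delta) `^ (- b)).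
    rewrite /rr powRM ?powR_ge0 ?(ltW K0)//; congr (_ * _).
    by rewrite -powRM ?powR_ge0// -powRM// ltW.
  have -> : ((N.+1%:R^-1 : R) `^ delta) `^ (- b) = N.+1%:R `^ e * N.+1%:R.
    rewrite -powRrM -powR_inv1// -powRrM -[X in _ = _ * X]powRr1// -powRD.
      by congr (_ `^ _); rewrite /e; ring.
    by apply/implyP => _; rewrite pnatr_eq0.
  by rewrite /C; field.
set E := fine _ in key2.
have E0 : 0 <= E / C by rewrite divr_ge0 ?(ltW C0)// (le_trans _ (key2 0%N))// mulr_ge0 ?powR_ge0// ltW.
(* With this y, the power y^e is E / C + 1, so that truncn y + 1 pieces already contradict
   [key2]. *)
pose y := (E / C + 1) `^ e^-1.
have := key2 (Num.truncn y).
rewrite leNgt => /negP; apply.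
rewrite -ltr_pdivrMl// mulrC.
apply: (@lt_le_trans _ _ (y `^ e)).
  rewrite /y -powRrM mulVf ?gt_eqF// powRr1; lra.
rewrite ge0_ler_powR ?nnegrE ?powR_ge0 ?(ltW e0)// ltW// truncnS_gt//.
Qed.

End holder_image.

(** * Measures with integrable Fourier transform *)

Section interior.
Context {R : realType} {d : nat}.
Implicit Types (x y z xi : 'rV[R]_d).

Definition cis (a : R) : R[i] := Complex (cos a) (sin a).

Lemma cisD a b : cis (a + b) = cis a * cis b.
Proof.
rewrite /cis cosD sinD; apply/eqP; rewrite eq_complex /=.
by apply/andP; split; apply/eqP; ring.
Qed.

Lemma cis_sum (I : Type) (r : seq I) (P : pred I) (u : I -> R) :
  cis (\sum_(i <- r | P i) u i) = \prod_(i <- r | P i) cis (u i).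
Proof. by apply: (big_morph cis cisD); rewrite /cis cos0 sin0. Qed.

Definition sqn (z : R[i]) : R := complex.Re z ^+ 2 + complex.Im z ^+ 2.

Lemma sqnM (z w : R[i]) : sqn (z * w) = sqn z * sqn w.
Proof. by case: z w => [a b] [c e]; rewrite /sqn /=; ring. Qed.

Lemma sqn_prod (I : Type) (r : seq I) (P : pred I) (u : I -> R[i]) :
  sqn (\prod_(i <- r | P i) u i) = \prod_(i <- r | P i) sqn (u i).
Proof. by apply: (big_morph sqn sqnM); rewrite /sqn /= expr1n expr0n addr0. Qed.

Lemma sqnX (z : R[i]) n : sqn (z ^+ n) = sqn z ^+ n.
Proof.
elim: n => [|n IH]; last by rewrite !exprS sqnM IH.
by rewrite /sqn /= expr1n expr0n addr0.
Qed.

Lemma sqn_ge0 (z : R[i]) : 0 <= sqn z. Proof. by rewrite addr_ge0 ?sqr_ge0. Qed.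

Lemma sum_complex (I : finType) (f : I -> R[i]) :
  \sum_i f i = Complex (\sum_i complex.Re (f i)) (\sum_i complex.Im (f i)).
Proof. by elim/big_rec3: _ => // i y1 y2 z _ ->; case: (f i). Qed.

Lemma tker_sqn (V : finType) (freq : V -> 'rV[R]_d) z :
  tker freq z = sqn (\sum_v cis (dotv (freq v) z)).
Proof. by rewrite sum_complex. Qed.

Lemma tker_lattice_prod n z :
  tker (@lattice R d n) z = \prod_(j < d) sqn (\sum_(k < n) cis (k%:R * z 0 j)).
Proof.
rewrite tker_sqn -sqn_prod bigA_distr_bigA; congr sqn; apply: eq_bigr => v _.
by rewrite -cis_sum; congr cis; apply: eq_bigr => j _; rewrite mxE.
Qed.

Lemma sqn_dirichlet_le n (t : R) : sqn (\sum_(k < n) cis (k%:R * t)) <= n%:R ^+ 2.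
Proof.
have -> : sqn (\sum_(k < n) cis (k%:R * t)) =
    \sum_(k < n) \sum_(l < n) cos (k%:R * t - l%:R * t).
  rewrite sum_complex /sqn /= !expr2 !mulr_suml -big_split; apply: eq_bigr => v _ /=.
  by rewrite !mulr_sumr -big_split; apply: eq_bigr => w _ /=; rewrite cosB.
apply: (@le_trans _ _ (\sum_(k < n) \sum_(l < n) 1)).
  by apply: ler_sum => k _; apply: ler_sum => l _; exact: cos_le1.
by rewrite !sumr_const !card_ord -[leLHS]mulr_natl expr2.
Qed.

(** The sum is geometric: times exp (i t) - 1, of square modulus 2 - 2 cos t, it has square modulus
    at most 4. The bound 2 <= pi keeps t within half a period, where cos t <= cos r. *)
Lemma sqn_dirichlet_far n (r t : R) : 0 < r -> r <= `|t| <= 2 ->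
  sqn (\sum_(k < n) cis (k%:R * t)) <= 4 / (2 - 2 * cos r).
Proof.
move=> r0 /andP[rt t2].
have pi2 : (2 : R) <= pi := @pi_ge2 R.
have in0pi (x : R) : 0 <= x <= 2 -> x \in `[0, pi].
  by rewrite in_itv /= => /andP[-> x1]; apply: le_trans x1 _.
have r2 : r <= 2 := le_trans rt t2.
have c1 : cos r < 1 by rewrite -[ltRHS]cos0 ltr_cos//; apply: in0pi; rewrite ?lexx ?ler0n ?(ltW r0) ?r2.
rewrite ler_pdivlMr; last by lra.
have tele : (\sum_(k < n) cis (k%:R * t)) * (cis t - 1) = cis (n%:R * t) - 1.
  elim: n => [|n IH]; first by rewrite big_ord0 !mul0r /cis cos0 sin0 subrr.
  rewrite big_ord_recr /= mulrDl IH -natr1 mulrDl mul1r cisD; ring.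
have sB a : sqn (cis a - 1) = 2 - 2 * cos a.
  rewrite /sqn /=; have := cos2Dsin2 a; rewrite subr0 => h.
  by rewrite sqrrB expr1n mulr1; lra.
have := congr1 sqn tele; rewrite sqnM !sB => e.
apply: (@le_trans _ _ (2 - 2 * cos (n%:R * t))); last first.
  have := cos_geN1 (n%:R * t); lra.
rewrite -e ler_wpM2l ?sqn_ge0// lerB// ler_pM2l//.
rewrite -[cos t]cos_norm leNgt ltr_cos -?leNgt//; apply: in0pi; rewrite ?normr_ge0//.
by rewrite (ltW r0).
Qed.


(** * Powers of the Fejer kernel *)

Section tensor_kernel.
Context (n p : nat).

(** Sums of p + 1 lattice points, the frequencies of the power p + 1 of the lattice kernel. The
    power is needed for localisation: where a single coordinate is away from 0, the lattice kernel
    is still of order n^(2 d - 2), which its normalisation n^d does not beat for d >= 2. For d = p +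
    1 the power is of order n^(2 d (d - 1)) there, against a normalisation n^(d (2 d - 1)). *)
Definition lfreq (v : {ffun 'I_d -> 'I_n} * {ffun 'I_p -> {ffun 'I_d -> 'I_n}}) : 'rV[R]_d :=
  lattice v.1 + \sum_(l < p) lattice (v.2 l).

Lemma dotv_suml (I : Type) (r : seq I) (u : I -> 'rV[R]_d) z :
  dotv (\sum_(i <- r) u i) z = \sum_(i <- r) dotv (u i) z.
Proof.
apply: (big_morph (fun x => dotv x z)) => [x y|]; first exact: dotvDl.
exact: dotv0.
Qed.

Lemma tker_lfreq z : tker lfreq z = tker (@lattice R d n) z ^+ p.+1.
Proof.
rewrite !tker_sqn -sqnX; congr sqn.
rewrite exprS -[X in _ ^+ X](card_ord p) -prodr_const bigA_distr_bigA big_distrlr pair_bigA /=.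
apply: eq_bigr => -[v u] _ /=; rewrite /lfreq /= dotvDl cisD; congr (_ * _).
by rewrite dotv_suml cis_sum.
Qed.

Lemma card_lfreq : #|{: {ffun 'I_d -> 'I_n} * {ffun 'I_p -> {ffun 'I_d -> 'I_n}}}| =
  ((n ^ d) ^ p.+1)%N.
Proof. by rewrite card_prod !card_ffun !card_ord expnS. Qed.

(** With w and [v.2] fixed, the sum over [v.1] is a lattice sum around some centre, and
    [sum_decay_le] is uniform in the centre; the remaining indices are merely counted. *)
Lemma sum_decay_lfreq_le a : 0 <= a ->
  \sum_v \sum_w decay a (lfreq v - lfreq w) <=
  n%:R ^+ (d * (p + p.+1)) * (\sum_(k < n) (1 + k%:R / 2) `^ (- a)) ^+ d.
Proof.
move=> a0; rewrite exchange_big /=; set S := (X in _ * X).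
have H w : \sum_v decay a (lfreq v - lfreq w) <= n%:R ^+ (d * p) * S.
  rewrite -(pair_bigA _ (fun v u => decay a (lfreq (v, u) - lfreq w))) /= exchange_big /=.
  apply: (@le_trans _ _ (\sum_(u : {ffun 'I_p -> {ffun 'I_d -> 'I_n}}) S)).
    apply: ler_sum => u _; apply: le_trans (sum_decay_le _ (lfreq w - \sum_(l < p) lattice (u l)) a0).
    rewrite le_eqVlt; apply/orP; left; apply/eqP; apply: eq_bigr => v _.
    by congr decay; rewrite /lfreq /= opprB addrA.
  by rewrite sumr_const !card_ffun !card_ord -[leLHS]mulr_natl !natrX exprM.
apply: (@le_trans _ _ (\sum_(w : {ffun 'I_d -> 'I_n} * {ffun 'I_p -> {ffun 'I_d -> 'I_n}})
   n%:R ^+ (d * p) * S)); first by apply: ler_sum.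
rewrite sumr_const card_lfreq -[leLHS]mulr_natl !natrX -exprM mulrA -exprD.
by rewrite -mulnDr (addnC p).
Qed.

(** Only pairs of equal frequency are kept. The n^(d (p + 1)) indices take at most (2 (p + 1) n)^d
    frequencies, so by Cauchy-Schwarz there are at least n^(d (2 p + 1)) / (2 (p + 1))^d such
    pairs. *)
Lemma sum_collisions_ge (c : R) (f : 'rV[R]_d -> R) : 0 <= c -> (0 < n)%N ->
  (forall xi, 0 <= f xi) -> f 0 = c ->
  n%:R ^+ (d * (p + p.+1)) * ((2 * p.+1)%:R ^- d * c) <= \sum_v \sum_w f (lfreq v - lfreq w).
Proof.
move=> c0 n0 f0 fc.
pose W := ({ffun 'I_d -> 'I_n} * {ffun 'I_p -> {ffun 'I_d -> 'I_n}})%type.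
pose S := {ffun 'I_d -> 'I_(p.+1 * n).+1}.
pose phi (v : W) : S := [ffun j => inord (v.1 j + \sum_(l < p) v.2 l j)%N].
have phiP v w : phi v = phi w -> lfreq v = lfreq w.
  move=> /ffunP pvw; apply/rowP => j; move: (pvw j); rewrite !ffunE => /(congr1 val) /=.
  have le (u : W) : (u.1 j + \sum_(l < p) u.2 l j < (p.+1 * n).+1)%N.
    rewrite ltnS mulSn leq_add ?(ltnW (ltn_ord _))//.
    apply: (@leq_trans (\sum_(l < p) n)); first by apply: leq_sum => l _; rewrite ltnW.
    by rewrite sum_nat_const card_ord.
  rewrite !inordK// => e; have lE (u : W) : lfreq u 0 j = (u.1 j + \sum_(l < p) u.2 l j)%N%:R.
    rewrite /lfreq !mxE summxE natrD natr_sum; congr (_ + _).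
    by apply: eq_bigr => l _; rewrite mxE.
  by rewrite !lE e.
pose N (s : S) : R := \sum_(v : W) (phi v == s)%:R.
have NS : \sum_s N s = n%:R ^+ (d * p.+1).
  rewrite /N exchange_big /=.
  transitivity (\sum_(v : W) (1 : R)).
    by apply: eq_bigr => v _; rewrite (bigD1 (phi v))//= eqxx big1 ?addr0// => s /negPf; rewrite eq_sym => ->.
  by rewrite sumr_const card_lfreq natrX exprM natrX.
have N2 : \sum_s N s ^+ 2 = \sum_(v : W) \sum_(w : W) (phi v == phi w)%:R.
  transitivity (\sum_s \sum_(v : W) \sum_(w : W) ((phi v == s)%:R * (phi w == s)%:R : R)).
    apply: eq_bigr => s _; rewrite expr2 mulr_suml; apply: eq_bigr => v _.
    by rewrite mulr_sumr.
  rewrite exchange_big; apply: eq_bigr => v _; rewrite exchange_big; apply: eq_bigr => w _.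
  rewrite (bigD1 (phi v))//= eqxx mul1r big1 ?addr0 1?eq_sym// => s /negPf.
  by rewrite eq_sym => ->; rewrite mul0r.
have := @sum_sqr_ge R S N; rewrite NS N2 => CS.
apply: (@le_trans _ _ (\sum_(v : W) \sum_(w : W) c * (phi v == phi w)%:R)); last first.
  apply: ler_sum => v _; apply: ler_sum => w _.
  by case: eqP => [/phiP ->|_]; rewrite ?subrr ?fc ?mulr1// mulr0.
under eq_bigr do rewrite -mulr_sumr.
rewrite -mulr_sumr [in leRHS]mulrC mulrA ler_wpM2r//.
have nR : (0 : R) < n%:R by rewrite ltr0n.
rewrite ler_pdivrMr ?exprn_gt0// -(ler_pM2l (exprn_gt0 d nR)) -exprD -mulnS -addSn.
rewrite mulnDr exprD -expr2; apply: le_trans CS _.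
rewrite card_ffun !card_ord natrX [leRHS]mulrCA [leLHS]mulrC ler_wpM2l//.
  by apply: sumr_ge0 => v _; apply: sumr_ge0 => w _; rewrite ler0n.
by rewrite -exprMn lerXn2r ?nnegrE// -natrM ler_nat; nia.
Qed.

End tensor_kernel.

Lemma cos_lipschitz (A B : R) : `|cos A - cos B| <= `|A - B|.
Proof.
wlog BA : A B / B <= A.
  move=> H; have [/H//|/ltW /H] := leP B A.
  by rewrite distrC (distrC B).
have [c _ ->] : exists2 c, c \in `[B, A] & cos A - cos B = - sin c * (A - B).
  apply: MVT_segment => //; last exact/continuous_subspaceT/continuous_cos.
by rewrite normrM normrN ler_piMl// sin_max.
Qed.

Lemma sin_lipschitz (A B : R) : `|sin A - sin B| <= `|A - B|.
Proof.
have H (x : R) : sin x = - cos (x + pi / 2) by rewrite cosDpihalf opprK.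
rewrite !H -opprD normrN; apply: le_trans (cos_lipschitz _ _) _.
by rewrite opprD addrACA subrr addr0.
Qed.

(** Interpolation between the trivial bound 2 and the Lipschitz bound: a small exponent e makes a
    phase increment cost only a small power of the frequency. *)
Lemma cos_sin_dist_le (A B t e : R) : 0 <= e <= 1 -> `|A - B| <= t ->
  `|cos A - cos B| <= 2 * t `^ e /\ `|sin A - sin B| <= 2 * t `^ e.
Proof.
move=> /andP[e0 e1] ABt; have t0 : 0 <= t by apply: le_trans ABt.
have two : `|cos A - cos B| <= 2 /\ `|sin A - sin B| <= 2.
  have := cos_max A; have := cos_max B; have := sin_max A; have := sin_max B => h1 h2 h3 h4.
  by split; apply: le_trans (ler_normB _ _) _; lra.
have [t1|t1] := leP 1 t.
  have t1e : 1 <= t `^ e by rewrite -(powRr0 t) ler_powR.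
  by case: two => c s; split; [apply: le_trans c _|apply: le_trans s _]; lra.
have te : t <= t `^ e.
  have [->|tn0] := eqVneq t 0; first exact: powR_ge0.
  by rewrite -[leLHS]powRr1// ger_powR// lt_def tn0 t0 ltW.
by split; [apply: le_trans (cos_lipschitz _ _) _|apply: le_trans (sin_lipschitz _ _) _];
  apply: le_trans ABt _; lra.
Qed.

End interior.

(** * Interior of a compact set carrying such a measure *)

Section interior_lemma.
Context {R : realType} {p : nat}.
Local Notation d := p.+1.
Context (mu : {finite_measure set (borelType 'rV[R]_d) -> \bar R}) (A : set 'rV[R]_d).
Hypotheses (cA : compact A) (muA : mu (~` A) = 0%E).

Lemma Rintegral_le_support (f : borelType 'rV[R]_d -> R) (c : R) :
  bmeas setT f -> (forall x, A x -> f x <= c) -> \int[mu]_x f x <= c * mass mu.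
Proof.
move=> bf fc; have mA : measurable (A : set (borelType 'rV[R]_d)) := compact_borel cA.
have mAc := measurableC mA.
have bS (D : set (borelType 'rV[R]_d)) : measurable D -> bmeas D f.
  move=> mD; case: bf => mf [M fM]; split; last by exists M => x _; exact: fM.
  exact: measurable_funS mf.
have fin (D : set (borelType 'rV[R]_d)) : measurable D -> (mu D < +oo)%E.
  by move=> mD; rewrite -ge0_fin_numE//; exact: fin_num_measure.
have -> : \int[mu]_x f x = \int[mu]_(x in A) f x + \int[mu]_(x in ~` A) f x.
  rewrite -(setUv A) Rintegral_setU//.
  - rewrite setUv; apply: bmeas_integrable => //; exact: mu_fin.
  - by apply/disj_setPS; rewrite setICr.
have z : \int[mu]_(x in ~` A) f x = 0.
  case: (bf) => _ [M fM].
  have := @Rintegral_norm_le _ _ _ mu _ mAc (fin _ mAc) f M (bS _ mAc) (fun x _ => fM x I).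
  rewrite [X in fine X](_ : _ = 0%E); last exact: muA.
  by rewrite mulr0 => h; apply/eqP; rewrite -normr_le0.
have massA : mass mu = fine (mu A).
  transitivity (fine (mu A + mu (~` A))%E).
    by rewrite /mass -measureU// ?setICr// setUv.
  by rewrite [X in fine (_ + X)%E](_ : _ = 0%E) ?adde0//; exact: muA.
rewrite z addr0 massA -Rintegral_cst//; apply: bmeas_le_Rintegral => //.
- exact: fin.
- exact: bS.
- exact: bmeas_cst.
Qed.

Context (a C : R).
Hypotheses (a12 : 1 < a <= 2) (C0 : 0 <= C)
  (cosC : forall xi, `|fcos mu xi| <= C * decay a xi)
  (sinC : forall xi, `|fsin mu xi| <= C * decay a xi).

(* mu convolved with a power of the Fejer kernel, whose integral is of the order of the normalisation. *)
Definition mollified m x : R :=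
  (2 ^+ m) ^- (d * (p + d)) * tconv mu (@lfreq R d (2 ^ m) p) x.

(** Half of the excess a - 1 is spent on Hoelder continuity. The decay exponent a' = (a + 1) / 2
    that remains still exceeds 1, so the lattice sums, hence the constant, are bounded independently
    of m. *)
Lemma mollified_equicontinuous : exists2 B : R, 0 <= B & forall m (x y : 'rV[R]_d) t, 0 <= t ->
  (forall j, `|x 0 j - y 0 j| <= t) ->
  `|mollified m x - mollified m y| <= B * t `^ ((a - 1) / 2).
Proof.
have /andP[a1 a2] := a12.
set e := (a - 1) / 2; have e0 : 0 <= e by rewrite divr_ge0// subr_ge0 ltW.
have e1 : e <= 1 by rewrite ler_pdivrMr//; lra.
pose a' := (a + 1) / 2; have a'1 : 1 < a' by rewrite /a'; lra.
have [S S0 HS] := dyadic_sum_bounded a'1.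
exists (4 * C * d%:R `^ e * S ^+ d).
  by rewrite !mulr_ge0 ?powR_ge0 ?exprn_ge0.
move=> m x y t t0 xyt.
rewrite /mollified -mulrBr normrM ger0_norm ?invr_ge0 ?exprn_ge0//.
set n := (2 ^ m)%N; set fr := @lfreq R d n p.
have cn : 2 ^+ m = n%:R :> R by rewrite natrX.
rewrite ler_pdivrMl ?exprn_gt0// !tconvE -sumrB.
have term (v w : 'rV[R]_d) (eta := v - w) :
   `|cos (dotv eta x) * fcos mu eta + sin (dotv eta x) * fsin mu eta -
     (cos (dotv eta y) * fcos mu eta + sin (dotv eta y) * fsin mu eta)| <=
   4 * C * d%:R `^ e * t `^ e * decay a' eta.
  have -> : cos (dotv eta x) * fcos mu eta + sin (dotv eta x) * fsin mu eta -
     (cos (dotv eta y) * fcos mu eta + sin (dotv eta y) * fsin mu eta) =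
     (cos (dotv eta x) - cos (dotv eta y)) * fcos mu eta +
     (sin (dotv eta x) - sin (dotv eta y)) * fsin mu eta by ring.
  (* P dominates every |eta_j| and has the product form of [decay], so that P^e is absorbed factor
     by factor. *)
  pose P : R := \prod_(j < d) (1 + `|eta 0 j|).
  have P1 j : `|eta 0 j| <= P.
    rewrite /P (bigD1 j)//=; set Q := \prod_(_ | _) _.
    have Q1 : 1 <= Q.
      rewrite /Q; elim/big_ind: _ => // [u v' u1 v1|i _]; last by rewrite lerDl.
      by rewrite mulr_ege1.
    by apply: le_trans (ler_peMr _ Q1); rewrite ?addr_ge0// lerDr.
  have P0 : 0 <= P by apply: le_trans (P1 0).
  have dist : `|dotv eta x - dotv eta y| <= d%:R * t * P.
    rewrite -dotvBr; apply: le_trans (@dotv_norm_le _ _ eta (x - y) t _) _.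
      by move=> i; rewrite !mxE.
    rewrite [leRHS]mulrAC ler_wpM2r//.
    rewrite (le_trans (ler_sum _ (fun i _ => P1 i)))//.
    by rewrite sumr_const card_ord -[leLHS]mulr_natl.
  have e01 : 0 <= e <= 1 by rewrite e0.
  have [c s] := cos_sin_dist_le e01 dist.
  have dec : P `^ e * decay a eta = decay a' eta.
    rewrite /P /decay; under [RHS]eq_bigr => j _.
      rewrite /decay1 (_ : - a' = e - a); last by rewrite /a' /e; field.
      rewrite powRD; last by apply/implyP => _; rewrite gt_eqF// ltr_pwDl.
      over.
    rewrite big_split /=; congr (_ * _).
    suff [] : 0 <= P /\ P `^ e = \prod_(j < d) (1 + `|eta 0 j|) `^ e by [].
    rewrite /P; apply: (@big_ind2 _ _ (fun u v => 0 <= u /\ u `^ e = v)) => //.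
      by rewrite powR1.
    by move=> x1 x2 y1 y2 [h1 <-] [h2 <-]; rewrite mulr_ge0// powRM.
  rewrite (le_trans (ler_normD _ _))// !normrM.
  have -> : 4 * C * d%:R `^ e * t `^ e * decay a' eta =
     2 * (d%:R * t * P) `^ e * (C * decay a eta) + 2 * (d%:R * t * P) `^ e * (C * decay a eta).
    rewrite -dec !powRM ?mulr_ge0//; ring.
  by rewrite lerD// ler_pM.
apply: le_trans (ler_norm_sum _ _ _) _.
apply: (@le_trans _ _ (\sum_v \sum_w 4 * C * d%:R `^ e * t `^ e * decay a' (fr v - fr w))).
  apply: ler_sum => v _; rewrite -sumrB (le_trans (ler_norm_sum _ _ _))//.
  by apply: ler_sum => w _; exact: term.
under eq_bigr do rewrite -mulr_sumr.
rewrite -mulr_sumr.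
have a'0 : 0 <= a' by lra.
have K0 : 0 <= 4 * C * d%:R `^ e * t `^ e by rewrite !mulr_ge0 ?powR_ge0.
apply: le_trans (ler_wpM2l K0 (sum_decay_lfreq_le n p a'0)) _.
rewrite cn.
have -> : n%:R ^+ (d * (p + d)) * (4 * C * d%:R `^ e * S ^+ d * t `^ e) =
  4 * C * d%:R `^ e * t `^ e * (n%:R ^+ (d * (p + d)) * S ^+ d) by ring.
rewrite ler_wpM2l// ler_wpM2l ?exprn_ge0// lerXn2r ?nnegrE ?HS//.
by apply: sumr_ge0 => k _; exact: powR_ge0.
Qed.

(** A is closed, so u differs from each x in A by at least some fixed r in a coordinate depending on
    x. The corresponding factor of the kernel is bounded, the others are at most n^2. The bound 2
    keeps the differences away from the other periods of the kernel. *)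
Lemma mollified_far u y : A y -> ~ A u -> (forall x, A x -> forall j, `|u 0 j - x 0 j| <= 2) ->
  exists2 B : R, 0 <= B & forall m, mollified m u <= B / 2 ^+ m.
Proof.
move=> Ay Au uA.
have [r r0 Hr] : exists2 r : R, 0 < r & forall x, A x -> exists j, r <= `|u 0 j - x 0 j|.
  have : nbhs u (~` A).
    by apply: open_nbhs_nbhs; split => //; rewrite openC; apply: compact_closed => //; exact: norm_hausdorff.
  move=> /nbhs_ballP[r /= r0 ur]; exists r => // x Ax; apply: contrapT => /forallNP H.
  apply: (ur x) => //; split => // i j; rewrite ord1.
  by have /negP := H j; rewrite -ltNge.
have r2 : r <= 2 by have [j] := Hr _ Ay; move=> /le_trans; apply; exact: uA.
pose c : R := 4 / (2 - 2 * cos r).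
have c0 : 0 <= c.
  by rewrite divr_ge0// subr_ge0 ler_piMr// cos_le1.
exists (c ^+ d * mass mu); first by rewrite mulr_ge0 ?exprn_ge0 ?mass_ge0.
move=> m; set n := (2 ^ m)%N; have cn : 2 ^+ m = n%:R :> R by rewrite natrX.
have n0 : (0 : R) < n%:R by rewrite ltr0n expn_gt0.
rewrite /mollified cn -/n ler_pdivrMl ?exprn_gt0//.
have H : tconv mu (@lfreq R d n p) u <= (n%:R ^+ (2 * p) * c) ^+ d * mass mu.
  apply: Rintegral_le_support; first exact: bmeas_tker.
  move=> x Ax; rewrite tker_lfreq lerXn2r ?nnegrE ?tker_ge0 ?mulr_ge0 ?exprn_ge0//.
  have [j Hj] := Hr _ Ax; rewrite tker_lattice_prod (bigD1 j)//= mulrC ler_pM ?sqn_ge0//.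
  - by apply: prodr_ge0 => i _; exact: sqn_ge0.
  - apply: (@le_trans _ _ (\prod_(i < d | i != j) n%:R ^+ 2)).
      by apply: ler_prod => i _; rewrite sqn_ge0 sqn_dirichlet_le.
    by rewrite prodr_const cardC1 card_ord -exprM.
  - by apply: sqn_dirichlet_far => //; rewrite !mxE Hj uA.
apply: le_trans H _; rewrite exprMn -!mulrA.
have -> : n%:R ^+ (d * (p + d)) * (c ^+ d * (mass mu / n%:R)) =
   (n%:R ^+ (2 * p)) ^+ d * (c ^+ d * mass mu) * (n%:R ^+ d / n%:R).
  have -> : (d * (p + d) = 2 * p * d + d)%N by lia.
  by rewrite exprD exprM; ring.
rewrite ler_peMr ?mulr_ge0 ?exprn_ge0 ?mass_ge0//.
by rewrite exprS mulrC mulKf ?gt_eqF// exprn_ege1// ler1n expn_gt0.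
Qed.

Lemma bmeas_mollified m : bmeas setT (mollified m : borelType _ -> R).
Proof. apply: bmeasZ; exact: bmeas_tconv. Qed.

(** The zero frequency alone, of weight (mass mu)^2, counted with its multiplicity in the Parseval
    sum. It prevents the mollifications from being uniformly small on the support. *)
Lemma Rintegral_mollified_ge m :
  (2 * d)%:R ^- d * mass mu ^+ 2 <= \int[mu]_x mollified m x.
Proof.
rewrite bmeas_RintegralZ//; [|exact: mu_fin|exact: bmeas_tconv].
rewrite Rintegral_tconv ler_pdivlMl ?exprn_gt0//.
have -> : 2 ^+ m = (2 ^ m)%N%:R :> R by rewrite natrX.
apply: (@sum_collisions_ge R d (2 ^ m) p _ (fun xi => fcos mu xi ^+ 2 + fsin mu xi ^+ 2)).
- exact: sqr_ge0.
- by rewrite expn_gt0.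
- by move=> xi; rewrite addr_ge0 ?sqr_ge0.
- by rewrite fcos0 fsin0 expr0n addr0.
Qed.

(** If A had empty interior, each of its points would be within tau of the complement, and by
    compactness finitely many points u outside A would come within tau of all of A. The
    mollifications tend to 0 at these u; by equicontinuity one of them is at most 2 eps on A,
    against the lower bound on its integral. *)
Lemma exists_open_subset : (0 < mu setT)%E ->
  (forall x y, A x -> A y -> forall j, `|x 0 j - y 0 j| <= 1) ->
  exists U : set 'rV[R]_d, [/\ open U, U !=set0 & U `<=` A].
Proof.
move=> mu0 A1; apply: contrapT => noU.
have m0 : 0 < mass mu by rewrite fine_gt0// mu0 mu_fin.
set kappa := (2 * d)%:R ^- d * mass mu ^+ 2.
have k0 : 0 < kappa by rewrite mulr_gt0 ?invr_gt0 ?exprn_gt0.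
have [B B0 HB] := mollified_equicontinuous.
set e := (a - 1) / 2 in HB; have e0 : 0 < e by rewrite divr_gt0// subr_gt0; case/andP: a12.
(* The bound 2 eps on A integrates to kappa / 2 < kappa. Below, tau <= 1 together with the width 1
   of A gives the distance 2 allowed by [mollified_far]. *)
pose eps := kappa / (4 * mass mu); have eps0 : 0 < eps by rewrite divr_gt0// mulr_gt0.
pose tau := Num.min 1 ((eps / (B + 1)) `^ e^-1).
have B1 : 0 < B + 1 by lra.
have tau0 : 0 < tau by rewrite lt_min ltr01 powR_gt0// divr_gt0.
have Btau : B * tau `^ e <= eps.
  have : tau `^ e <= eps / (B + 1).
    apply: (@le_trans _ _ (((eps / (B + 1)) `^ e^-1) `^ e)).
      by rewrite ge0_ler_powR ?nnegrE ?powR_ge0 ?(ltW e0) ?(ltW tau0)// ge_min lexx orbT.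
    by rewrite -powRrM mulVf ?gt_eqF// powRr1// divr_ge0 ?ltW.
  move=> h; apply: (@le_trans _ _ (B * (eps / (B + 1)))); first by rewrite ler_wpM2l.
  by rewrite mulrCA ger_pMr// ler_pdivrMr// mul1r; lra.
have near_out x : A x -> exists2 u, ~ A u & ball x tau u.
  move=> Ax; apply: contrapT => H; apply: noU; exists (ball x tau); split.
  - exact: ball_open.
  - by exists x; exact: ballxx.
  - by move=> u xu; apply: contrapT => Au; apply: H; exists u.
pose D : set 'rV[R]_d := [set u | ~ A u /\ exists2 x, A x & ball x tau u].
move: (cA); rewrite compact_cover => /(_ _ D (fun u => ball u tau)).
case; first by move=> u _; exact: ball_open.
  move=> x Ax; have [u Au xu] := near_out x Ax.
  by exists u; [split => //; exists x|exact/ball_sym].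
move=> F FD AF.
have [M HM] : exists M, forall u, u \in F -> mollified M u <= eps.
  have : forall s : seq 'rV[R]_d, {subset s <= F} -> exists M, forall m, (M <= m)%N ->
      forall u, u \in s -> mollified m u <= eps.
    elim => [|u s IH] sF; first by exists 0%N.
    have [|M HM] := IH; first by move=> w ws; apply: sF; rewrite inE ws orbT.
    have /FD : u \in F by apply: sF; rewrite inE eqxx.
    rewrite inE => -[Au [x Ax xu]].
    have [|Bu Bu0 HBu] := @mollified_far u x Ax Au.
      move=> y Ay j; have := A1 _ _ Ax Ay j.
      have := xu.2 0 j; rewrite /ball /= => h1 h2.
      have h3 : tau <= 1 by rewrite ge_min lexx.
      have -> : u 0 j - y 0 j = (x 0 j - y 0 j) - (x 0 j - u 0 j) by ring.
      by apply: le_trans (ler_normB _ _) _; lra.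
    pose N := (Num.truncn (Bu / eps)).+1.
    exists (maxn M N) => m; rewrite geq_max => /andP[Mm Nm] w.
    rewrite inE => /predU1P[->|]; last exact: HM.
    apply: le_trans (HBu m) _; rewrite ler_pdivrMr ?exprn_gt0// mulrC -ler_pdivrMr//.
    apply: (@le_trans _ _ N%:R); first by rewrite ltW// truncnS_gt.
    by rewrite -natrX ler_nat (leq_trans Nm)// ltnW// ltn_expl.
  by move=> /(_ (enum_fset F) (fun u h => h))[M HM]; exists M; exact: HM.
have key x : A x -> mollified M x <= 2 * eps.
  move=> Ax; have [u Fu ux] := AF _ Ax.
  have h1 := HM u Fu.
  have h2 : `|mollified M x - mollified M u| <= eps.
    apply: le_trans Btau; apply: HB => [|j]; first exact: ltW.
    by rewrite distrC ltW//; exact: (ux.2 0 j).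
  have := ler_norm (mollified M x - mollified M u); lra.
have := Rintegral_le_support (bmeas_mollified M) key.
move=> /(le_trans (Rintegral_mollified_ge M)); rewrite -/kappa /eps.
have -> : 2 * (kappa / (4 * mass mu)) * mass mu = kappa / 2.
  by field; rewrite gt_eqF.
by lra.
Qed.

End interior_lemma.

Lemma exists_open_subset_pos (R : realType) d
    (mu : {finite_measure set (borelType 'rV[R]_d) -> \bar R}) (A : set 'rV[R]_d) (a C : R) :
  (0 < d)%N -> compact A -> Mplus A mu -> 1 < a <= 2 -> 0 <= C ->
  (forall xi, `|fcos mu xi| <= C * decay a xi) -> (forall xi, `|fsin mu xi| <= C * decay a xi) ->
  (forall x y, A x -> A y -> forall j, `|x 0 j - y 0 j| <= 1) ->
  exists U : set 'rV[R]_d, [/\ open U, U !=set0 & U `<=` A].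
Proof.
case: d mu A => // p mu A _ cA [mu0 muA] a12 C0 hc hs A1.
exact: (exists_open_subset cA muA a12 C0 hc hs mu0 A1).
Qed.

(** * Random paths *)

Section random_paths.
Context {R : realType} (T : R) (d : nat) (delta : R) (L : nat).
Hypotheses (T_gt0 : 0 < T) (delta01 : 0 <= delta < 1).

Let delta_ge0 : 0 <= delta. Proof. by case/andP: delta01. Qed.
Let delta_le1 : delta <= 1. Proof. by case/andP: delta01 => _ /ltW. Qed.

(** With 4^m cells, a sum of independent cell contributions fluctuates by about step m * 2^m = T /
    2^m. *)
Definition step m : R := T / 4 ^+ m.
(* The factor m.+1 ^- 3 makes the levels summable in the Hoelder norm, and costs the Fourier decay
   only powers of m. *)
Definition amp m : R := step m `^ delta / m.+1%:R ^+ 3.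
(** L will satisfy c^L <= 1/2, where c bounds |cos lam| over the window; averaging over this many
    signs then damps the phase of a cell by at least 2^-m. *)
Definition nbits m : nat := L * m.+1.
Definition bitcode (m k i j : nat) : nat := choice.pickle (m, k, i, j).

(* Trapezoid: equal to 1 on [0, 1], supported in [-1, 2], with slopes 1 and -1. *)
Definition trap (s : R) : R := Num.max 0 (Num.min 1 (3 / 2 - `|s - 1 / 2|)).
Definition bump m k (r : R) : R := trap (r / step m - k%:R).

Definition amount (x : nat -> bool) m k i : R := \sum_(j < nbits m) sgb (x (bitcode m k i j)).

Definition level_fun (x : nat -> bool) m (r : R) : 'rV[R]_d :=
  \row_i (amp m * \sum_(k < 4 ^ m) bump m k r * amount x m k i).

Lemma step_gt0 m : 0 < step m. Proof. by rewrite divr_gt0// exprn_gt0. Qed.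

Lemma amp_gt0 m : 0 < amp m.
Proof. by rewrite divr_gt0 ?exprn_gt0// powR_gt0 ?step_gt0. Qed.

Lemma trap_ge0 s : 0 <= trap s. Proof. by rewrite le_max lexx. Qed.

Lemma trap_le1 s : trap s <= 1.
Proof. by rewrite ge_max ler01 /= ge_min lexx. Qed.

Lemma trap_eq1 s : 0 <= s <= 1 -> trap s = 1.
Proof.
move=> /andP[s0 s1]; rewrite /trap min_l; first by rewrite max_r.
by rewrite lerBrDl -lerBrDr ler_norml; apply/andP; split; lra.
Qed.

Lemma trap_eq0 s : s <= -1 \/ 2 <= s -> trap s = 0.
Proof.
move=> s12; rewrite /trap max_l// ge_min; apply/orP; right.
rewrite subr_le0 ler_normr; case: s12 => ?; apply/orP; [right|left]; lra.
Qed.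

Lemma trap_aux (D u v : R) : 0 <= D -> v - u <= D ->
  Num.max 0 (Num.min 1 (3 / 2 - u)) - Num.max 0 (Num.min 1 (3 / 2 - v)) <= D.
Proof.
move=> D0 h; rewrite /Num.max /Num.min.
by case: (ltP 1 (3 / 2 - u)) => hu; case: (ltP 1 (3 / 2 - v)) => hv;
  repeat case: ltP => ?; lra.
Qed.

Lemma trap_lipschitz s t : `|trap s - trap t| <= `|s - t|.
Proof.
wlog : s t / trap t <= trap s.
  move=> H; have [/H//|/ltW /H] := leP (trap t) (trap s).
  by rewrite distrC (distrC t).
move=> ts; rewrite ger0_norm ?subr_ge0//.
have h : `|t - 1 / 2| - `|s - 1 / 2| <= `|s - t|.
  apply: le_trans (lerB_dist _ _) _.
  have -> : t - 1 / 2 - (s - 1 / 2) = t - s by ring.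
  by rewrite distrC.
have n0 := normr_ge0 (s - t).
exact: trap_aux.
Qed.

Lemma sum_near_le N (s : R) : \sum_(k < N) ((-1 < s - k%:R) && (s - k%:R < 2))%:R <= 4 :> R.
Proof.
rewrite -natr_sum -[4]/(4%:R) ler_nat.
rewrite (eq_bigr (fun i : 'I_N => if (-1 < s - i%:R) && (s - i%:R < 2) then 1%N else 0%N)); last first.
  by move=> i _; case: ifP.
rewrite -big_mkcond sum1dep_card.
pose f := Num.truncn (s + 2).
have [s0|s0] := ltP s (-1).
  rewrite (@eq_card0 _ _) // => k; rewrite !inE; apply/negbTE/negP => /andP[+ _].
  by have : 0 <= k%:R :> R by []; lra.
have /andP[f1 f2] : f%:R <= s + 2 < f.+1%:R by apply: truncn_itv; lra.
pose g (k : 'I_N) : 'I_4 := inord (f - k).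
rewrite -[4%N]card_ord.
have h (k : 'I_N) : (-1 < s - k%:R) && (s - k%:R < 2) -> (k <= f)%N /\ (f - k < 4)%N.
  move=> /andP[k1 k2].
  have kf : (k < f.+1)%N by rewrite -(ltr_nat R); lra.
  have fk : (f < k + 4)%N by rewrite -(ltr_nat R) natrD; lra.
  by split; lia.
rewrite -(@card_in_imset _ _ g).
  by apply: max_card.
move=> k l; rewrite !inE => /h[k1 k2] /h[l1 l2] /(congr1 val) /=.
rewrite !inordK// => e; apply/val_inj.
have H (a b c : nat) : (c - a = c - b -> a <= c -> b <= c -> a = b)%N by lia.
exact: H e k1 l1.
Qed.

Lemma bump_ge0 m k r : 0 <= bump m k r. Proof. exact: trap_ge0. Qed.

Lemma bump_le_near m k r :
  bump m k r <= ((-1 < r / step m - k%:R) && (r / step m - k%:R < 2))%:R.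
Proof.
case: (boolP (_ && _)) => [_|]; first exact: trap_le1.
rewrite negb_and -!leNgt => h; rewrite /bump trap_eq0//.
by case/orP: h => ?; [left|right].
Qed.

Lemma sum_bump_le m r : \sum_(k < 4 ^ m) bump m k r <= 4.
Proof.
apply: le_trans (sum_near_le (4 ^ m) (r / step m)).
by apply: ler_sum => k _; exact: bump_le_near.
Qed.

Lemma sum_bump_dist_le m r s :
  \sum_(k < 4 ^ m) `|bump m k r - bump m k s| <= 8 * (`|r - s| / step m).
Proof.
have h0 := step_gt0 m.
set b := fun r (k : nat) => ((-1 < r / step m - k%:R) && (r / step m - k%:R < 2))%:R : R.
apply: (@le_trans _ _ (\sum_(k < 4 ^ m) (b r k + b s k) * (`|r - s| / step m))).
  apply: ler_sum => k _.
  have hl : `|bump m k r - bump m k s| <= `|r - s| / step m.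
    apply: le_trans (trap_lipschitz _ _) _.
    have -> : r / step m - k%:R - (s / step m - k%:R) = (r - s) / step m.
      by rewrite opprB addrA subrK mulrBl.
    by rewrite normrM [X in _ * X]ger0_norm// invr_ge0 ltW.
  have := bump_le_near m k r; have := bump_le_near m k s; rewrite -/(b r k) -/(b s k).
  have := bump_ge0 m k r; have := bump_ge0 m k s.
  have q0 : 0 <= `|r - s| / step m by rewrite mulr_ge0// invr_ge0 ltW.
  rewrite /b; case: (_ && _); case: (_ && _) => /= r0 s0 s1 r1.
  - by apply: le_trans hl _; rewrite ler_peMl//; lra.
  - by apply: le_trans hl _; rewrite ler_peMl//; lra.
  - by apply: le_trans hl _; rewrite ler_peMl//; lra.
  - have -> : bump m k r = 0 by lra.
    have -> : bump m k s = 0 by lra.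
    by rewrite subrr normr0 addr0 mul0r.
have q0 : 0 <= `|r - s| / step m by rewrite mulr_ge0// invr_ge0 ltW.
rewrite -mulr_suml ler_wpM2r//.
have -> : (8 : R) = 4 + 4 by ring.
by rewrite big_split lerD//; exact: sum_near_le.
Qed.

Lemma amount_norm x m k i : `|amount x m k i| <= (nbits m)%:R.
Proof.
rewrite (le_trans (ler_norm_sum _ _ _))//.
rewrite (@le_trans _ _ (\sum_(j < nbits m) 1))//.
  by apply: ler_sum => j _; rewrite sgb_norm.
by rewrite sumr_const card_ord.
Qed.

Lemma euclid_le_coord (v : 'rV[R]_d) (b : R) : 0 <= b -> (forall i, `|v 0 i| <= b) ->
  euclid v <= d%:R * b.
Proof.
move=> b0 vb; apply: le_trans (ler_euclid_norm v) _; rewrite ler_wpM2l//.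
rewrite [leLHS]/Num.norm /= mx_normrE; apply: bigmax_le => // -[i j] _ /=.
by rewrite (ord1 i).
Qed.

Lemma level_coord x m r i :
  `|level_fun x m r 0 i| <= 4 * (amp m * (nbits m)%:R).
Proof.
rewrite mxE normrM ger0_norm ?(ltW (amp_gt0 m))// mulrCA ler_wpM2l ?(ltW (amp_gt0 m))//.
rewrite (le_trans (ler_norm_sum _ _ _))//.
apply: (@le_trans _ _ (\sum_(k < 4 ^ m) bump m k r * (nbits m)%:R)).
  by apply: ler_sum => k _; rewrite normrM ger0_norm ?bump_ge0// ler_wpM2l ?bump_ge0// amount_norm.
by rewrite -mulr_suml ler_wpM2r// sum_bump_le.
Qed.

Lemma level_coord_dist x m r s i :
  `|level_fun x m r 0 i - level_fun x m s 0 i| <=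
  8 * (amp m * (nbits m)%:R) * (`|r - s| / step m).
Proof.
rewrite !mxE -mulrBr normrM ger0_norm ?(ltW (amp_gt0 m))// -sumrB.
have -> : 8 * (amp m * (nbits m)%:R) * (`|r - s| / step m) =
   amp m * (8 * (`|r - s| / step m) * (nbits m)%:R) by ring.
rewrite ler_wpM2l ?(ltW (amp_gt0 m))// (le_trans (ler_norm_sum _ _ _))//.
apply: (@le_trans _ _ (\sum_(k < 4 ^ m) `|bump m k r - bump m k s| * (nbits m)%:R)).
  by apply: ler_sum => k _; rewrite -mulrBl normrM ler_wpM2l// amount_norm.
by rewrite -mulr_suml ler_wpM2r// sum_bump_dist_le.
Qed.

(* [min (1, z) <= z ^ delta] interpolates the sup and the Lipschitz bounds. *)
Lemma level_coord_holder x m r s i :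
  `|level_fun x m r 0 i - level_fun x m s 0 i| <=
  8 * L%:R / m.+1%:R ^+ 2 * `|r - s| `^ delta.
Proof.
have h0 := step_gt0 m; have a0 := amp_gt0 m.
set z := `|r - s| / step m.
have z0 : 0 <= z by rewrite mulr_ge0// invr_ge0 ltW.
have K0 : 0 <= 8 * (amp m * (nbits m)%:R) by rewrite mulr_ge0// mulr_ge0// ltW.
apply: (@le_trans _ _ (8 * (amp m * (nbits m)%:R) * z `^ delta)).
  have [z1|z1] := leP 1 z.
    have zd : 1 <= z `^ delta by rewrite -(powRr0 z) ler_powR.
    apply: le_trans (ler_normB _ _) _.
    have := level_coord x m r i; have := level_coord x m s i.
    have : 8 * (amp m * (nbits m)%:R) <= 8 * (amp m * (nbits m)%:R) * z `^ delta by rewrite ler_peMr.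
    by set X := _ `^ _; set Y := amp m * _; lra.
  apply: le_trans (level_coord_dist x m r s i) _; rewrite ler_wpM2l// -/z.
  have [->|zn0] := eqVneq z 0; first exact: powR_ge0.
  by rewrite -[leLHS]powRr1// ger_powR// lt_def zn0 z0 ltW.
rewrite /z powRM ?invr_ge0 ?(ltW h0)// /amp /nbits.
have -> : (step m)^-1 `^ delta = (step m `^ delta)^-1.
  by rewrite -powR_inv1 ?(ltW h0)// -powRrM mulN1r powRN.
rewrite natrM le_eqVlt; apply/orP; left; apply/eqP.
have aux (a l n D : R) : a != 0 -> n != 0 ->
  8 * (a / n ^+ 3 * (l * n)) * (D / a) = 8 * l / n ^+ 2 * D.
  by move=> an nn; field; rewrite nn an.
by apply: aux; rewrite ?pnatr_eq0// gt_eqF// powR_gt0.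
Qed.

Lemma level_path_continuous (f : time T -> 'rV[R]_d) (K : R) :
  (forall u v, euclid (f u - f v) <= K * `|val u - val v|) -> continuous f.
Proof.
move=> fK u; apply/(@cvgrPdist_le _ _ _ (nbhs u) (nbhs_filter u)) => e e0.
have K0 : 0 < `|K| + 1 by rewrite ltr_wpDl.
have e1 : 0 < e / (`|K| + 1) by rewrite divr_gt0.
have := @initial_continuous _ _ (val : time T -> R) u.
move=> /(@cvgrPdist_le _ _ _ (nbhs u) (nbhs_filter u))/(_ _ e1).
apply: filterS => v uv; apply: le_trans (ler_norm_euclid _) _; apply: le_trans (fK u v) _.
apply: (@le_trans _ _ ((`|K| + 1) * `|val u - val v|)).
  by rewrite ler_wpM2r// (le_trans (ler_norm K))// lerDl.
by rewrite -ler_pdivlMl// mulrC.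
Qed.

Lemma level_funP x m : (fun u : time T => level_fun x m (val u)) \in holder_path delta.
Proof.
rewrite inE; split.
  apply: (@level_path_continuous _ (d%:R * (8 * (amp m * (nbits m)%:R) / step m))) => u v.
  have K0 : 0 <= 8 * (amp m * (nbits m)%:R) / step m * `|val u - val v|.
    by rewrite mulr_ge0// mulr_ge0 ?invr_ge0 ?(ltW (step_gt0 m))// mulr_ge0// mulr_ge0// ltW// amp_gt0.
  rewrite -[d%:R * _ * _]mulrA; apply: euclid_le_coord => // i.
  have := level_coord_dist x m (val u) (val v) i.
  by rewrite [X in _ <= X](mulrA _ _ (step m)^-1) (mulrAC _ _ (step m)^-1) !mxE.
move=> _; exists (d%:R * (8 * L%:R / m.+1%:R ^+ 2)) => u v.
rewrite -[d%:R * _ * _]mulrA; apply: euclid_le_coord => [|i].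
  by rewrite mulr_ge0 ?powR_ge0 ?divr_ge0 ?mulr_ge0 ?exprn_ge0.
have := level_coord_holder x m (val u) (val v) i.
by rewrite !mxE.
Qed.

Definition level x m : holder T d delta := Holder (level_funP x m).

Definition level_cst : R := d%:R * (4 * (T `^ delta * L%:R)) + d%:R * (8 * L%:R).

Lemma level_cst_ge0 : 0 <= level_cst.
Proof. by rewrite addr_ge0 ?mulr_ge0 ?powR_ge0. Qed.

(** One factor m + 1 of the cube in [amp m] absorbs [nbits m]; the remaining square makes the norms
    summable. *)
Lemma level_norm x m : `|level x m| <= level_cst / m.+1%:R ^+ 2.
Proof.
rewrite [leLHS]/Num.norm /= /holder_norm /level_cst mulrDl.
have m0 : 0 < m.+1%:R ^+ 2 :> R by rewrite exprn_gt0.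
apply: lerD.
  apply: sup_norm_le => [|u]; first by rewrite divr_ge0 ?mulr_ge0 ?powR_ge0// ltW.
  rewrite -[d%:R * _ * _]mulrA; apply: euclid_le_coord => [|i].
    by rewrite divr_ge0 ?mulr_ge0 ?powR_ge0// ltW.
  apply: le_trans (level_coord _ _ _ _) _; rewrite -mulrA ler_pM2l//.
  rewrite /amp /nbits natrM.
  have -> : step m `^ delta / m.+1%:R ^+ 3 * (L%:R * m.+1%:R) = step m `^ delta * L%:R / m.+1%:R ^+ 2.
    have aux (a l n : R) : n != 0 -> a / n ^+ 3 * (l * n) = a * l / n ^+ 2.
      by move=> nn; field.
    by apply: aux; rewrite pnatr_eq0.
  rewrite ler_pM2r ?invr_gt0// ler_wpM2r// ge0_ler_powR ?nnegrE ?(ltW T_gt0) ?(ltW (step_gt0 m))//.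
  by rewrite ler_pdivrMr ?exprn_gt0// ler_peMr ?(ltW T_gt0)// exprn_ege1// ler1n.
case: ifP => _; last by rewrite divr_ge0 ?mulr_ge0// ltW.
apply: holder_seminorm_le => [|u v]; first by rewrite divr_ge0 ?mulr_ge0// ltW.
rewrite -[d%:R * _ / _]mulrA -[d%:R * _ * _]mulrA; apply: euclid_le_coord => [|i].
  by rewrite mulr_ge0 ?powR_ge0// mulr_ge0 ?invr_ge0 ?(ltW m0)// mulr_ge0.
have := level_coord_holder x m (val u) (val v) i.
by rewrite !mxE.
Qed.

Definition partial x N : holder T d delta := series (level x) N.

Lemma sum_inv_sqr_le N M : (0 < N)%N -> (N <= M)%N ->
  \sum_(N <= m < M) (m.+1%:R ^+ 2)^-1 <= N%:R^-1 - M%:R^-1 :> R.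
Proof.
move=> N0 NM; rewrite -(subnKC NM); elim: (M - N)%N => [|k IH].
  by rewrite addn0 subrr big_geq.
rewrite addnS big_nat_recr ?leq_addr//=.
apply: (@le_trans _ _ (N%:R^-1 - (N + k)%:R^-1 + ((N + k)%:R^-1 - (N + k).+1%:R^-1))).
  rewrite lerD// -[(N + k).+1]addn1 natrD.
  have n0 : 0 < (N + k)%:R :> R by rewrite ltr0n addn_gt0 N0.
  set n := (N + k)%:R in n0 *.
  have -> : n^-1 - (n + 1)^-1 = (n * (n + 1))^-1 by field; apply/andP; split; lra.
  rewrite lef_pV2 ?posrE; [|nra|nra].
  by nra.
by rewrite addrA subrK.
Qed.

Lemma partial_dist x N M : (0 < N)%N -> (N <= M)%N ->
  `|partial x M - partial x N| <= level_cst / N%:R.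
Proof.
move=> N0 NM; rewrite /partial sub_series_geq// (le_trans (ler_norm_sum _ _ _))//.
apply: (@le_trans _ _ (\sum_(N <= m < M) level_cst * (m.+1%:R ^+ 2)^-1)).
  by apply: ler_sum => m _; exact: level_norm.
rewrite -mulr_sumr ler_wpM2l ?level_cst_ge0//.
by apply: le_trans (sum_inv_sqr_le N0 NM) _; rewrite gerBl.
Qed.

Lemma partial_cvg x : cvgn (partial x).
Proof.
apply/cauchy_cvgP/cauchy_seriesP => e e0.
pose N := (Num.truncn (level_cst / e)).+1.
exists ([set n | (N <= n)%N], [set n | (N <= n)%N]); first by split; exists N.
move=> [n m] [/= Nn Nm]; have [nm|mn] := leqP n m; last by rewrite big_geq ?normr0// ltnW.
rewrite -sub_series_geq//; apply: le_lt_trans (partial_dist _ _ nm) _.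
  exact: leq_trans Nn.
rewrite ltr_pdivrMr ?ltr0n ?(leq_trans _ Nn)// mulrC -ltr_pdivrMr//.
by apply: lt_le_trans (truncnS_gt _) _; rewrite ler_nat.
Qed.

Definition random_path x : holder T d delta := limn (partial x).

Lemma path_partial_dist x N : (0 < N)%N -> `|random_path x - partial x N| <= level_cst / N%:R.
Proof.
move=> N0; apply/ler_addgt0Pr => e e0.
have := @partial_cvg x; move=> /cvgrPdist_le/(_ _ e0)[M _ HM].
have h1 := HM (maxn M N) (leq_maxl _ _).
have h2 := @partial_dist x N (maxn M N) N0 (leq_maxr _ _).
have -> : random_path x - partial x N = (random_path x - partial x (maxn M N)) +
   (partial x (maxn M N) - partial x N) by rewrite addrA subrK.
by rewrite (le_trans (ler_normD _ _))// addrC lerD.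
Qed.

(** The signs of the levels below N have codes below this number, so a partial sum depends on
    finitely many bits. Continuity, measurability and the reduction to counting all rest on this. *)
Definition code_bound N : nat :=
  (\max_(m < N) \max_(k < 4 ^ m) \max_(i < d) \max_(j < nbits m) bitcode m k i j).+1.

Lemma code_lt m k i j N : (m < N)%N -> (k < 4 ^ m)%N -> (i < d)%N -> (j < nbits m)%N ->
  (bitcode m k i j < code_bound N)%N.
Proof.
move=> mN km id jm; rewrite ltnS.
apply: leq_trans (leq_bigmax (Ordinal mN)).
apply: leq_trans (leq_bigmax (Ordinal km)).
apply: leq_trans (leq_bigmax (Ordinal id)).
exact: leq_trans (leq_bigmax (Ordinal jm)).
Qed.

Lemma partial_agree x y N : (forall q, (q < code_bound N)%N -> x q = y q) ->
  partial x N = partial y N.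
Proof.
move=> xy; rewrite /partial /series /= !big_mkord; apply: eq_bigr => m _.
apply/val_inj/funext => u; apply/rowP => i; rewrite !mxE; congr (_ * _).
apply: eq_bigr => k _; congr (_ * _); apply: eq_bigr => j _; congr sgb.
by apply: xy; exact: code_lt.
Qed.

Lemma path_agree x y N : (0 < N)%N -> (forall q, (q < code_bound N)%N -> x q = y q) ->
  `|random_path x - random_path y| <= 2 * (level_cst / N%:R).
Proof.
move=> N0 /partial_agree xy.
have -> : random_path x - random_path y = (random_path x - partial x N) - (random_path y - partial y N).
  by rewrite xy opprB addrA subrK.
by apply: le_trans (ler_normB _ _) _; rewrite mulr_natl mulr2n lerD// path_partial_dist.
Qed.


(** * Binary digits and Lebesgue measure *)

Definition digit (w : R) (q : nat) : bool := odd (Num.truncn (2 ^+ q.+1 * w)).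

Lemma truncn_half (y : R) : Num.truncn (y / 2) = (Num.truncn y)./2.
Proof.
have [y0|y0] := ltP y 0.
  have t0 (z : R) : z < 0 -> Num.truncn z = 0%N.
    by move=> z0; apply/eqP; rewrite -leqn0 truncn_le_nat (lt_trans z0).
  by rewrite !t0//; lra.
have /andP[y1 y2] := truncn_itv y0; set n := Num.truncn y in y1 y2 *.
apply: truncn_def; have := odd_double_half n; set k := n./2 => nk.
have e : n%:R = (odd n)%:R + 2 * k%:R :> R by rewrite -{1}nk natrD -mul2n natrM.
have o : ((odd n)%:R : R) = 0 \/ ((odd n)%:R : R) = 1 by case: (odd n); [right|left].
have hS (i : nat) : i.+1%:R = i%:R + 1 :> R by rewrite natr1.
move: y1 y2; rewrite (hS n) (hS k) e.
by case: o => ->; move=> y1 y2; apply/andP; split; lra.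
Qed.

Lemma truncn_coarser (w w' : R) Q : Num.truncn (2 ^+ Q * w) = Num.truncn (2 ^+ Q * w') ->
  forall q, (q <= Q)%N -> Num.truncn (2 ^+ q * w) = Num.truncn (2 ^+ q * w').
Proof.
elim: Q => [|Q IH] e q; first by rewrite leqn0 => /eqP ->.
rewrite leq_eqVlt => /predU1P[->//|]; rewrite ltnS; apply: IH.
have h (z : R) : 2 ^+ Q * z = 2 ^+ Q.+1 * z / 2 by rewrite exprS; field.
by rewrite !h !truncn_half e.
Qed.

Lemma digit_eq (w w' : R) Q : Num.truncn (2 ^+ Q * w) = Num.truncn (2 ^+ Q * w') ->
  forall q, (q < Q)%N -> digit w q = digit w' q.
Proof. by move=> /truncn_coarser e q qQ; rewrite /digit e. Qed.

Fixpoint bitnum (x : nat -> bool) Q : nat :=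
  if Q is Q'.+1 then ((bitnum x Q').*2 + x Q')%N else 0%N.

Lemma truncn_bitnum (w : R) x Q : 0 <= w < 1 -> (forall q, (q < Q)%N -> digit w q = x q) ->
  Num.truncn (2 ^+ Q * w) = bitnum x Q.
Proof.
move=> /andP[w0 w1]; elim: Q => [|Q IH] wx.
  by rewrite expr0 mul1r /=; apply: truncn_def; rewrite w0.
rewrite /= -IH => [|q qQ]; last by apply: wx; rewrite ltnS ltnW.
rewrite -(wx Q)// /digit.
have -> : 2 ^+ Q * w = 2 ^+ Q.+1 * w / 2 by rewrite exprS; field.
by rewrite truncn_half addnC odd_double_half.
Qed.

Definition extend Q (x : {ffun 'I_Q -> bool}) (q : nat) : bool :=
  if insub q is Some i then x i else false.

Lemma extendE Q (x : {ffun 'I_Q -> bool}) (i : 'I_Q) : extend x i = x i.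
Proof. by rewrite /extend valK. Qed.

(** The points of [0, 1[ with prescribed first Q digits lie in one cell of length 2^-Q. Upper bounds
    for probabilities thus become counts of bit vectors. *)
Lemma lebesgue_bits_le Q (S : set R) (P : {ffun 'I_Q -> bool} -> bool) :
  measurable S -> S `<=` `[0, 1[ ->
  (forall w, S w -> P [ffun i : 'I_Q => digit w i]) ->
  (lebesgue_measure S <= (#|[pred x | P x]|%:R / 2 ^+ Q)%:E)%E.
Proof.
move=> mS S01 SP.
pose cell (x : {ffun 'I_Q -> bool}) : set R :=
  `[(bitnum (extend x) Q)%:R / 2 ^+ Q, (bitnum (extend x) Q).+1%:R / 2 ^+ Q[%classic.
have mcell x : measurable (cell x) by exact: measurable_itv.
have cellE x : lebesgue_measure (cell x) = (2 ^- Q)%:E.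
  rewrite /cell lebesgue_measure_itv /= lte_fin ltr_pM2r ?invr_gt0 ?exprn_gt0// ltr_nat ltnSn.
  by rewrite -EFinB -mulrBl -natr1 addrAC subrr add0r mul1r.
have union (s : seq {ffun 'I_Q -> bool}) :
    (lebesgue_measure (\big[setU/set0]_(x <- s) cell x) <= ((size s)%:R / 2 ^+ Q)%:E)%E.
  elim: s => [|x s IH]; first by rewrite big_nil measure0 mul0r.
  rewrite big_cons; apply: le_trans (measureU2 _ _ _) _; first exact: mcell.
    by apply: bigsetU_measurable => y _; exact: mcell.
  rewrite /= -nat1r mulrDl mul1r EFinD -(cellE x).
  by apply: leeD.
apply: le_trans (le_measure _ _ _ _) _; last 1 first.
- by rewrite cardE; exact: union (enum [pred x | P x]).
- by rewrite inE.
- by rewrite inE; apply: bigsetU_measurable => x _; exact: mcell.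
move=> w Sw; rewrite -bigcup_seq; exists [ffun i : 'I_Q => digit w i].
  by rewrite /= mem_enum inE; exact: SP.
have /= := S01 _ Sw; rewrite in_itv /= => w01; have w0 : 0 <= w by case/andP: w01.
have := @truncn_bitnum w (extend [ffun i : 'I_Q => digit w i]) Q w01.
move=> /(_ _)/Wrap[q qQ|]; first by rewrite (extendE _ (Ordinal qQ)) ffunE.
move=> bE; have /andP[b1 b2] := truncn_itv (mulr_ge0 (exprn_ge0 Q (ler0n R 2)) w0).
by rewrite /cell -bE /= in_itv /= ler_pdivrMr ?exprn_gt0// ltr_pdivlMr ?exprn_gt0// (mulrC w) b1 b2.
Qed.

(** * The law of the random path *)

Local Notation E := (holder T d delta).

Definition random_holder (w : R) : E := random_path (digit w).

(** A neighbourhood in the product topology can impose agreement on all bits below [code_bound N],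
    which leaves an error of order 1 / N. Compactness of the Cantor space then passes to the set of
    random paths. *)
Lemma random_path_continuous :
  continuous (random_path : cantor_space -> E).
Proof.
move=> x; apply/cvgrPdist_le => e e0.
pose N := (Num.truncn (2 * level_cst / e)).+1.
have Ne : 2 * (level_cst / N%:R) <= e.
  rewrite mulrA ler_pdivrMr// [leRHS]mulrC -ler_pdivrMr//.
  by rewrite ltW// truncnS_gt.
have near_agree M : \forall y \near (x : cantor_space), forall q, (q < M)%N -> x q = y q.
  elim: M => [|M IH]; first by near=> y.
  have hM : \forall y \near (x : cantor_space), y M = x M.
    have := @proj_continuous nat (fun=> bool) M x.
    by move=> /(_ [set x M])/=; apply; exact: discrete_set1.
  near=> y => q; rewrite ltnS leq_eqVlt => /predU1P[->|].
    by apply/esym; near: y.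
  by move: q; near: y.
near=> y; apply: le_trans (path_agree _ _) Ne => //.
by near: y; exact: near_agree.
Unshelve. all: by end_near. Qed.

Lemma measurable_truncn_cell Q k : measurable [set w : R | Num.truncn (2 ^+ Q * w) = k].
Proof.
have p0 : (0 : R) < 2 ^+ Q by rewrite exprn_gt0.
case: k => [|k].
  rewrite [X in measurable X](_ : _ = `]-oo, 2 ^- Q[%classic); first exact: measurable_itv.
  apply/seteqP; split => w /=; rewrite in_itv /=.
    by move=> /eqP; rewrite -leqn0 truncn_le_nat -ltr_pdivlMl// mulr1.
  by move=> h; apply/eqP; rewrite -leqn0 truncn_le_nat -ltr_pdivlMl// mulr1.
rewrite [X in measurable X](_ : _ = `[k.+1%:R / 2 ^+ Q, k.+2%:R / 2 ^+ Q[%classic).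
  exact: measurable_itv.
apply/seteqP; split => w /=; rewrite in_itv /= ler_pdivrMr// ltr_pdivlMr// (mulrC w).
  by move=> /esym e; rewrite -truncn_gt_nat -truncn_le_nat -e ?ltnSn ?leqnn.
by move=> h; apply: truncn_def.
Qed.

(** The preimage of an open set is the union of the countably many dyadic cells that it contains,
    since finitely many digits determine the path up to a small error. This argument is available
    although Hoelder spaces are not separable. *)
Lemma measurable_random_holder : measurable_fun setT (random_holder : R -> borelType E).
Proof.
apply: (@measurability _ _ R (borelType E) _ _ (@open E)) => //.
move=> _ [U oU <-]; rewrite setTI.
pose C Q k := [set w : R | Num.truncn (2 ^+ Q * w) = k].
pose G Q k := if pselect (C Q k `<=` random_holder @^-1` U) then C Q k else set0.
rewrite (_ : _ @^-1` _ = \bigcup_Q \bigcup_k G Q k).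
  apply: bigcup_measurable => Q _; apply: bigcup_measurable => k _.
  by rewrite /G; case: pselect => h /=; [exact: measurable_truncn_cell|exact: measurable0].
apply/seteqP; split => [w Uw|w [Q _ [k _]]]; last first.
  by rewrite /G; case: pselect => [sub|] //=; exact: sub.
have : nbhs (random_holder w) U by apply: open_nbhs_nbhs.
move=> /nbhs_ballP[e /= e0 eU].
pose N := (Num.truncn (2 * level_cst / e)).+1.
have Ne : 2 * (level_cst / N%:R) < e.
  rewrite mulrA ltr_pdivrMr// [ltRHS]mulrC -ltr_pdivrMr//.
  by rewrite truncnS_gt.
exists (code_bound N) => //; exists (Num.truncn (2 ^+ code_bound N * w)) => //.
rewrite /G; case: pselect => //= H; exfalso; apply: H => w' ww'.
apply: eU; rewrite -ball_normE /=; apply: le_lt_trans (path_agree _ _) Ne => //.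
by move=> q; apply: digit_eq; rewrite ww'.
Qed.

Definition transverse_law : set (borelType E) -> \bar R :=
  pushforward (mrestr lebesgue_measure (measurable_itv `[0 : R, 1[)) (random_holder : R -> borelType E).

Let transverse_law_measure : {measure set (borelType E) -> \bar R} :=
  measure_function_pushforward__canonical__measure_function_Measure
    (mrestr lebesgue_measure (measurable_itv `[0 : R, 1[)) measurable_random_holder.

HB.instance Definition _ := isMeasure.Build _ _ _ transverse_law
  (measure0 transverse_law_measure) (measure_ge0 transverse_law_measure)
  (@measure_semi_sigma_additive _ _ _ transverse_law_measure).

(** Every digit sequence is a point of the Cantor space, so the compact image has full measure 1. *)
Lemma transverse_law_compact : exists2 K : set E, compact K & (0 < transverse_law K < +oo)%E.
Proof.
exists (random_path @` [set: cantor_space]).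
  apply: continuous_compact; last exact: cantor_space_compact.
  by apply: continuous_subspaceT; exact: random_path_continuous.
rewrite /transverse_law /pushforward /mrestr (_ : _ @^-1` _ = setT); last first.
  by apply/seteqP; split => w // _; exists (digit w).
by rewrite setTI lebesgue_measure_itv /= lte_fin ltr01 -EFinB subr0 lte_fin ltr01 ltry.
Qed.

(** * Phase integrals of a path *)

Lemma clamp_subproof (r : R) : Num.max 0 (Num.min r T) \in time T.
Proof.
apply/mem_set; rewrite /time /= in_itv /= le_max lexx /=.
by rewrite ge_max (ltW T_gt0) /= ge_min lexx orbT.
Qed.

Definition clamp (r : R) : time T :=
  exist (fun x => x \in time T) (Num.max 0 (Num.min r T)) (clamp_subproof r).

Lemma val_clamp r : 0 <= r <= T -> val (clamp r) = r.
Proof. by move=> /andP[r0 rT] /=; rewrite min_l// max_r. Qed.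

Lemma clamp_val (u : time T) : clamp (val u) = u.
Proof.
apply/val_inj/val_clamp; have := set_valP u.
by rewrite /time /= in_itv.
Qed.

Lemma clamp_lipschitz r s : `|val (clamp r) - val (clamp s)| <= `|r - s|.
Proof.
rewrite /=; have T0 := T_gt0; rewrite ler_norml; have := ler_norm (r - s).
have := ler_norm (s - r); rewrite (distrC s); move=> h1 h2.
have aux (D : R) : s - r <= D -> r - s <= D ->
    - D <= Num.max 0 (Num.min r T) - Num.max 0 (Num.min s T) <= D.
  move=> {}h1 {}h2; rewrite /Num.max /Num.min; apply/andP.
  by case: (ltP r T) => hr; case: (ltP s T) => hs; split; repeat case: ltP => ?; lra.
exact: aux.
Qed.

(** Constant extension beyond [0, T], so that integrals run over real intervals instead of the
    subtype [time T]. *)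
Definition lift_path (phi : time T -> 'rV[R]_d) (r : R) : 'rV[R]_d := phi (clamp r).

Lemma clamp_continuous : continuous clamp.
Proof.
apply: continuous_comp_initial => r; apply/cvgrPdist_le => e e0.
have := @cvg_id _ (nbhs r) => /cvgrPdist_le/(_ _ e0).
by apply: filterS => s; apply: le_trans; exact: clamp_lipschitz.
Qed.

Lemma lift_path_continuous (phi : E) : continuous (lift_path phi).
Proof.
have /set_mem[cphi _] := holder_funP phi.
move=> r; apply: (@continuous_comp _ _ _ clamp phi r).
  exact: clamp_continuous.
exact: cphi.
Qed.

Lemma measurable_dotv_path xi (phi : E) : measurable_fun setT (fun r : R => dotv xi (lift_path phi r)).
Proof.
apply: (@measurableT_comp _ _ _ _ (borelType 'rV[R]_d)); first exact: measurable_dotv.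
by apply: continuous_real_borel_measurable; exact: lift_path_continuous.
Qed.

(** th = 0 and th = pi / 2 give the real part and, up to sign, the imaginary part of the Fourier
    transform of the occupation measure; adding pi changes the sign. *)
Definition phase_integral (phi : E) (xi : 'rV[R]_d) (th a b : R) : R :=
  \int[lebesgue_measure]_(r in `[a, b[) cos (dotv xi (lift_path phi r) + th).

Let mco (a b : R) : measurable (`[a, b[%classic : set R). Proof. exact: measurable_itv. Qed.

Lemma lebesgue_co_lty (a b : R) : (lebesgue_measure (`[a, b[%classic : set R) < +oo)%E.
Proof. by rewrite lebesgue_measure_itv /=; case: ifP => // _; rewrite -EFinB ltry. Qed.

Lemma lebesgue_co (a b : R) : a <= b -> fine (lebesgue_measure (`[a, b[%classic : set R)) = b - a.
Proof.
move=> ab; rewrite lebesgue_measure_itv /= lte_fin; case: ltP => // ba.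
by have -> : b = a by [apply/le_anti; rewrite ba ab]; rewrite subrr.
Qed.

Lemma bmeas_phase (phi : E) xi th (D : set R) : measurable D ->
  bmeas D (fun r => cos (dotv xi (lift_path phi r) + th)).
Proof.
move=> mD; apply: bmeas_cos; apply: measurable_funD; last exact: measurable_cst.
exact: measurable_funTS (measurable_dotv_path xi phi).
Qed.

Lemma phase_integral_norm phi xi th a b : a <= b -> `|phase_integral phi xi th a b| <= b - a.
Proof.
move=> ab; rewrite -(lebesgue_co ab) -[leRHS]mul1r; apply: Rintegral_norm_le => //.
- exact: lebesgue_co_lty.
- exact: bmeas_phase.
- by move=> r _; exact: cos_max.
Qed.

Lemma phase_integral_lipschitz (phi psi : E) xi eta th a b (K : R) : a <= b ->
  (forall r, `|dotv xi (lift_path phi r) - dotv eta (lift_path psi r)| <= K) ->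
  `|phase_integral phi xi th a b - phase_integral psi eta th a b| <= K * (b - a).
Proof.
move=> ab HK; rewrite /phase_integral -bmeas_RintegralB//; last 3 first.
- exact: lebesgue_co_lty.
- exact: bmeas_phase.
- exact: bmeas_phase.
rewrite -(lebesgue_co ab); apply: Rintegral_norm_le => //.
- exact: lebesgue_co_lty.
- have := bmeasD (bmeas_phase phi xi th (mco a b)) (bmeasZ (-1) (bmeas_phase psi eta th (mco a b))).
  by under [X in _ -> bmeas _ X]eq_fun do rewrite -mulN1r.
- move=> r _; apply: le_trans (cos_lipschitz _ _) _.
  by rewrite opprD addrACA subrr addr0.
Qed.

Lemma phase_integral_dist (phi psi : E) xi th a b : a <= b ->
  `|phase_integral phi xi th a b - phase_integral psi xi th a b| <=
  (\sum_(i < d) `|xi 0 i|) * `|phi - psi| * (b - a).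
Proof.
move=> ab; apply: phase_integral_lipschitz => // r.
rewrite -dotvBr; apply: dotv_norm_le => i.
apply: le_trans (ler_coord_euclid _ _) _.
exact: le_trans (le_holder_norm (phi - psi) (clamp r)) _.
Qed.

Lemma phase_integral_freq (phi : E) (xi eta : 'rV[R]_d) th a b (t : R) : a <= b ->
  (forall i, `|xi 0 i - eta 0 i| <= t) ->
  `|phase_integral phi xi th a b - phase_integral phi eta th a b| <=
  d%:R * t * `|phi| * (b - a).
Proof.
move=> ab xe; apply: phase_integral_lipschitz => // r.
rewrite -dotvBl; apply: le_trans (dotv_norm_le (xi - eta) (b := `|phi|) _) _.
  move=> i; apply: le_trans (ler_coord_euclid _ _) _.
  exact: le_trans (le_holder_norm phi (clamp r)) _.
rewrite ler_wpM2r// (@le_trans _ _ (\sum_(i < d) t))//.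
  by apply: ler_sum => i _; rewrite !mxE.
by rewrite sumr_const card_ord -[leLHS]mulr_natl.
Qed.

Lemma phase_integral_split phi xi th (h : R) p q : 0 <= h -> (p <= q)%N ->
  phase_integral phi xi th (h * p%:R) (h * q%:R) =
  \sum_(p <= k < q) phase_integral phi xi th (h * k%:R) (h * k.+1%:R).
Proof.
move=> h0; elim: q => [|q IH].
  by rewrite leqn0 => /eqP ->; rewrite big_geq// /phase_integral set_itvco0 Rintegral_set0.
rewrite leq_eqVlt => /predU1P[->|].
  by rewrite big_geq// /phase_integral set_itvco0 Rintegral_set0.
rewrite ltnS => pq; rewrite big_nat_recr//= -IH// /phase_integral -Rintegral_setU//.
- congr (Rintegral _ _ _); apply/seteqP; split => r /=; rewrite !in_itv /=.
    move=> /andP[r1 r2]; case: (ltP r (h * q%:R)) => r3; [left|right]; apply/andP; split => //.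
  have hp : h * p%:R <= h * q%:R by rewrite ler_wpM2l// ler_nat.
  have hq : h * q%:R <= h * q.+1%:R by rewrite ler_wpM2l// ler_nat.
  by case=> /andP[r1 r2]; apply/andP; split => //; [exact: lt_le_trans hq|exact: le_trans r1].
- apply: bmeas_integrable; [exact: measurableU| |apply: bmeas_phase; exact: measurableU].
  apply: le_lt_trans (measureU2 _ _ _) _ => //.
  by rewrite lte_add_pinfty// lebesgue_co_lty.
- apply/disj_setPS => r [] /=; rewrite !in_itv /= => /andP[_ r1] /andP[r2 _].
  by move: (lt_le_trans r1 r2); rewrite ltxx.
Qed.

(* On a cell of parity rho, the only bump of that parity which does not vanish is its own, equal to 1:
   the flips of distinct cells of parity rho act independently. *)
Definition flip_mask (m i : nat) (rho : bool) (y : nat -> nat -> bool) (q : nat) : bool :=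
  if choice.unpickle q is Some (m', k, i', j) then
    [&& m' == m, i' == i, odd k == rho & y k j] else false.

Definition flip m i rho y (x : nat -> bool) (q : nat) : bool := x q (+) flip_mask m i rho y q.

Lemma flipE m i rho y x m' k i' j : flip m i rho y x (bitcode m' k i' j) =
  x (bitcode m' k i' j) (+) [&& m' == m, i' == i, odd k == rho & y k j].
Proof. by rewrite /flip /flip_mask /bitcode choice.pickleK. Qed.

Lemma amount_flip_id m i rho y x m' k i' :
  ~~ [&& m' == m, i' == i & odd k == rho] -> amount (flip m i rho y x) m' k i' = amount x m' k i'.
Proof.
move=> h; apply: eq_bigr => j _; rewrite flipE.
have -> : [&& m' == m, i' == i, odd k == rho & y k j] =
    [&& m' == m, i' == i & odd k == rho] && y k j by rewrite -!andbA.
by rewrite (negbTE h) addbF.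
Qed.

Lemma amount_flip m i rho y x k : odd k = rho ->
  amount (flip m i rho y x) m k i = \sum_(j < nbits m) sgb (x (bitcode m k i j) (+) y k j).
Proof. by move=> kr; apply: eq_bigr => j _; rewrite flipE kr !eqxx. Qed.

Lemma bump_cell_eq1 m k r : step m * k%:R <= r < step m * k.+1%:R -> bump m k r = 1.
Proof.
move=> /andP[r1 r2]; apply: trap_eq1; have s0 := step_gt0 m.
have h1 : k%:R <= r / step m by rewrite ler_pdivlMr// mulrC.
have h2 : r / step m <= k%:R + 1 by rewrite natr1 ler_pdivrMr// mulrC ltW.
by apply/andP; split; lra.
Qed.

Lemma bump_cell_eq0 m k l r : step m * k%:R <= r < step m * k.+1%:R ->
  odd l = odd k -> l != k -> bump m l r = 0.
Proof.
move=> /andP[r1 r2] lk nlk; apply: trap_eq0; have s0 := step_gt0 m.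
have h1 : k%:R <= r / step m by rewrite ler_pdivlMr// mulrC.
have h2 : r / step m <= k%:R + 1 by rewrite natr1 ler_pdivrMr// mulrC ltW.
have [lt|lt|e] := ltngtP l k; last by rewrite e eqxx in nlk.
- right; have : (l + 2 <= k)%N.
    by move: lt; rewrite leq_eqVlt => /predU1P[e|]; [move: lk; rewrite -e /=; case: (odd l)|rewrite addn2].
  by rewrite -(ler_nat R) natrD; lra.
- left; have : (k + 2 <= l)%N.
    by move: lt; rewrite leq_eqVlt => /predU1P[e|]; [move: lk; rewrite -e /=; case: (odd k)|rewrite addn2].
  by rewrite -(ler_nat R) natrD; lra.
Qed.

Lemma level_flip m (i : 'I_d) rho y x (k : 'I_(4 ^ m)) r m' (i' : 'I_d) :
  odd k = rho -> step m * k%:R <= r < step m * k.+1%:R ->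
  level_fun (flip m i rho y x) m' r 0 i' - level_fun x m' r 0 i' =
  if (m' == m) && (i' == i) then
    amp m * (\sum_(j < nbits m) sgb (x (bitcode m k i j) (+) y k j) - amount x m k i)
  else 0.
Proof.
move=> kr rk; rewrite !mxE -mulrBr -sumrB.
case: (boolP (_ && _)) => [/andP[/eqP em /eqP ei]|ne]; last first.
  rewrite big1 ?mulr0// => l _; rewrite amount_flip_id ?subrr//.
  by apply: contra ne => /and3P[-> /eqP/val_inj -> _]; rewrite eqxx.
subst m' i'; congr (_ * _).
rewrite (bigD1 k)//= bump_cell_eq1// !mul1r big1 ?addr0; first by rewrite amount_flip.
move=> l lk; have [lo|lo] := eqVneq (odd l) rho.
  by rewrite (@bump_cell_eq0 m k)// ?mul0r ?subrr// lo kr.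
by rewrite amount_flip_id ?subrr// (negbTE lo) !andbF.
Qed.

Lemma partialE x N (u : time T) i : partial x N u 0 i = \sum_(m < N) level_fun x m (val u) 0 i.
Proof.
elim: N => [|N IH].
  by rewrite /partial /series /= big_geq// big_ord0 mxE.
rewrite big_ord_recr -IH /= /partial seriesSr.
by rewrite [LHS]mxE.
Qed.

Lemma dotv_partial_flip m (i : 'I_d) rho y x (k : 'I_(4 ^ m)) r N xi :
  (m < N)%N -> odd k = rho -> 0 <= r <= T -> step m * k%:R <= r < step m * k.+1%:R ->
  dotv xi (lift_path (partial (flip m i rho y x) N) r) =
  dotv xi (lift_path (partial x N) r) + xi 0 i * amp m *
    (\sum_(j < nbits m) sgb (x (bitcode m k i j) (+) y k j) - amount x m k i).
Proof.
move=> mN kr rT rk; apply/eqP; rewrite addrC -subr_eq; apply/eqP.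
rewrite -dotvBr /dotv (bigD1 i)//= big1 ?addr0; last first.
  move=> i' ii'; rewrite !mxE !partialE -sumrB big1 ?mulr0// => m' _.
  by rewrite val_clamp// (level_flip _ _ _ _ _ kr)// (negbTE ii') andbF.
rewrite !mxE !partialE (val_clamp rT) -sumrB (bigD1 (Ordinal mN))//= big1 ?addr0.
  by rewrite (level_flip _ _ _ _ _ kr)// !eqxx mulrA.
move=> m' mm'; rewrite (level_flip _ _ _ _ _ kr)//.
by case: eqP => // e; move: mm'; rewrite -val_eqE /= e eqxx.
Qed.

Lemma step_cell_sub m k r : (k < 4 ^ m)%N -> step m * k%:R <= r < step m * k.+1%:R -> 0 <= r <= T.
Proof.
move=> km /andP[r1 r2]; have s0 := step_gt0 m; apply/andP; split.
  by apply: le_trans r1; rewrite mulr_ge0// ltW.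
apply: le_trans (ltW r2) _; apply: (@le_trans _ _ (step m * (4 ^ m)%N%:R)).
  by rewrite ler_pM2l// ler_nat.
by rewrite natrX /step divfK// expf_neq0.
Qed.

(** * Exponential moments of sums over cells *)

Section mgf.
Context (v : E) (xi : 'rV[R]_d) (i : 'I_d) (m N : nat) (th c : R).
Hypotheses (mN : (m < N)%N) (c01 : 0 <= c < 1)
  (cosc : `|cos (xi 0 i * amp m)| <= c) (cL : c ^+ L <= 2^-1).

Local Notation h := (step m).
Local Notation Q := (code_bound N).
Local Notation K := (4 ^ m)%N.
Local Notation J := (nbits m).
Local Notation lam := (xi 0 i * amp m).
Local Notation U := {ffun 'I_J -> bool}.

Definition cell_integral (x : nat -> bool) (k : nat) : R :=
  phase_integral (partial x N - v) xi th (h * k%:R) (h * k.+1%:R).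

(* The contribution of the cell k once its own signs in the direction i are flipped by u. *)
Definition conditional (x : nat -> bool) (k : nat) (u : U) : R :=
  \int[lebesgue_measure]_(r in `[h * k%:R, h * k.+1%:R[)
    cos (dotv xi (lift_path (partial x N - v) r) - lam * amount x m k i + th +
         lam * \sum_(j < J) sgb (x (bitcode m k i j) (+) u j)).

Definition nat_bits (y : {ffun 'I_K -> U}) (k j : nat) : bool :=
  if insub k is Some k' then if insub j is Some j' then y k' j' else false else false.

Lemma nat_bitsE y (k : 'I_K) (j : 'I_J) : nat_bits y k j = y k j.
Proof. by rewrite /nat_bits !valK. Qed.

Lemma cell_integral_flip rho x (y : {ffun 'I_K -> U}) (k : 'I_K) : odd k = rho ->
  cell_integral (flip m i rho (nat_bits y) x) k = conditional x k (y k).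
Proof.
move=> kr; rewrite /cell_integral /phase_integral /conditional.
apply: eq_Rintegral => r; rewrite inE /= in_itv /= => rk; congr cos.
have rT := step_cell_sub (ltn_ord k) rk.
have e (z : nat -> bool) : lift_path (partial z N - v) r = lift_path (partial z N) r - lift_path v r by [].
rewrite !e !dotvBr (@dotv_partial_flip m i rho _ x k r N xi mN kr rT rk).
have -> : \sum_(j < J) sgb (x (bitcode m k i j) (+) nat_bits y k j) =
    \sum_(j < J) sgb (x (bitcode m k i j) (+) y k j) :> R.
  by apply: eq_bigr => j _; rewrite nat_bitsE.
ring.
Qed.

Lemma cell_len k : h * k.+1%:R - h * k%:R = h.
Proof. by rewrite -mulrBr -natr1 addrAC subrr add0r mulr1. Qed.

Lemma cell_le k : h * k%:R <= h * k.+1%:R.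
Proof. by rewrite -subr_ge0 cell_len ltW// step_gt0. Qed.

Lemma bmeas_conditional x k (s : R) : bmeas `[h * k%:R, h * k.+1%:R[%classic
  (fun r => cos (dotv xi (lift_path (partial x N - v) r) - lam * amount x m k i + th + s)).
Proof.
apply: bmeas_cos; do 3 (apply: measurable_funD; last exact: measurable_cst).
exact: measurable_funTS (measurable_dotv_path xi _).
Qed.

Lemma conditional_norm x k u : `|conditional x k u| <= h.
Proof.
rewrite -[leRHS](cell_len k) -(lebesgue_co (cell_le k)) -[leRHS]mul1r.
apply: Rintegral_norm_le; [exact: measurable_itv|exact: lebesgue_co_lty|exact: bmeas_conditional|].
by move=> r _; exact: cos_max.
Qed.

Lemma sum_conditional x k : \sum_(u : U) conditional x k u <= #|U|%:R * (h * c ^+ J).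
Proof.
rewrite /conditional -Rintegral_sum; [|exact: measurable_itv|exact: lebesgue_co_lty|]; last first.
  by move=> u; exact: bmeas_conditional.
under eq_Rintegral => r _ do
  rewrite (@sum_cos_bits R J lam _ (fun j => x (bitcode m k i j))).
rewrite card_ffun card_ord card_bool natrX.
have -> : 2 ^+ J * (h * c ^+ J) = 2 ^+ J * c ^+ J *
    fine (lebesgue_measure (`[h * k%:R, h * k.+1%:R[%classic : set R)).
  by rewrite (lebesgue_co (cell_le k)) cell_len (mulrC h) mulrA.
apply: le_trans (ler_norm _) _; apply: Rintegral_norm_le.
- exact: measurable_itv.
- exact: lebesgue_co_lty.
- apply: bmeasZ; apply: bmeasM; last exact: bmeas_cst.
  apply: bmeas_cos; do 2 (apply: measurable_funD; last exact: measurable_cst).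
  exact: measurable_funTS (measurable_dotv_path xi _).
- move=> r _; rewrite normrM ger0_norm ?exprn_ge0// ler_wpM2l ?exprn_ge0// normrM.
  rewrite -[leRHS]mul1r ler_pM ?cos_max// normrX lerXn2r ?nnegrE//.
  by case/andP: c01.
Qed.

Definition class_sum rho p q (x : nat -> bool) : R :=
  \sum_(k < K | (p <= k < q)%N && (odd k == rho)) cell_integral x k.

(** The Chernoff parameter: theta * h = 2^-(m+1), so the variance term summed over the 4^m cells
    stays bounded. *)
Definition theta : R := 2 ^+ m / (2 * T).

Lemma theta_step : theta * h = 2^-1 / 2 ^+ m.
Proof.
rewrite /theta /step.
have -> : (4 : R) ^+ m = 2 ^+ m * 2 ^+ m by rewrite -exprMn -natrM.
have z : (2 : R) ^+ m != 0 by rewrite expf_neq0.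
by field; rewrite z gt_eqF.
Qed.

Lemma cJ_le : c ^+ J <= 2 ^- m.
Proof.
have /andP[c0 c1] := c01.
rewrite /nbits exprM; apply: (@le_trans _ _ (2^-1 ^+ m.+1)).
  by rewrite lerXn2r ?nnegrE ?exprn_ge0.
by rewrite -exprVn ler_wiXn2l// ?invr_ge0// invf_le1// ler1n.
Qed.

(** Each [fl y] is an involution of the bit vectors, so averaging over x amounts to averaging over x
    and y. For fixed x the cells of parity rho depend on distinct components of y, which is the
    independence that [hoeffding_mgf] asks for. *)
Lemma class_sum_mgf rho p q :
  \sum_(x : {ffun 'I_Q -> bool}) expR (theta * class_sum rho p q (extend x)) <=
  2 ^+ Q * expR 1.
Proof.
have h0 := step_gt0 m; have /andP[c0 c1] := c01.
have th0 : 0 <= theta by rewrite divr_ge0 ?exprn_ge0// mulr_ge0// ltW.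
pose fl (y : {ffun 'I_K -> U}) (x : {ffun 'I_Q -> bool}) : {ffun 'I_Q -> bool} :=
  [ffun q : 'I_Q => x q (+) flip_mask m i rho (nat_bits y) q].
have flK y : involutive (fl y).
  by move=> x; apply/ffunP => z; rewrite !ffunE -addbA addbb addbF.
have flE y x : partial (extend (fl y x)) N = partial (flip m i rho (nat_bits y) (extend x)) N.
  apply: partial_agree => z zQ; rewrite /flip.
  by rewrite (extendE _ (Ordinal zQ)) (extendE _ (Ordinal zQ)) ffunE.
pose Y := {ffun 'I_K -> U}.
have Y0 : (0 : R) < #|{: Y}|%:R.
  by rewrite ltr0n; apply/card_gt0P; exists [ffun=> [ffun=> false]].
rewrite -(ler_pM2l Y0).
have -> : #|{: Y}|%:R * (\sum_(x : {ffun 'I_Q -> bool}) expR (theta * class_sum rho p q (extend x))) =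
   \sum_(x : {ffun 'I_Q -> bool}) \sum_(y : Y) expR (theta * class_sum rho p q (extend (fl y x))).
  rewrite mulr_natl -sumr_const [RHS]exchange_big /=; apply: eq_bigr => y _.
  have flB : {on xpredT, bijective (fl y)} by exists (fl y) => x _; exact: flK.
  pose F (x : {ffun 'I_Q -> bool}) := expR (theta * class_sum rho p q (extend x)).
  have := reindex (op := +%R) (F := F) (fl y) flB.
  by apply.
apply: (@le_trans _ _ (\sum_(x : {ffun 'I_Q -> bool}) #|{: Y}|%:R * expR 1)); last first.
  move: #|_|%:R => y.
  by rewrite sumr_const card_ffun card_bool card_ord -[leLHS]mulr_natl natrX mulrCA.
apply: ler_sum => x _.
pose Z (k : 'I_K) (u : U) : R :=
  if (p <= k < q)%N && (odd k == rho) then conditional (extend x) k u else 0.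
have -> : \sum_(y : Y) expR (theta * class_sum rho p q (extend (fl y x))) =
    \sum_(y : Y) expR (theta * \sum_(k < K) Z k (y k)).
  apply: eq_bigr => y _; congr (expR (_ * _)); rewrite /class_sum big_mkcond.
  apply: eq_bigr => k _; rewrite /Z; case: ifP => // /andP[_ /eqP kr].
  by rewrite /cell_integral flE -(cell_integral_flip _ _ kr).
apply: le_trans (@hoeffding_mgf R U K Z h (h * c ^+ J) theta _ th0 _ _ _) _.
- by apply/card_gt0P; exists [ffun=> false].
- by rewrite theta_step ler_pdivrMr ?exprn_gt0// ler_peMr ?invr_ge0// exprn_ege1// ler1n//.
- by move=> k u; rewrite /Z; case: ifP => _; [exact: conditional_norm|rewrite normr0 ltW].
- move=> k; rewrite /Z; case: (_ && _); first exact: sum_conditional.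
  by rewrite big1// mulr_ge0// mulr_ge0 ?exprn_ge0// ltW.
rewrite ler_wpM2l ?(ltW Y0)// ler_expR mulrA theta_step.
have -> : (K%:R : R) = 2 ^+ m * 2 ^+ m by rewrite natrX -exprMn -natrM.
have p0 : (0 : R) < 2 ^+ m by rewrite exprn_gt0.
have := cJ_le; generalize (c ^+ J) => w; move: p0.
set t := (2 : R) ^+ m => t0 wt.
(* The mean contributes w t / 2 <= 1/2 by [cJ_le], the variance term exactly 1/2. *)
have -> : t * t * (2^-1 / t * w + 2 * (2^-1 / t) ^+ 2) = 2^-1 * (w * t) + 2^-1.
  by field; rewrite gt_eqF.
have : w * t <= 1 by rewrite -ler_pdivlMr// div1r.
lra.
Qed.

Lemma class_sum_tail rho p q t :
  (#|[pred x : {ffun 'I_Q -> bool} | (t < class_sum rho p q (extend x))%R]|)%:R <=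
  2 ^+ Q * (expR 1 * expR (- (theta * t))).
Proof.
have th0 : 0 <= theta by rewrite divr_ge0 ?exprn_ge0// mulr_ge0// ltW.
rewrite expRN mulrA ler_pdivlMr ?expR_gt0//.
apply: le_trans (class_sum_mgf rho p q).
rewrite -sum1_card natr_sum mulr_suml big_mkcond /=; apply: ler_sum => x _.
rewrite inE; case: ifP => [h|_]; last exact: expR_ge0.
by rewrite mul1r ler_expR ler_wpM2l// ltW.
Qed.

Lemma phase_integral_classes x p q : (p <= q <= K)%N ->
  phase_integral (partial x N - v) xi th (h * p%:R) (h * q%:R) =
  class_sum false p q x + class_sum true p q x.
Proof.
move=> /andP[pq qK]; rewrite phase_integral_split ?(ltW (step_gt0 m))//.
rewrite (big_nat_widenl _ 0)// (big_nat_widen _ _ K)// big_mkord.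
rewrite (bigID (fun k : 'I_K => odd k == false)) /=; congr (_ + _).
  by apply: eq_bigl => k /=; case: (odd k) => /=; rewrite ?andbF ?andbT// andbC.
Qed.

End mgf.

(** Phase integrals are Lipschitz in the path; the sets where they exceed a level are therefore
    open, and the exceptional set built from them is Borel. *)
Lemma open_gt_lipschitz (F : E -> R) (t K : R) : 0 <= K ->
  (forall phi psi, F phi - F psi <= K * `|phi - psi|) -> open [set phi | t < F phi].
Proof.
move=> K0 FK; rewrite openE => phi /= tF; apply/nbhs_ballP.
have K1 : 0 < K + 1 by rewrite ltr_wpDl.
exists ((F phi - t) / (K + 1)) => /=; first by rewrite divr_gt0// subr_gt0.
move=> psi; rewrite -ball_normE /=; move: (normr_ge0 (phi - psi)) (FK phi psi).
move: `|phi - psi| => n n0 Fn; rewrite ltr_pdivlMr// mulrDr mulr1 (mulrC n); lra.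
Qed.

Lemma phase_gt_open (v : E) xi th a b t : a <= b ->
  open [set phi : E | t < phase_integral (phi - v) xi th a b].
Proof.
move=> ab; apply: (@open_gt_lipschitz (fun phi => phase_integral (phi - v) xi th a b) t
  ((\sum_(i < d) `|xi 0 i|) * (b - a))).
  by rewrite mulr_ge0 ?subr_ge0// sumr_ge0.
move=> phi psi; apply: le_trans (ler_norm _) _.
have -> : phi - psi = (phi - v) - (psi - v) by rewrite opprB addrA subrK.
by rewrite mulrAC; exact: phase_integral_dist.
Qed.

(** Of the budget 4 t, truncating the path at level N uses at most 2 t, and each parity class is
    left with t. The bound [class_sum_tail] is uniform in N, so N may be taken as large as t
    requires. *)
Lemma phase_tail (v : E) (xi : 'rV[R]_d) (i : 'I_d) m p q th (c t : R) : 0 <= c < 1 ->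
  `|cos (xi 0 i * amp m)| <= c -> c ^+ L <= 2^-1 -> (p <= q <= 4 ^ m)%N -> 0 < t ->
  (lebesgue_measure ([set w : R | (4 * t < phase_integral (random_holder w - v) xi th
      (step m * p%:R) (step m * q%:R))%R] `&` `[0%R, 1%R[%classic) <=
   (2 * (expR 1 * expR (- (theta m * t))))%:E)%E.
Proof.
move=> c01 cosc cL pqK t0.
have /andP[pq qK] := pqK.
have aux (X Z : R) : 4 * t < X -> X - Z <= 2 * t -> 2 * t < Z by lra.
have aux2 (X Z : R) : 2 * t < X + Z -> X <= t -> t < Z by lra.
set a := step m * p%:R; set b := step m * q%:R.
have ab : a <= b by rewrite ler_wpM2l ?ler_nat// ltW// step_gt0.
pose D := (\sum_(j < d) `|xi 0 j|) * level_cst * (b - a).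
have D0 : 0 <= D by rewrite mulr_ge0 ?subr_ge0// mulr_ge0 ?level_cst_ge0// sumr_ge0.
pose N := (maxn m (Num.truncn (D / (2 * t)))).+1.
have mN : (m < N)%N by rewrite ltnS leq_maxl.
have DN : D / N%:R <= 2 * t.
  rewrite ler_pdivrMr ?ltr0n// mulrC -ler_pdivrMr ?mulr_gt0//.
  by apply: le_trans (ltW (truncnS_gt _)) _; rewrite ler_nat ltnS leq_maxr.
pose P (x : {ffun 'I_(code_bound N) -> bool}) :=
  (t < class_sum v xi m N th false p q (extend x)) ||
  (t < class_sum v xi m N th true p q (extend x)).
have mS : measurable ([set w : R | (4 * t < phase_integral (random_holder w - v) xi th a b)%R]).
  rewrite -[X in measurable X]setTI.
  apply: (measurable_random_holder measurableT
    (Y := [set phi : E | 4 * t < phase_integral (phi - v) xi th a b])).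
  by apply: sub_sigma_algebra; exact: phase_gt_open.
apply: le_trans (@lebesgue_bits_le (code_bound N) _ P _ _ _) _.
- by apply: measurableI => //; exact: measurable_itv.
- by move=> w [].
- move=> w [/= h _].
  have agree : partial (extend [ffun z : 'I_(code_bound N) => digit w z]) N = partial (digit w) N.
    apply: partial_agree => z zQ.
    by rewrite (extendE _ (Ordinal zQ)) ffunE.
  have h2 : 2 * t < phase_integral (partial (digit w) N - v) xi th a b.
    have := phase_integral_dist (random_holder w - v) (partial (digit w) N - v) xi th ab.
    have -> : random_holder w - v - (partial (digit w) N - v) =
        random_path (digit w) - partial (digit w) N.
      by rewrite opprB addrA subrK.
    have := ler_norm (phase_integral (random_holder w - v) xi th a b -
       phase_integral (partial (digit w) N - v) xi th a b).
    have : (\sum_(j < d) `|xi 0 j|) * `|random_path (digit w) - partial (digit w) N| * (b - a)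
        <= D / N%:R.
      have -> : D / N%:R = (\sum_(j < d) `|xi 0 j|) * (level_cst / N%:R) * (b - a).
        by rewrite /D -!mulrA; congr (_ * (_ * _)); exact: mulrC.
      rewrite ler_wpM2r ?subr_ge0// ler_wpM2l ?sumr_ge0//.
      exact: path_partial_dist.
    move=> e1 e2 e3; have e4 := le_trans e2 (le_trans e3 (le_trans e1 DN)).
    exact: aux h e4.
  have := phase_integral_classes v xi N th (digit w) pqK; rewrite -/a -/b => e.
  rewrite e in h2.
  have ce rho : class_sum v xi m N th rho p q (extend [ffun z : 'I_(code_bound N) => digit w z]) =
      class_sum v xi m N th rho p q (digit w).
    by apply: eq_bigr => k _; rewrite /cell_integral agree.
  rewrite /P !ce; apply/orP.
  have [h3|h3] := ltP t (class_sum v xi m N th false p q (digit w)); [by left|right].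
  exact: aux2 h2 h3.
rewrite lee_fin ler_pdivrMr ?exprn_gt0//.
pose PP rho : pred {ffun 'I_(code_bound N) -> bool} :=
  [pred x | t < class_sum v xi m N th rho p q (extend x)].
have le : (#|[pred x | P x]| <= #|PP false| + #|PP true|)%N.
  rewrite -cardUI; apply: leq_trans (leq_addr _ _).
  by rewrite leq_eqVlt; apply/predU1P; left; apply: eq_card => x; rewrite !inE.
apply: (@le_trans _ _ (#|PP false|%:R + #|PP true|%:R)); first by rewrite -natrD ler_nat.
have := @class_sum_tail v xi i m N th c mN c01 cosc cL false p q t.
have := @class_sum_tail v xi i m N th c mN c01 cosc cL true p q t.
set X := expR 1 * _; rewrite -/(PP true) -/(PP false) => h1 h2.
by rewrite mulrC [leRHS]mulrCA mulr_natl mulr2n lerD.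
Qed.

(** * Exceptional paths *)

Definition rate : R := ln (2 * 64 ^+ d).
(** For t = threshold m / 4 the exponent theta m * t equals rate * (m + 1), and the tail is of order
    (2 * 64^d)^-(m+1). Against a number of grid points of order 64^(d m), a factor 2^-m is left to
    sum. *)
Definition threshold m : R := 4 * (2 * T * (rate * m.+1%:R) / 2 ^+ m).
(** Frequencies of level m have size at most 1 / amp m, which is at most a constant times 32^m; in
    units of the mesh 2^-m this becomes 64^m. *)
Definition radius m : nat := ((Num.truncn (1 + T^-1)).+1 * 64 ^ m)%N.

Definition grid m (g : {ffun 'I_d -> 'I_(radius m).*2.+1}) : 'rV[R]_d :=
  \row_i (((g i)%:R - (radius m)%:R) / 2 ^+ m).

(** One coordinate in the window is enough, since the signs flipped are those of a single
    coordinate. *)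
Definition active m (xi : 'rV[R]_d) : bool := [exists i, 64^-1 <= `|xi 0 i * amp m| <= 1].

(** The four multiples of pi / 2 turn one-sided tail bounds into bounds for the absolute values of
    the real and imaginary parts. *)
Definition large m a b xi (q : 'I_4) : set E :=
  if active m xi then [set phi | threshold m < phase_integral phi xi (q%:R * (pi / 2)) a b] else set0.

(** The time interval remains the cell p of level m0 while the frequencies run through the levels m0
    + n; the limit superior is taken in n. *)
Definition bad m0 p n : set E :=
  \big[setU/set0]_(z <- enum [the finType of ({ffun 'I_d -> 'I_(radius (m0 + n)).*2.+1} * 'I_4)%type])
    large (m0 + n) (step m0 * p%:R) (step m0 * p.+1%:R) (grid z.1) z.2.

Lemma rate_gt0 : 0 < rate.
Proof.
rewrite ln_gt0// (@lt_le_trans _ _ 2) ?ltr1n// ler_peMr// exprn_ege1// ler1n.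
by [].
Qed.

Lemma large_open m a b xi q (v : E) : a <= b -> open [set phi | large m a b xi q (phi - v)].
Proof.
move=> ab; rewrite /large; case: ifP => _; last exact: open0.
exact: phase_gt_open.
Qed.

Lemma step_refine m0 n p : step m0 * p%:R = step (m0 + n) * (p * 4 ^ n)%N%:R.
Proof.
rewrite /step natrM natrX exprD.
have aux (x y z : R) : x != 0 -> y != 0 -> T / x * z = T / (x * y) * (z * y).
  by move=> x0 y0; field; rewrite x0 y0.
by apply: aux; rewrite expf_neq0.
Qed.

Lemma step_cell_le m0 p : step m0 * p%:R <= step m0 * p.+1%:R.
Proof. by rewrite ler_wpM2l ?ler_nat ?leqW// ltW// step_gt0. Qed.

Lemma measurable_large_random (v : E) m a b xi q : a <= b ->
  measurable [set w : R | large m a b xi q (random_holder w - v)].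
Proof.
move=> ab; rewrite -[X in measurable X]setTI.
apply: (measurable_random_holder measurableT (Y := [set phi : E | large m a b xi q (phi - v)])).
by apply: sub_sigma_algebra; exact: large_open.
Qed.

Section exceptional_law.
Context (c : R).
Hypotheses (c01 : 0 <= c < 1) (cL : c ^+ L <= 2^-1)
  (cos_le : forall lam, 64^-1 <= `|lam| <= 1 -> `|cos lam| <= c).

Lemma large_random_le (v : E) m0 n p xi q : (p < 4 ^ m0)%N ->
  (lebesgue_measure ([set w : R | large (m0 + n) (step m0 * p%:R) (step m0 * p.+1%:R) xi q
      (random_holder w - v)]%R `&` `[0%R, 1%R[%classic) <=
   (2 * (expR 1 * (2 * 64 ^+ d) ^- (m0 + n).+1))%:E)%E.
Proof.
move=> pm; rewrite /large; case: ifPn => [/existsP[i act]|_]; last first.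
  rewrite (_ : [set _ | _] = set0); last by apply/seteqP; split.
  by rewrite set0I measure0 lee_fin !mulr_ge0 ?expR_ge0// invr_ge0 exprn_ge0// mulr_ge0// exprn_ge0.
set m := (m0 + n)%N in act *.
have t0 : 0 < 2 * T * (rate * m.+1%:R) / 2 ^+ m.
  by rewrite divr_gt0 ?exprn_gt0// !mulr_gt0// rate_gt0.
have th : theta m * (2 * T * (rate * m.+1%:R) / 2 ^+ m) = rate * m.+1%:R.
  have aux (x y : R) : x != 0 -> x / (2 * T) * (2 * T * y / x) = y.
    by move=> x0; field; rewrite x0 gt_eqF.
  by apply: aux; rewrite expf_neq0.
have rateE : expR (- (rate * m.+1%:R)) = (2 * 64 ^+ d) ^- m.+1.
  by rewrite expRN mulrC expRM_natl lnK// posrE mulr_gt0 ?exprn_gt0.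
have pq : (p * 4 ^ n <= p.+1 * 4 ^ n <= 4 ^ m)%N.
  by rewrite leq_mul2r leqnSn orbT /m expnD leq_mul2r pm orbT.
have := @phase_tail v xi i m (p * 4 ^ n)%N (p.+1 * 4 ^ n)%N (q%:R * (pi / 2)) c _ c01
  (cos_le act) cL pq t0.
by rewrite th rateE -!step_refine.
Qed.

Lemma measurable_bad_random (v : E) m0 p n :
  measurable [set w : R | bad m0 p n (random_holder w - v)].
Proof.
rewrite (_ : [set _ | _] = (fun w => random_holder w - v) @^-1` bad m0 p n)//.
rewrite /bad; elim: (enum _) => [|z s IH]; first by rewrite big_nil preimage_set0; exact: measurable0.
rewrite big_cons preimage_setU; apply: measurableU => //.
by apply: measurable_large_random; exact: step_cell_le.
Qed.

Definition bad_cst : R := 16 * expR 1 * (3 * (Num.truncn (1 + T^-1)).+1%:R) ^+ d.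

Lemma radius_le m : ((radius m).*2.+1 <= 3 * (Num.truncn (1 + T^-1)).+1 * 64 ^ m)%N.
Proof.
rewrite /radius -mulnA; set r := (_.+1 * _)%N.
have : (0 < r)%N by rewrite muln_gt0 expn_gt0.
by rewrite -addnn; lia.
Qed.

(** A union bound over the grid and the four phases. What remains is stated in the summable form
    that [epsilon_trick0] expects. *)
Lemma bad_random_le (v : E) m0 n p : (p < 4 ^ m0)%N ->
  (lebesgue_measure ([set w : R | bad m0 p n (random_holder w - v)]%R `&` `[0%R, 1%R[%classic) <=
   (bad_cst / (2 ^ n.+1)%N%:R)%:E)%E.
Proof.
move=> pm; pose b : R := 2 * (expR 1 * (2 * 64 ^+ d) ^- (m0 + n).+1).
have union (s : seq ({ffun 'I_d -> 'I_(radius (m0 + n)).*2.+1} * 'I_4)) :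
    (lebesgue_measure ([set w : R | (\big[setU/set0]_(z <- s)
    large (m0 + n) (step m0 * p%:R) (step m0 * p.+1%:R) (grid z.1) z.2) (random_holder w - v)]%R
    `&` `[0%R, 1%R[%classic) <= ((size s)%:R * b)%:E)%E.
  elim: s => [|z s IH].
    rewrite (_ : [set _ | _] = set0); last by apply/seteqP; split => // w; rewrite /= big_nil.
    by rewrite set0I measure0 mul0r.
  have -> : [set w : R | (\big[setU/set0]_(z <- z :: s)
    large (m0 + n) (step m0 * p%:R) (step m0 * p.+1%:R) (grid z.1) z.2) (random_holder w - v)] =
    [set w : R | large (m0 + n) (step m0 * p%:R) (step m0 * p.+1%:R) (grid z.1) z.2 (random_holder w - v)] `|`
    [set w : R | (\big[setU/set0]_(z <- s)
    large (m0 + n) (step m0 * p%:R) (step m0 * p.+1%:R) (grid z.1) z.2) (random_holder w - v)].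
    by apply/seteqP; split => w; rewrite /= big_cons.
  rewrite setIUl; apply: le_trans (measureU2 _ _ _) _.
  - apply: measurableI; last exact: measurable_itv.
    by apply: measurable_large_random; exact: step_cell_le.
  - apply: measurableI; last exact: measurable_itv.
    elim: s {IH} => [|y s IH].
      rewrite (_ : [set _ | _] = set0); first exact: measurable0.
      by apply/seteqP; split => // w; rewrite /= big_nil.
    rewrite (_ : [set _ | _] = (fun w => random_holder w - v) @^-1` (\big[setU/set0]_(z <- y :: s)
      large (m0 + n) (step m0 * p%:R) (step m0 * p.+1%:R) (grid z.1) z.2))//.
    rewrite big_cons preimage_setU; apply: measurableU => //.
    by apply: measurable_large_random; exact: step_cell_le.
  have -> : (size (z :: s))%:R * b = b + (size s)%:R * b.
    by rewrite /= -natr1 mulrDl mul1r addrC.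
  rewrite EFinD; apply: leeD => //.
  exact: large_random_le.
apply: le_trans (union _) _.
rewrite lee_fin -cardT card_prod card_ffun !card_ord natrM natrX /b /bad_cst.
set r := (3 * _)%R.
have rd : (radius (m0 + n)).*2.+1%:R ^+ d <= r ^+ d * (64 ^+ d) ^+ (m0 + n) :> R.
  rewrite -exprM mulnC exprM -exprMn lerXn2r ?nnegrE ?mulr_ge0 ?exprn_ge0//.
  by rewrite /r -natrX -!natrM ler_nat radius_le.
have two : (2 : R) ^- (m0 + n).+1 <= 2 ^- n.+1.
  rewrite lef_pV2 ?posrE ?exprn_gt0// ler_weXn2l ?ler1n//.
  by rewrite ltnS leq_addl.
have x0 : (0 : R) < 64 ^+ d by rewrite exprn_gt0.
have r0 : 0 <= r ^+ d by rewrite exprn_ge0// mulr_ge0.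
have e0 : 0 <= expR 1 :> R by exact: expR_ge0.
move: rd two x0; rewrite natrX; set u := _.*2.+1%:R ^+ d.
set y := (64 : R) ^+ d; set k := (m0 + n)%N; move=> ru two y0.
rewrite exprMn invfM; set f := 2 ^- k.+1 in two *; set h := 2 ^- n.+1 in two *.
have -> : y ^- k.+1 = y^-1 * y ^- k by rewrite exprS invfM.
have yk : 0 < y ^+ k by rewrite exprn_gt0.
have y1 : 1 <= y by rewrite exprn_ege1// ler1n.
have uyk : u / y ^+ k <= r ^+ d by rewrite ler_pdivrMr.
have f0 : 0 <= f by rewrite invr_ge0 exprn_ge0.
have yv : 0 <= y^-1 <= 1 by rewrite invr_ge0 (ltW y0) invf_le1.
have u0 : 0 <= u / y ^+ k by rewrite divr_ge0 ?exprn_ge0// ltW.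
have -> : u * 4%:R * (2 * (expR 1 * (f * (y^-1 * y ^- k)))) =
   8 * expR 1 * ((u / y ^+ k) * (f * y^-1)) by ring.
have h1 : f * y^-1 <= h by apply: le_trans two; rewrite ler_piMr//; case/andP: yv.
have h2 : (u / y ^+ k) * (f * y^-1) <= r ^+ d * h.
  by rewrite ler_pM// mulr_ge0//; case/andP: yv.
have h3 : 0 <= (u / y ^+ k) * (f * y^-1) by have /andP[y2 _] := yv; exact: mulr_ge0 u0 (mulr_ge0 f0 y2).
have h4 := le_trans h3 h2.
rewrite -[leRHS]mulrA; apply: (@le_trans _ _ (8 * expR 1 * (r ^+ d * h))).
  by rewrite ler_wpM2l// mulr_ge0.
by rewrite ler_wpM2r// ler_wpM2r// ler_nat.
Qed.

Lemma bad_measurable m0 p n : measurable (bad m0 p n : set (borelType E)).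
Proof.
apply: bigsetU_measurable => z _; apply: sub_sigma_algebra.
have := @large_open (m0 + n) _ _ (grid z.1) z.2 0 (step_cell_le m0 p).
by under eq_fun do rewrite subr0.
Qed.

(** A single set for all dyadic cells and all decay exponents, off which the three conclusions of
    the theorem hold. *)
Definition exceptional : set E :=
  \bigcup_m0 \bigcup_(p in [set p | (p < 4 ^ m0)%N]) lim_sup_set (bad m0 p).

Lemma exceptional_measurable : measurable (exceptional : set (borelType E)).
Proof.
apply: bigcup_measurable => m0 _; apply: bigcup_measurable => p _.
apply: bigcapT_measurable => n; apply: bigcup_measurable => k _.
exact: bad_measurable.
Qed.

(** A path W lies in the translate exactly when W - v is exceptional. The tail bounds are uniform in
    v, so Borel-Cantelli applies to every translate, for each of the countably many cells. *)
Lemma exceptional_null (v : E) : transverse_law [set v + a | a in exceptional] = 0%E.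
Proof.
rewrite (_ : [set v + a | a in exceptional] = [set phi | exceptional (phi - v)]); last first.
  apply/seteqP; split => [_ [a Aa <-]|phi h] /=; first by rewrite addrAC subrr add0r.
  by exists (phi - v) => //; rewrite addrC subrK.
pose F m0 p n := [set w : R | bad m0 p n (random_holder w - v)]%R `&` `[0%R, 1%R[%classic.
have mF m0 p n : measurable (F m0 p n).
  by apply: measurableI; [exact: measurable_bad_random|exact: measurable_itv].
have cell m0 p : (p < 4 ^ m0)%N -> lebesgue_measure (lim_sup_set (F m0 p)) = 0%E.
  move=> pm; apply: lim_sup_set_cvg0; first by move=> n; exact: mF.
  apply: le_lt_trans (lee_nneseries _ _) _; last 1 first.
  - apply: le_lt_trans (@epsilon_trick0 R bad_cst xpredT _) _; last exact: ltry.
    by rewrite mulr_ge0 ?exprn_ge0 ?mulr_ge0 ?expR_ge0.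
  - by move=> n _ _; exact: measure_ge0.
  - by move=> n _; exact: bad_random_le.
rewrite /transverse_law /pushforward /mrestr; apply: measure_negligible.
  apply: measurableI; last exact: measurable_itv.
  rewrite (_ : _ @^-1` _ = \bigcup_m0 \bigcup_(p in [set p | (p < 4 ^ m0)%N])
     \bigcap_n \bigcup_(k in [set k | (n <= k)%N]) [set w : R | bad m0 p k (random_holder w - v)])//.
  apply: bigcup_measurable => m0 _; apply: bigcup_measurable => p _.
  apply: bigcapT_measurable => n; apply: bigcup_measurable => k _.
  exact: measurable_bad_random.
have neg : lebesgue_measure.-negligible (\bigcup_m0 \bigcup_p
    if (p < 4 ^ m0)%N then lim_sup_set (F m0 p) else set0).
  apply: negligible_bigcup => m0; apply: negligible_bigcup => p.
  case: ifP => [pm|_]; last exact: negligible_set0.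
  apply/negligibleP; last exact: cell.
  rewrite /lim_sup_set; apply: bigcapT_measurable => n.
  by apply: bigcup_measurable => k _; exact: mF.
apply: negligibleS neg => w [/= [m0 _ [p pm h]] w01]; exists m0 => //; exists p => //.
by rewrite pm => n _; have [k nk hk] := h n I; exists k.
Qed.

Lemma exceptional_shy : borel_shy exceptional.
Proof.
split; first exact: exceptional_measurable.
exists transverse_law; split; first exact: transverse_law_compact.
exact: exceptional_null.
Qed.

End exceptional_law.

(** * Sizes of the amplitudes and rounding of frequencies *)

Lemma natr_powR_geometric (s r : R) : 0 <= s -> 0 < r ->
  exists2 C : R, 0 <= C & forall m : nat, m.+1%:R `^ s <= C * 2 `^ (r * m%:R).
Proof.
(* Dividing by s + 1 instead of s keeps q defined at s = 0; the exponent q s m is at most r m all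
   the same. *)
move=> s0 r0; pose q := r / (s + 1); pose u := q * ln 2.
have s1 : 0 < s + 1 by lra.
have q0 : 0 < q by rewrite divr_gt0.
have u0 : 0 < u by rewrite mulr_gt0// ln_gt0// ltr1n.
exists ((1 + u^-1) `^ s) => [|m]; first exact: powR_ge0.
have le1 : m.+1%:R <= (1 + u^-1) * 2 `^ (q * m%:R) :> R.
  have -> : 2 `^ (q * m%:R) = expR (u * m%:R) :> R.
    by rewrite /powR pnatr_eq0 /= /u mulrAC.
  apply: (@le_trans _ _ ((1 + u^-1) * (1 + u * m%:R))).
    have -> : (1 + u^-1) * (1 + u * m%:R) = 1 + m%:R + (u^-1 + u * m%:R).
      by field; rewrite gt_eqF.
    have ui : 0 < u^-1 by rewrite invr_gt0.
    have um : 0 <= u * m%:R by rewrite mulr_ge0// ltW.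
    by rewrite -natr1; lra.
  by rewrite ler_wpM2l ?expR_ge1Dx// addr_ge0// invr_ge0 ltW.
apply: (@le_trans _ _ (((1 + u^-1) * 2 `^ (q * m%:R)) `^ s)).
  by rewrite ge0_ler_powR ?nnegrE ?mulr_ge0 ?powR_ge0 ?addr_ge0 ?invr_ge0 ?(ltW u0).
rewrite powRM ?powR_ge0 ?addr_ge0 ?invr_ge0 ?(ltW u0)// ler_wpM2l ?powR_ge0//.
rewrite -powRrM ler_powR ?ler1n// mulrAC ler_wpM2r// /q mulrAC ler_pdivrMr// ler_wpM2l ?(ltW r0)//.
lra.
Qed.

Lemma amp_le m : amp m <= T `^ delta.
Proof.
rewrite /amp ler_pdivrMr ?exprn_gt0//.
apply: (@le_trans _ _ (T `^ delta)); last first.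
  by rewrite ler_peMr ?powR_ge0// exprn_ege1// ler1n.
rewrite ge0_ler_powR ?nnegrE ?(ltW T_gt0) ?(ltW (step_gt0 m))//.
by rewrite ler_pdivrMr ?exprn_gt0// ler_peMr ?(ltW T_gt0)// exprn_ege1// ler1n.
Qed.

(** For delta = 0 only the polynomial factor makes [amp m] tend to 0; this bound therefore provides
    a level for each frequency. *)
Lemma amp_le_inv m : amp m <= T `^ delta / m.+1%:R.
Proof.
have p0 : (0 : R) < m.+1%:R by rewrite ltr0n.
rewrite /amp ler_pM ?powR_ge0 ?invr_ge0 ?exprn_ge0//; last first.
  by rewrite lef_pV2 ?posrE ?exprn_gt0// ler_eXnr// ler1n.
rewrite ge0_ler_powR ?nnegrE ?(ltW T_gt0) ?(ltW (step_gt0 m))//.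
by rewrite ler_pdivrMr ?exprn_gt0// ler_peMr ?(ltW T_gt0)// exprn_ege1// ler1n.
Qed.

Local Notation scale := ((Num.truncn (1 + T^-1)).+1).

Lemma scale_ge : 1 + T^-1 <= scale%:R.
Proof. by rewrite ltW// truncnS_gt. Qed.

(** A factor 4^m comes from the step, as delta <= 1, and 8^m from (m + 1)^3 <= 8^m. The integer
    [scale] absorbs the dependence on T. *)
Lemma amp_ge m : (scale%:R * 32 ^+ m)^-1 <= amp m.
Proof.
have S0 : (0 : R) < scale%:R by rewrite ltr0n.
have S1 := scale_ge; have Ti : 0 < T^-1 by rewrite invr_gt0.
pose y : R := (scale%:R * 4 ^+ m)^-1.
have y0 : 0 < y by rewrite invr_gt0 mulr_gt0 ?exprn_gt0.
have y1 : y <= 1.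
  by rewrite invf_le1 ?mulr_gt0 ?exprn_gt0// mulr_ege1 ?exprn_ege1 ?ler1n//; lra.
have ys : y <= step m.
  rewrite /y /step invfM ler_pM2r ?invr_gt0 ?exprn_gt0//.
  by rewrite invf_ple ?posrE//; lra.
have h1 : y <= step m `^ delta.
  apply: (@le_trans _ _ (y `^ delta)).
    by rewrite -[leLHS]powRr1 ?(ltW y0)// ger_powR// y0 y1.
  by rewrite ge0_ler_powR ?nnegrE ?(ltW y0) ?(ltW (step_gt0 m)).
rewrite /amp ler_pdivlMr ?exprn_gt0//; apply: le_trans h1.
rewrite /y; have -> : (32 : R) ^+ m = 4 ^+ m * (2 ^+ m) ^+ 3.
  by rewrite exprAC -exprMn; congr (_ ^+ m); ring.
rewrite (mulrA scale%:R) invfM -mulrA ler_piMr ?invr_ge0 ?mulr_ge0 ?exprn_ge0//.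
rewrite ler_pdivrMl ?exprn_gt0// mulr1 lerXn2r ?nnegrE ?exprn_ge0//.
by rewrite -natrX ler_nat ltn_expl.
Qed.

(** The constant is 4 * 8, from 4^delta <= 4 and ((m + 2) / (m + 1))^3 <= 8. Hence the windows
    [1/32, 1] for |xi| * amp m leave no gap between levels. *)
Lemma amp_ratio m : amp m <= 32 * amp m.+1.
Proof.
have s0 := step_gt0 m; have s1 := step_gt0 m.+1.
have -> : amp m = (4 * step m.+1) `^ delta / m.+1%:R ^+ 3.
  congr (_ `^ _ / _); rewrite /step exprS.
  have aux (x : R) : x != 0 -> T / x = 4 * (T / (4 * x)) by move=> x0; field.
  by apply: aux; rewrite expf_neq0.
rewrite powRM ?(ltW s1)// /amp.
have h4 : 4 `^ delta <= 4 :> R.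
  by rewrite -[leRHS]powRr1// ler_powR// ler1n.
have h8 : (m.+1%:R ^+ 3)^-1 <= 8 / m.+2%:R ^+ 3 :> R.
  rewrite ler_pdivlMr ?exprn_gt0// mulrC ler_pdivrMr ?exprn_gt0//.
  have -> : (8 : R) = 2 ^+ 3 by rewrite -natrX.
  rewrite -exprMn lerXn2r ?nnegrE ?mulr_ge0// -natrM ler_nat; lia.
have -> : 32 * (step m.+1 `^ delta / m.+2%:R ^+ 3) = (4 * step m.+1 `^ delta) * (8 / m.+2%:R ^+ 3).
  by ring.
by rewrite ler_pM ?mulr_ge0 ?powR_ge0 ?invr_ge0 ?exprn_ge0// ler_wpM2r// powR_ge0.
Qed.

Lemma phase_integral_pi (phi : E) xi th a b :
  phase_integral phi xi (th + pi) a b = - phase_integral phi xi th a b.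
Proof.
rewrite /phase_integral -[RHS]mulN1r -bmeas_RintegralZ//.
- by apply: eq_Rintegral => r _; rewrite addrA cosDpi mulN1r.
- exact: lebesgue_co_lty.
- exact: bmeas_phase.
Qed.

Lemma norm_coord (xi : 'rV[R]_d) i : `|xi 0 i| <= `|xi|.
Proof.
by rewrite [leRHS]/Num.norm /= mx_normrE; apply: (le_bigmax _ _ (0, i)).
Qed.

Lemma norm_attained (xi : 'rV[R]_d) y : 0 < y -> y <= `|xi| -> exists i, y <= `|xi 0 i|.
Proof.
move=> y0; apply: contraPP => /forallNP h; apply/negP; rewrite -ltNge.
rewrite [ltLHS]/Num.norm /= mx_normrE; apply: bigmax_lt => // -[i j] _ /=.
by rewrite (ord1 i) ltNge; apply/negP; exact: h.
Qed.

(** Rounding towards 0 does not increase any coordinate in absolute value, which preserves the upper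
    end of the window in [active]. *)
Lemma grid_round m (xi : 'rV[R]_d) : (forall i, `|xi 0 i| * 2 ^+ m <= (radius m)%:R) ->
  exists g, forall i, `|xi 0 i - @grid m g 0 i| <= 2 ^- m /\ `|@grid m g 0 i| <= `|xi 0 i|.
Proof.
move=> xr; have p0 : (0 : R) < 2 ^+ m by rewrite exprn_gt0.
pose k i := Num.truncn (`|xi 0 i| * 2 ^+ m).
have kE i : (k i)%:R <= `|xi 0 i| * 2 ^+ m < (k i).+1%:R.
  by apply: truncn_itv; rewrite mulr_ge0// ltW.
have kr i : (k i <= radius m)%N.
  by rewrite -(ler_nat R); case/andP: (kE i) => + _; move=> /le_trans; apply.
pose s i := if 0 <= xi 0 i then (radius m + k i)%N else (radius m - k i)%N.
have sr i : (s i < (radius m).*2.+1)%N by rewrite /s; case: ifP => _; have := kr i; lia.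
exists [ffun i => Ordinal (sr i)] => i; rewrite !mxE ffunE /=.
have /andP[k1 k2] := kE i; rewrite -[(k i).+1%:R]natr1 in k2.
rewrite -ler_pdivrMr// in k1; rewrite -ltr_pdivlMr// mulrDl mul1r in k2.
have kp : 0 <= (k i)%:R / 2 ^+ m :> R by rewrite divr_ge0// ltW.
rewrite /s; case: ifPn => [x0|]; last rewrite -ltNge => x0.
  rewrite natrD addrAC subrr add0r (ger0_norm kp).
  rewrite (ger0_norm x0) in k1 k2 *; split => //.
  by rewrite ger0_norm ?subr_ge0//; lra.
rewrite natrB// addrAC subrr add0r mulNr normrN (ger0_norm kp).
rewrite (ltr0_norm x0) in k1 k2 *; split => //.
by rewrite opprK ler0_norm; lra.
Qed.

(** * Fourier decay off the exceptional set *)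

Section good_path.
Context (phi : E) (m0 p : nat).
Hypotheses (good : ~ exceptional phi) (pm : (p < 4 ^ m0)%N).
Local Notation a := (step m0 * p%:R).
Local Notation b := (step m0 * p.+1%:R).

Let ab : a <= b. Proof. exact: step_cell_le. Qed.

Lemma good_grid : exists M, forall m (g : {ffun 'I_d -> 'I_(radius m).*2.+1}) (q : 'I_4),
  (M <= m)%N -> active m (grid g) ->
  phase_integral phi (grid g) (q%:R * (pi / 2)) a b <= threshold m.
Proof.
have : ~ lim_sup_set (bad m0 p) phi.
  by move=> h; apply: good; exists m0 => //; exists p.
move=> /existsNP[n /not_implyP[_ h]]; exists (m0 + n)%N => m g q mn act.
rewrite leNgt; apply/negP => ht; apply: h.
exists (m - m0)%N; first by rewrite /=; lia.
have e : (m0 + (m - m0) = m)%N by lia.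
rewrite /bad e -bigcup_seq; exists (g, q); first by rewrite /= mem_enum.
by rewrite /large act.
Qed.

(** The phase integral is Lipschitz in xi, with a constant proportional to the norm of phi, so
    moving xi to the grid costs O(2^-m), less than the threshold. *)
Lemma good_dyadic : exists2 K, 0 <= K & exists M, forall m (xi : 'rV[R]_d) (q : 'I_2),
  (M <= m)%N -> 32^-1 <= `|xi| * amp m <= 1 ->
  `|phase_integral phi xi (q%:R * (pi / 2)) a b| <= K * (m.+1%:R / 2 ^+ m).
Proof.
have [M1 HM1] := good_grid.
have rp := rate_gt0.
exists (8 * T * rate + d%:R * `|phi| * (b - a)).
  by rewrite addr_ge0 ?mulr_ge0 ?subr_ge0// ltW.
(* From M2 on, the mesh 2^-m is at most 1 / (64 amp m), so rounding leaves at least half of the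
   lower bound 1 / (32 amp m). *)
pose M2 := Num.truncn (64 * T `^ delta).
exists (maxn M1 M2) => m xi q; rewrite geq_max => /andP[mM1 mM2] /andP[x1 x2].
have a0 := amp_gt0 m; have p0 : (0 : R) < 2 ^+ m by rewrite exprn_gt0.
have am : 64 * amp m <= 2 ^+ m.
  apply: (@le_trans _ _ (64 * T `^ delta)); first by rewrite ler_wpM2l// amp_le.
  apply: (@le_trans _ _ M2.+1%:R); first by rewrite ltW// truncnS_gt.
  by rewrite -natrX ler_nat (leq_ltn_trans mM2)// ltn_expl.
have rad : (2 ^+ m : R) <= (radius m)%:R * amp m.
  apply: (@le_trans _ _ ((radius m)%:R * (scale%:R * 32 ^+ m)^-1)); last first.
    by rewrite ler_wpM2l// amp_ge.
  rewrite ler_pdivlMr ?mulr_gt0 ?exprn_gt0// mulrCA -exprMn /radius natrM natrX.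
  rewrite ler_wpM2l// le_eqVlt; apply/orP; left; apply/eqP; congr (_ ^+ m); ring.
have [i|g Hg] := @grid_round m xi.
  apply: (@le_trans _ _ (`|xi| * 2 ^+ m)); first by rewrite ler_wpM2r ?norm_coord// ltW.
  apply: (@le_trans _ _ (`|xi| * ((radius m)%:R * amp m))); first by rewrite ler_wpM2l.
  by rewrite mulrCA ler_piMr.
have act : active m (grid g).
  have [i xi_i] : exists i, (32 * amp m)^-1 <= `|xi 0 i|.
    apply: norm_attained; first by rewrite invr_gt0 mulr_gt0.
    by rewrite invfM ler_pdivrMr.
  have [h1 h2] := Hg i; apply/existsP; exists i; rewrite normrM (gtr0_norm a0); apply/andP; split.
    have h3 : `|xi 0 i| - `|grid g 0 i| <= 2 ^- m by apply: le_trans (lerB_dist _ _) h1.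
    rewrite -ler_pdivrMr//.
    have c0 : 0 < 64 * amp m by rewrite mulr_gt0.
    have h4 : 2 ^- m <= (64 * amp m)^-1 :> R by rewrite lef_pV2.
    move: xi_i h4; rewrite !invfM; lra.
  apply: le_trans x2; apply: ler_wpM2r; first exact: ltW.
  exact: le_trans h2 (norm_coord _ _).
have pg : `|phase_integral phi (grid g) (q%:R * (pi / 2)) a b| <= threshold m.
  have q1 : (q < 4)%N by exact: leq_trans (ltn_ord q) _.
  have q2 : (q + 2 < 4)%N by rewrite (ltn_add2r 2 q 2).
  rewrite ler_norml; apply/andP; split; last exact: (HM1 m g (Ordinal q1) mM1 act).
  have := HM1 m g (Ordinal q2) mM1 act; rewrite /= natrD mulrDl.
  have -> : 2%:R * (pi / 2) = pi :> R by field.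
  by rewrite phase_integral_pi lerNl.
have dist := @phase_integral_freq phi xi (grid g) (q%:R * (pi / 2)) a b (2 ^- m) ab (fun i => (Hg i).1).
have -> : phase_integral phi xi (q%:R * (pi / 2)) a b =
  phase_integral phi xi (q%:R * (pi / 2)) a b - phase_integral phi (grid g) (q%:R * (pi / 2)) a b +
  phase_integral phi (grid g) (q%:R * (pi / 2)) a b by rewrite subrK.
apply: le_trans (ler_normD _ _) _; rewrite addrC [leRHS]mulrDl.
apply: lerD.
  apply: le_trans pg _; rewrite /threshold le_eqVlt; apply/orP; left; apply/eqP; ring.
apply: le_trans dist _.
have -> : d%:R * 2 ^- m * `|phi| * (b - a) = (d%:R * `|phi| * (b - a)) * 2 ^- m by ring.
rewrite ler_wpM2l ?mulr_ge0 ?subr_ge0// ler_peMl ?invr_ge0 ?(ltW p0)// ler1n.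
by [].
Qed.

(** Take the first m with |xi| * amp m <= 1; [amp_ratio] and minimality put xi in the window. Then
    (1 + |xi|)^beta is at most of order (m + 1)^(3 beta) 4^(delta beta m), and its product with (m +
    1) / 2^m is bounded because 2 beta delta < 1. The finitely many low levels concern bounded
    frequencies, for which the trivial bound b - a suffices. *)
Lemma good_decay (beta : R) : 0 <= beta -> 2 * beta * delta < 1 ->
  exists2 C, 0 <= C & forall (xi : 'rV[R]_d) (q : 'I_2),
  `|phase_integral phi xi (q%:R * (pi / 2)) a b| <= C * (1 + `|xi|) `^ (- beta).
Proof.
move=> be0 bed; have [K K0 [M HM]] := good_dyadic.
have r0 : 0 < 1 - 2 * beta * delta by lra.
have s0 : 0 <= 3 * beta + 1 by lra.
have [C C0 HC] := natr_powR_geometric s0 r0.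
pose B1 := (b - a) * (1 + scale%:R * 32 ^+ M) `^ beta.
pose B2 := K * ((1 + T `^ delta) `^ beta * (T `^ (- (delta * beta)) * C)).
have B10 : 0 <= B1 by rewrite mulr_ge0 ?powR_ge0 ?subr_ge0.
have B20 : 0 <= B2 by rewrite !mulr_ge0 ?powR_ge0.
exists (B1 + B2) => [|xi q]; first exact: addr_ge0.
have x1 : 0 < 1 + `|xi| by rewrite ltr_pwDl.
rewrite powRN ler_pdivlMr ?powR_gt0//.
have ex : exists m, `|xi| * amp m <= 1.
  pose m := Num.truncn (`|xi| * T `^ delta).
  exists m; apply: (@le_trans _ _ (`|xi| * (T `^ delta / m.+1%:R))).
    by rewrite ler_wpM2l// amp_le_inv.
  by rewrite mulrA ler_pdivrMr ?ltr0n// mul1r ltW// truncnS_gt.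
case: (ex_minnP ex) => m Pm mmin.
have a0 := amp_gt0 m; have p0 : (0 : R) < 2 ^+ m by rewrite exprn_gt0.
have xm : `|xi| <= (amp m)^-1 by rewrite -[leRHS]mul1r ler_pdivlMr.
have [mM|Mm] := leqP m M.
  apply: (@le_trans _ _ B1); last by rewrite lerDl.
  rewrite /B1 ler_pM ?powR_ge0// ?phase_integral_norm//.
  rewrite ge0_ler_powR ?nnegrE ?addr_ge0 ?mulr_ge0 ?exprn_ge0// lerD2l.
  apply: le_trans xm _; rewrite invf_ple ?posrE ?a0 ?mulr_gt0 ?exprn_gt0//.
  apply: le_trans (amp_ge m); rewrite lef_pV2 ?posrE ?mulr_gt0 ?exprn_gt0//.
  by rewrite ler_wpM2l// ler_weXn2l// ler1n.
apply: (@le_trans _ _ B2); last by rewrite lerDr.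
have m1 : 32^-1 <= `|xi| * amp m.
  rewrite leNgt; apply/negP => h.
  have : `|xi| * amp m.-1 <= 1.
    apply: (@le_trans _ _ (`|xi| * (32 * amp m))).
      by rewrite ler_wpM2l// -{2}(@prednK m) ?amp_ratio// (leq_ltn_trans _ Mm).
    by rewrite mulrCA; lra.
  by move=> /mmin; rewrite leqNgt ltn_predL (leq_ltn_trans _ Mm).
have hK := HM m xi q (ltnW Mm); rewrite m1 Pm in hK; have {}hK := hK isT.
have hx : (1 + `|xi|) `^ beta <= (1 + T `^ delta) `^ beta * (T `^ (- (delta * beta)) *
    (m.+1%:R `^ (3 * beta) * 2 `^ (2 * beta * delta * m%:R))).
  apply: (@le_trans _ _ (((1 + T `^ delta) / amp m) `^ beta)).
    rewrite ge0_ler_powR ?nnegrE ?divr_ge0 ?addr_ge0 ?powR_ge0 ?(ltW a0)//.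
    rewrite ler_pdivlMr// mulrDl mul1r addrC lerD ?amp_le//.
  rewrite powRM ?addr_ge0 ?powR_ge0 ?invr_ge0 ?(ltW a0)// ler_wpM2l ?powR_ge0//.
  rewrite le_eqVlt; apply/orP; left; apply/eqP.
  rewrite /amp invfM invrK powRM ?exprn_ge0 ?invr_ge0 ?powR_ge0//.
  rewrite -powRN -powRrM /step powRM ?(ltW T_gt0) ?invr_ge0 ?exprn_ge0// mulNr -mulrA.
  congr (_ * _); rewrite mulrC; congr (_ * _).
    by rewrite -powR_mulrn// -powRrM.
  have -> : (4 : R) ^+ m = 2 `^ (2 * m%:R).
    have h4 : (2 : R) `^ 2 = 4 by rewrite (powR_mulrn 2)// -natrX.
    by rewrite powRrM h4 powR_mulrn.
  by rewrite -powRN -powRrM; congr (_ `^ _); ring.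
apply: le_trans (ler_pM _ _ hK hx) _; rewrite ?powR_ge0//.
rewrite -[X in X <= _]mulrA ler_wpM2l//.
set X := (1 + T `^ delta) `^ beta; set Y := T `^ (- (delta * beta)).
have -> : m.+1%:R / 2 ^+ m * (X * (Y * (m.+1%:R `^ (3 * beta) * 2 `^ (2 * beta * delta * m%:R)))) =
  X * (Y * ((m.+1%:R * m.+1%:R `^ (3 * beta)) * (2 `^ (2 * beta * delta * m%:R) / 2 ^+ m))) by ring.
rewrite ler_wpM2l ?powR_ge0// ler_wpM2l ?powR_ge0//.
have -> : m.+1%:R * m.+1%:R `^ (3 * beta) = m.+1%:R `^ (3 * beta + 1).
  by rewrite powRD ?powRr1 1?mulrC//; apply/implyP; rewrite pnatr_eq0.
apply: le_trans (ler_wpM2r _ (HC m)) _; first by rewrite divr_ge0 ?powR_ge0// ltW.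
rewrite -[leLHS]mulrA ler_piMr// -(powR_mulrn m (ler0n R 2)) -powRN -!powRD ?pnatr_eq0 ?implybT//.
rewrite (_ : _ + _ = 0) ?powRr0//; ring.
Qed.

End good_path.

Lemma Rintegral_pushforward_mrestr d1 d2 (X : measurableType d1) (Y : measurableType d2)
    (mu : {measure set X -> \bar R}) (D : set X) (mD : measurable D) (g : X -> Y) (f : Y -> R)
    (mg : measurable_fun setT g) : (mu D < +oo)%E -> bmeas setT f ->
  fine (\int[pushforward (mrestr mu mD) g]_y (f y)%:E)%E = \int[mu]_(x in D) f (g x).
Proof.
move=> muD [mf [M fM]].
have mE : measurable_fun setT (EFin \o f) by exact/measurable_EFinP.
have mfg : measurable_fun setT (f \o g) := measurableT_comp mf mg.
have fin : (mrestr mu mD setT < +oo)%E by rewrite /mrestr setTI.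
have int : (mrestr mu mD).-integrable setT (EFin \o (f \o g)).
  by apply: bmeas_integrable => //; split => //; exists M => x _; exact: fM.
rewrite integral_pushforward// preimage_setT.
rewrite (@negligible_integral _ _ _ _ setT (~` D))//; last 2 first.
- exact: measurableC.
- by rewrite /= /mrestr setICl measure0.
congr fine; rewrite setTD setCK; apply: eq_measure_integral => A mA AD /=.
by rewrite /mrestr; congr (mu _); apply/setIidPl.
Qed.

(** * Occupation measures *)

Definition occupation (phi : E) (a b : R) : set (borelType 'rV[R]_d) -> \bar R :=
  pushforward (mrestr lebesgue_measure (measurable_itv `[a, b[)) (lift_path phi : R -> borelType 'rV[R]_d).

Lemma measurable_lift_path (phi : E) : measurable_fun setT (lift_path phi : R -> borelType 'rV[R]_d).
Proof. by apply: continuous_real_borel_measurable; exact: lift_path_continuous. Qed.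

Section occupation_measure.
Context (phi : E) (a b : R).

Let occupation_measure : {measure set (borelType 'rV[R]_d) -> \bar R} :=
  measure_function_pushforward__canonical__measure_function_Measure
    (mrestr lebesgue_measure (measurable_itv `[a, b[)) (measurable_lift_path phi).

HB.instance Definition _ := isMeasure.Build _ _ _ (occupation phi a b)
  (measure0 occupation_measure) (measure_ge0 occupation_measure)
  (@measure_semi_sigma_additive _ _ _ occupation_measure).

Lemma occupation_setT : occupation phi a b setT = lebesgue_measure (`[a, b[%classic : set R).
Proof. by rewrite /occupation /pushforward /mrestr preimage_setT setTI. Qed.

Lemma occupation_finite : fin_num_fun (occupation phi a b).
Proof.
move=> A mA; rewrite ge0_fin_numE ?measure_ge0//.
apply: le_lt_trans (lebesgue_co_lty a b); rewrite -occupation_setT.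
by apply: le_measure; rewrite ?inE//; exact: measurableT.
Qed.

HB.instance Definition _ := @Measure_isFinite.Build _ _ _ (occupation phi a b) occupation_finite.

Lemma Rintegral_occupation (f : borelType 'rV[R]_d -> R) : bmeas setT f ->
  \int[occupation phi a b]_x f x = \int[lebesgue_measure]_(r in `[a, b[) f (lift_path phi r).
Proof.
exact: (@Rintegral_pushforward_mrestr _ _ _ (borelType 'rV[R]_d) lebesgue_measure
  (`[a, b[%classic : set R) (measurable_itv `[a, b[) (lift_path phi) f (measurable_lift_path phi)
  (lebesgue_co_lty a b)).
Qed.

Lemma fcos_occupation xi : fcos (occupation phi a b) xi = phase_integral phi xi 0 a b.
Proof.
rewrite /fcos Rintegral_occupation; last by apply: bmeas_cos; exact: measurable_dotv.
by apply: eq_Rintegral => r _; rewrite addr0.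
Qed.

Lemma fsin_occupation xi : fsin (occupation phi a b) xi = - phase_integral phi xi (pi / 2) a b.
Proof.
rewrite /fsin Rintegral_occupation; last by apply: bmeas_sin; exact: measurable_dotv.
rewrite /phase_integral -[RHS]mulN1r -bmeas_RintegralZ//.
- by apply: eq_Rintegral => r _; rewrite cosDpihalf mulN1r opprK.
- exact: lebesgue_co_lty.
- exact: bmeas_phase.
Qed.

Lemma occupation_Mplus (A : set 'rV[R]_d) : a < b -> lift_path phi @` `[a, b[ `<=` A ->
  Mplus A (occupation phi a b).
Proof.
move=> ab sub; split.
  have : (0 < occupation phi a b [set: borelType 'rV[R]_d])%E by rewrite occupation_setT
    lebesgue_measure_itv /= lte_fin ab -EFinB lte_fin subr_gt0.
  by [].
have e : lift_path phi @^-1` (~` A) `&` `[a, b[%classic = set0.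
  by apply/seteqP; split => r //= [h rab]; apply: h; apply: sub; exists r.
have : occupation phi a b (~` A : set (borelType 'rV[R]_d)) = 0%E.
  by rewrite /occupation /pushforward /mrestr e measure0.
by [].
Qed.

End occupation_measure.

(** * Images of good paths *)

Section good_image.
Context (phi : E).
Hypothesis (good : ~ exceptional phi).

Lemma path_imageE (s t : R) : 0 <= s -> t <= T -> path_image phi s t = lift_path phi @` `[s, t].
Proof.
move=> s0 tT; apply/seteqP; split => [_ [u /= ust <-]|_ [r /= + <-]].
  exists (val u); first by rewrite /= in_itv.
  by rewrite /lift_path clamp_val.
rewrite in_itv /= => /andP[sr rt]; exists (clamp r) => //.
have rT : 0 <= r <= T by rewrite (le_trans s0 sr) (le_trans rt tT).
have : s <= val (clamp r) <= t by rewrite (val_clamp rT) sr rt.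
by [].
Qed.

Lemma lift_path_image_compact (s t : R) : compact (lift_path phi @` `[s, t]).
Proof.
apply: continuous_compact; last exact: segment_compact.
by apply: continuous_subspaceT; exact: lift_path_continuous.
Qed.

(** Cells of at most half the length t - s are taken, and the first one that starts after s fits. *)
Lemma dyadic_subinterval (s t : R) : 0 <= s -> s < t -> t <= T ->
  exists m p, [/\ (p < 4 ^ m)%N, s <= step m * p%:R & step m * p.+1%:R <= t].
Proof.
move=> s0 st tT; have ts : 0 < t - s by rewrite subr_gt0.
pose m := Num.truncn (2 * T / (t - s)); have h0 := step_gt0 m.
have hm : 2 * step m <= t - s.
  rewrite /step mulrA ler_pdivrMr ?exprn_gt0// [leRHS]mulrC -ler_pdivrMr//.
  apply: (@le_trans _ _ m.+1%:R); first by rewrite ltW// truncnS_gt.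
  by rewrite -natrX ler_nat ltn_expl.
pose p := (Num.truncn (s / step m)).+1.
have /andP[p1 p2] : p.-1%:R <= s / step m < p%:R.
  by apply: truncn_itv; rewrite divr_ge0// ltW.
rewrite ler_pdivlMr// in p1; rewrite ltr_pdivrMr// in p2.
have pE : p%:R = p.-1%:R + 1 :> R by rewrite natr1.
have pt : step m * p.+1%:R <= t by rewrite -natr1 pE mulrC !mulrDl !mul1r; lra.
exists m, p; split => //; last by rewrite mulrC ltW.
rewrite -(ltr_nat R) -(ltr_pM2l h0); apply: (@lt_le_trans _ _ (step m * p.+1%:R)).
  by rewrite ltr_pM2l// ltr_nat.
apply: le_trans pt _; apply: le_trans tT _.
by rewrite natrX /step divfK// expf_neq0.
Qed.

Lemma occupation_decay m p (beta : R) : (p < 4 ^ m)%N -> 0 <= beta -> 2 * beta * delta < 1 ->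
  exists2 C, 0 <= C & forall xi,
    `|fcos (occupation phi (step m * p%:R) (step m * p.+1%:R)) xi| <= C * (1 + `|xi|) `^ (- beta) /\
    `|fsin (occupation phi (step m * p%:R) (step m * p.+1%:R)) xi| <= C * (1 + `|xi|) `^ (- beta).
Proof.
move=> pm be0 bed; have [C C0 HC] := good_decay good pm be0 bed.
exists C => // xi; rewrite fcos_occupation fsin_occupation normrN.
have := HC xi ord0; have := HC xi (lift ord0 ord0).
by rewrite /= /bump /= mul0r mul1r.
Qed.

Lemma occupation_fourier_decay m p alpha : (p < 4 ^ m)%N -> 0 <= alpha -> alpha * delta < 1 ->
  (fourier_decay alpha (occupation phi (step m * p%:R) (step m * p.+1%:R)) < +oo)%E.
Proof.
move=> pm al0 ald.
have [||C C0 HC] := @occupation_decay m p (alpha / 2) pm; first by rewrite divr_ge0.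
  by have -> : 2 * (alpha / 2) * delta = alpha * delta by field.
apply: (@le_lt_trans _ _ ((1 + d%:R) `^ (alpha / 2) * (2 * C))%:E); last exact: ltry.
apply: ge_ereal_sup => _ [xi _ <-]; rewrite lee_fin.
have x0 : 0 <= 1 + `|xi| by rewrite addr_ge0.
have hn : ComplexField.Normc.normc (fourier (occupation phi (step m * p%:R) (step m * p.+1%:R)) xi)
    <= 2 * C * (1 + `|xi|) `^ (- (alpha / 2)).
  have [h1 h2] := HC xi; rewrite /fourier /=.
  rewrite -/(fcos _ xi) -/(fsin _ xi); set u := fcos _ xi in h1 *; set v := fsin _ xi in h2 *.
  set z := _ `^ _ in h1 h2 *.
  apply: (@le_trans _ _ (`|u| + `|v|)); last first.
    have -> : 2 * C * z = C * z + C * z by ring.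
    exact: lerD h1 h2.
  rewrite -(ler_pXn2r (n := 2)) ?nnegrE ?sqrtr_ge0 ?addr_ge0// sqr_sqrtr ?addr_ge0 ?sqr_ge0//.
  rewrite sqrrD -(real_normK (num_real u)) -(real_normK (num_real v)).
  by rewrite addrAC lerDl mulrn_wge0// mulr_ge0.
have he : (1 + euclid xi ^+ 2) `^ (alpha / 4) <= (1 + d%:R) `^ (alpha / 2) * (1 + `|xi|) `^ (alpha / 2).
  rewrite -powRM ?addr_ge0//.
  have -> : ((1 + d%:R) * (1 + `|xi|)) `^ (alpha / 2) = (((1 + d%:R) * (1 + `|xi|)) ^+ 2) `^ (alpha / 4).
    by rewrite -powR_mulrn ?mulr_ge0 ?addr_ge0// -powRrM; congr (_ `^ _); field.
  rewrite ge0_ler_powR ?nnegrE ?exprn_ge0 ?addr_ge0 ?mulr_ge0 ?euclid_ge0 ?divr_ge0//.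
  have e0 := euclid_ge0 xi; have e1 := ler_euclid_norm xi; have n0 := normr_ge0 xi.
  have d0 : 0 <= d%:R :> R by [].
  have : euclid xi ^+ 2 <= (d%:R * `|xi|) ^+ 2 by rewrite lerXn2r ?nnegrE ?mulr_ge0.
  move: d0 n0; set dd := d%:R; set n := `|xi|; move=> d0 n0 h.
  have dn : 0 <= dd * n by rewrite mulr_ge0.
  have -> : (1 + dd) * (1 + n) = 1 + dd + n + dd * n by ring.
  apply: (@le_trans _ _ ((1 + dd * n) ^+ 2)); last by rewrite lerXn2r ?nnegrE; lra.
  rewrite sqrrD expr1n mul1r; move: h; set q := _ ^+ 2; set q' := _ ^+ 2; lra.
apply: le_trans (ler_pM _ _ he hn) _; first exact: powR_ge0.
  by case: (fourier _ _) => u v /=; exact: sqrtr_ge0.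
set A1 := (1 + d%:R) `^ _; set A2 := _ `^ (alpha / 2).
have -> : A1 * A2 * (2 * C * (1 + `|xi|) `^ (- (alpha / 2))) =
   A1 * (2 * C) * (A2 * (1 + `|xi|) `^ (- (alpha / 2))) by ring.
rewrite powRN divff ?mulr1//.
by rewrite gt_eqF// powR_gt0// ltr_pwDl.
Qed.

Lemma cell_image_sub (s t : R) m p : s <= step m * p%:R -> step m * p.+1%:R <= t ->
  lift_path phi @` `[step m * p%:R, step m * p.+1%:R[ `<=` lift_path phi @` `[s, t].
Proof.
move=> h1 h2 _ [r /= + <-]; rewrite in_itv /= => /andP[r1 r2]; exists r => //=.
by rewrite in_itv /= (le_trans h1 r1) ltW// (lt_le_trans r2 h2).
Qed.

Lemma step_cell_lt m p : step m * p%:R < step m * p.+1%:R.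
Proof. by rewrite ltr_pM2l ?step_gt0// ltr_nat. Qed.

Lemma dim_F_image_ge (s t : R) alpha : 0 <= s -> s < t -> t <= T ->
  0 <= alpha <= d%:R -> alpha * delta < 1 -> alpha <= dim_F (lift_path phi @` `[s, t]).
Proof.
move=> s0 st tT ald aldl; have [m [p [pm h1 h2]]] := dyadic_subinterval s0 st tT.
apply: (le_dim_F (mu := occupation phi (step m * p%:R) (step m * p.+1%:R))) => //.
  apply: occupation_Mplus; first exact: step_cell_lt.
  exact: cell_image_sub.
by apply: occupation_fourier_decay => //; case/andP: ald.
Qed.

Lemma dim_H_image_le (s t : R) : 0 <= s -> s < t -> t <= T -> 0 < delta ->
  dim_H (lift_path phi @` `[s, t]) <= delta^-1.
Proof.
move=> s0 st tT d0.
apply: (@dim_H_holder_image R d (lift_path phi) s t (holder_seminorm delta phi + 1) delta) => //.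
- by rewrite ltr_wpDl// holder_seminorm_ge0.
- exact: lift_path_continuous.
- move=> u v /andP[su ut] /andP[sv vt].
  have := le_holder_seminorm (clamp u) (clamp v) (holder_funP phi) d0.
  rewrite !val_clamp ?(le_trans s0 su) ?(le_trans ut tT) ?(le_trans s0 sv) ?(le_trans vt tT)//.
  move=> h; apply: le_trans h _; rewrite ler_wpM2r ?powR_ge0//.
  by rewrite lerDl.
Qed.

Lemma dim_image (s t : R) : (0 < d)%N -> 0 <= s -> s < t -> t <= T ->
  ((dim_F (path_image phi s t))%:E = mine (delta%:E)^-1 d%:R%:E /\
   (dim_H (path_image phi s t))%:E = mine (delta%:E)^-1 d%:R%:E)%E.
Proof.
move=> dpos s0 st tT; rewrite path_imageE//.
set A := _ @` _; have FH := dim_F_le_dim_H A dpos; have Hd := dim_H_le A.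
have F0 : 0 <= dim_F A by apply: sup_ge0 => x [/andP[]].
have lower alpha := @dim_F_image_ge s t alpha s0 st tT; rewrite -/A in lower.
rewrite inver; have [de0|den0] := eqVneq delta 0.
  (* For delta = 0 the exponent d itself is admissible. For delta > 0 the value 1 / delta is only
     approached, hence the midpoint argument further on. *)
  have dF : d%:R <= dim_F A by apply: lower; rewrite ?lexx ?ler0n// de0 mulr0.
  have -> : mine +oo%E (d%:R%:E : \bar R) = d%:R%:E by rewrite minC min_l// leey.
  by split; congr EFin; apply/le_anti/andP; split => //;
    [exact: le_trans FH Hd|exact: le_trans dF FH].
have de0 : 0 < delta by rewrite lt_def den0.
have Hde : dim_H A <= delta^-1 := dim_H_image_le s0 st tT de0.
rewrite -EFin_min; set M := Num.min _ _.
have HM : dim_H A <= M by rewrite le_min Hde Hd.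
have MF : M <= dim_F A.
  rewrite leNgt; apply/negP => FM.
  have Md : M <= d%:R by rewrite ge_min lexx orbT.
  have Mde : M <= delta^-1 by rewrite ge_min lexx.
  have h1 : 0 <= (dim_F A + M) / 2 <= d%:R by apply/andP; split; lra.
  have h2 : (dim_F A + M) / 2 * delta < 1 by rewrite -ltr_pdivlMr// div1r; lra.
  by have := lower _ h1 h2; lra.
by split; congr EFin; apply/le_anti/andP; split => //;
  [exact: le_trans FH HM|exact: le_trans MF FH].
Qed.

Lemma decay_ge a (xi : 'rV[R]_d) : 0 <= a -> (1 + `|xi|) `^ (- (a * d%:R)) <= decay a xi.
Proof.
move=> a0; have x0 : 0 <= 1 + `|xi| by rewrite addr_ge0.
have -> : (1 + `|xi|) `^ (- (a * d%:R)) = \prod_(j < d) (1 + `|xi|) `^ (- a).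
  by rewrite prodr_const card_ord -mulNr powRrM powR_mulrn// powR_ge0.
apply: ler_prod => j _; rewrite powR_ge0 /=.
rewrite /decay1; apply: ler_powRN; [by []|by rewrite ltr_pwDl|].
by rewrite lerD2l norm_coord.
Qed.

Lemma open_image (s t : R) : (0 < d)%N -> delta < (2 * d%:R)^-1 -> 0 <= s -> s < t -> t <= T ->
  exists U : set 'rV[R]_d, [/\ open U, U !=set0 & U `<=` path_image phi s t].
Proof.
move=> dpos ded s0 st tT; rewrite path_imageE//.
have d0 : (0 : R) < d%:R by rewrite ltr0n.
have dd : 2 * d%:R * delta < 1 by rewrite mulrC -ltr_pdivlMr ?mulr_gt0// div1r.
pose c0 := (s + t) / 2.
have half : (0 : R) < 2^-1 by rewrite invr_gt0.
have := @lift_path_continuous phi c0; move=> /cvgrPdist_lt/(_ _ half)/nbhs_ballP[e /= e0 He].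
(* The time interval shrinks around its midpoint until the image has width at most 1 in each
   coordinate, as the periodic kernels behind [exists_open_subset_pos] require. *)
pose s' := Num.max s (c0 - e / 2); pose t' := Num.min t (c0 + e / 2).
have ss' : s <= s' by rewrite le_max lexx.
have tt' : t' <= t by rewrite ge_min lexx.
have st' : s' < t' by rewrite lt_min !gt_max st /= /c0; apply/andP; split; [lra|apply/andP; split; lra].
have [m [p [pm h1 h2]]] := dyadic_subinterval (le_trans s0 ss') st' (le_trans tt' tT).
set q := 2 * d%:R * delta in dd; have q0 : 0 <= q by rewrite !mulr_ge0.
(* Halfway between 1 and 2 - q: a > 1 gives the interior, and 2 (a d) delta = a q = q (3 - q) / 2 <
   1 since q < 1. *)
pose a := 1 + (1 - q) / 2.
have a12 : 1 < a <= 2 by rewrite /a; apply/andP; split; lra.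
have a0 : 0 <= a by case/andP: a12; lra.
have [||C C0 HC] := @occupation_decay m p (a * d%:R) pm; first by rewrite mulr_ge0.
  have -> : 2 * (a * d%:R) * delta = a * q by rewrite /q; ring.
  by rewrite /a; nra.
pose A := lift_path phi @` `[step m * p%:R, step m * p.+1%:R].
have AM : Mplus A (occupation phi (step m * p%:R) (step m * p.+1%:R)).
  apply: occupation_Mplus; first exact: step_cell_lt.
  move=> _ [r /= + <-]; rewrite in_itv /= => /andP[r1 r2].
  by exists r => //=; rewrite in_itv /= r1 ltW.
have cA : compact A by exact: lift_path_image_compact.
have [||x y [r /= rI <-] [r' /= rI' <-] j|U [oU U0 UA]] :=
  exists_open_subset_pos dpos cA AM a12 C0.
- by move=> xi; apply: le_trans (HC xi).1 _; rewrite ler_wpM2l// decay_ge.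
- by move=> xi; apply: le_trans (HC xi).2 _; rewrite ler_wpM2l// decay_ge.
- have near z : z \in `[step m * p%:R, step m * p.+1%:R] ->
      `|lift_path phi c0 0 j - lift_path phi z 0 j| <= 2^-1.
    rewrite in_itv /= => /andP[z1 z2].
    have -> : lift_path phi c0 0 j - lift_path phi z 0 j = (lift_path phi c0 - lift_path phi z) 0 j.
      by rewrite !mxE.
    apply: le_trans (norm_coord _ _) _; apply: ltW; apply: He.
    have : s' <= z <= t' by rewrite (le_trans h1 z1) (le_trans z2 h2).
    rewrite /s' /t' ge_max le_min => /andP[/andP[_ g1] /andP[_ g2]].
    by rewrite -ball_normE /= ltr_norml; apply/andP; split; lra.
  have n1 := near _ rI; have n2 := near _ rI'.
  have -> : lift_path phi r 0 j - lift_path phi r' 0 j =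
    (lift_path phi c0 0 j - lift_path phi r' 0 j) - (lift_path phi c0 0 j - lift_path phi r 0 j).
    by ring.
  by apply: le_trans (ler_normB _ _) _; lra.
- exists U; split => //; apply: subset_trans UA _ => _ [r /= + <-].
  rewrite in_itv /= => /andP[r1 r2]; exists r => //=; rewrite in_itv /=.
  by rewrite (le_trans ss' (le_trans h1 r1)) (le_trans r2 (le_trans h2 tt')).
Qed.

Lemma salem_range : (0 < d)%N -> salem (range phi).
Proof.
move=> dpos.
have -> : range phi = path_image phi 0 T.
  apply/seteqP; split => _ [u _ <-]; exists u => //=.
  by have := set_valP u; rewrite /time /= in_itv.
have [h1 h2] := @dim_image 0 T dpos (lexx _) T_gt0 (lexx _).
split; last by apply: EFin_inj; rewrite h1 h2.
rewrite path_imageE//; apply: compact_borel; exact: lift_path_image_compact.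
Qed.

End good_image.

End random_paths.


Lemma exists_expr_le_half (R : realType) (c : R) : 0 <= c < 1 -> exists n : nat, c ^+ n <= 2^-1.
Proof.
move=> /andP[c0 c1]; have : c ^+ n @[n --> \oo] --> 0.
  by apply: cvg_expr; rewrite ger0_norm.
have half : (0 : R) < 2^-1 by rewrite invr_gt0.
move=> /cvgrPdist_le/(_ _ half)[n _ /(_ n (leqnn n))] /=.
by rewrite sub0r normrN ger0_norm ?exprn_ge0//; exists n.
Qed.

Theorem theorem34 (R : realType) (T : R) (d : nat) (delta : R)
    (T_gt0 : 0 < T) (d_ge1 : (1 <= d)%N) (delta01 : 0 <= delta < 1) :
  [/\ almost_every (fun phi : holder T d delta =>
        forall s t : R, 0 <= s -> s < t -> t <= T ->
          ((dim_F (path_image phi s t))%:E = mine (delta%:E)^-1 d%:R%:E /\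
           (dim_H (path_image phi s t))%:E = mine (delta%:E)^-1 d%:R%:E)%E),
      delta < (2 * d%:R)^-1 ->
        almost_every (fun phi : holder T d delta =>
          forall s t : R, 0 <= s -> s < t -> t <= T ->
            exists U : set 'rV[R]_d,
              [/\ open U, U !=set0 & U `<=` path_image phi s t]) &
      almost_every (fun phi : holder T d delta => salem (range phi))].
Proof.
(* The bound c comes before the construction: it determines the number L of signs per cell, hence
   the random path and its exceptional set. *)
have [c c01 cos_le] := @cos_lt1_bound R.
have [L cL] := exists_expr_le_half c01.
have shyA := exceptional_shy d T_gt0 delta01 c01 cL cos_le.
have ae (P : holder T d delta -> Prop) :
    (forall phi, ~ exceptional T_gt0 phi -> P phi) -> almost_every P.
  by move=> goodP; exists (exceptional T_gt0) => // phi; apply: contra_notP => /goodP.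
split=> [|ded|]; apply: ae => phi good.
- by move=> s t; exact: (dim_image delta01 good).
- by move=> s t; exact: (open_image delta01 good).
- exact: (salem_range delta01 good).
Qed.
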